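(* Let $\alpha\ge0$ be real. There is a positive constant $C<6\sqrt{2}$ such that $$\left|e^{-\mathrm{i}tH_\alpha}(n,m)\right|\le\frac{C\,|t|^{-1/2}}{\sqrt[4]{n+m+\alpha+1}}$$ for all $n,m\in\mathbb{N}_0$ and all real $t\neq0$.
   Context: $\mathbb{N}_0=\{0,1,2,\dots\}$. For $\alpha>-1$, $H_\alpha$ is the (self-adjoint) operator in $\ell^2(\mathbb{N}_0)$ with maximal domain $\{u\in\ell^2(\mathbb{N}_0): \tau_\alpha u\in\ell^2(\mathbb{N}_0)\}$ acting by $H_\alpha u=\tau_\alpha u$, where $$(\tau_\alpha u)_n=\sqrt{n(n+\alpha)}\,u_{n-1}+(2n+1+\alpha)u_n+\sqrt{(n+1)(n+1+\alpha)}\,u_{n+1},\qquad u_{-1}:=0.$$ $e^{-\mathrm{i}tH_\alpha}$ is the associated unitary group and $e^{-\mathrm{i}tH_\alpha}(n,m)=\langle\delta_n,e^{-\mathrm{i}tH_\alpha}\delta_m\rangle$ is its matrix entry with respect to the standard basis $(\delta_n)_{n\ge0}$. *)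

(* Defs.v *)
(* Stdlib reals with Coquelicot. *)
From Stdlib Require Import Reals.
From Coquelicot Require Import Coquelicot.
Open Scope R_scope.

(* The Hilbert space l^2(N_0) is represented by the sequences [u : nat -> C]
   satisfying [l2 u]. [Series] is total, so [inner] and [l2norm] are only
   meaningful on such sequences. *)
Definition l2 (u : nat -> C) : Prop :=
  ex_series (fun k => Cmod (u k) ^ 2).

Definition l2norm (u : nat -> C) : R :=
  sqrt (Series (fun k => Cmod (u k) ^ 2)).

(* Conjugate-linear in the first argument. *)
Definition inner (u v : nat -> C) : C :=
  (Series (fun k => Re (Cconj (u k) * v k)%C),
   Series (fun k => Im (Cconj (u k) * v k)%C)).

Definition delta (n : nat) : nat -> C :=
  fun k => if Nat.eqb k n then RtoC 1 else RtoC 0.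

(* Possibly unbounded operators in l^2; [app] is irrelevant outside [dom]. *)
Record operator : Type := Operator {
  dom : (nat -> C) -> Prop;
  app : (nat -> C) -> (nat -> C)
}.

Definition tau (alpha : R) (u : nat -> C) : nat -> C := fun n =>
  (RtoC (sqrt (INR n * (INR n + alpha)))
     * match n with O => RtoC 0 | S p => u p end
   + RtoC (2 * INR n + 1 + alpha) * u n
   + RtoC (sqrt ((INR n + 1) * (INR n + 1 + alpha))) * u (S n))%C.

Definition H (alpha : R) : operator :=
  Operator (fun u => l2 u /\ l2 (tau alpha u)) (tau alpha).

(* Unitary: a linear, inner product preserving map of l^2 onto l^2. *)
Record unitary (V : (nat -> C) -> (nat -> C)) : Prop := {
  unitary_l2 : forall u, l2 u -> l2 (V u);
  unitary_linear : forall (a b : C) u v, l2 u -> l2 v ->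
    V (fun k => a * u k + b * v k)%C = (fun k => a * V u k + b * V v k)%C;
  unitary_inner : forall u v, l2 u -> l2 v -> inner (V u) (V v) = inner u v;
  unitary_onto : forall v, l2 v -> exists u, l2 u /\ V u = v
}.

Record unitary_group (U : R -> (nat -> C) -> (nat -> C)) : Prop := {
  group_unitary : forall t, unitary (U t);
  group_0 : forall u, l2 u -> U 0 u = u;
  group_add : forall s t u, l2 u -> U (s + t) u = U s (U t u);
  group_continuous : forall t0 u, l2 u ->
    is_lim (fun t => l2norm (fun k => U t u k - U t0 u k)%C) t0 0
}.

(* [U t = exp (- i t A)] for all [t], in the sense of Stone's theorem: U is a
   strongly continuous unitary group whose infinitesimal generator is exactly
   [- i A], with equality of domains. For self-adjoint [A] there is exactly
   one such group on l^2. *)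
Definition is_exp_mit (A : operator) (U : R -> (nat -> C) -> (nat -> C)) : Prop :=
  unitary_group U /\
  forall u f, l2 u -> l2 f ->
    ((dom A u /\ app A u = f) <->
     is_lim (fun t => l2norm (fun k => (U t u k - u k) / RtoC t - (- Ci * f k))%C)
       0 0).

Definition matrix_entry (V : (nat -> C) -> (nat -> C)) (n m : nat) : C :=
  inner (delta n) (V (delta m)).

(* Main.v *)
(* Write [K n m t] for the matrix entry, [P = n + alpha] and [h_k^2 = (alpha + 1)_k / k!].  Up to a
   unimodular factor,
     [K n m t = (h_m / h_n) (1 + t^2)^(-(1 + P + m)/2) r],
   where [r] is the coefficient of [z^n] in [(1 + t z)^P (t - z)^m]: for fixed [n] both sides solve
   [i y_m' = (tau y)_m], for [m = 0] they agree by Green's identity with the geometrically decaying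
   solution, and then the recurrence in [m] determines everything.  Only [t > 0] is needed because
   [|K n m t| = |K m n (-t)|].

   The coefficient is estimated on the circle [|z| = rho], [rho^2 = (n + 1) / (m + alpha + 1)].  There
   [|1 + t z|^2] and [|t - z|^2] are proportional to [x] and [1 - x] with [x = x0 + kap cos th], so the
   integrand has modulus [sqrt (x^P (1 - x)^m)] up to a constant.  Since [dx = - kap sin th dth], cutting
   off short arcs at the two ends of the circle, where [sin th] is small, bounds the square of its
   integral by a multiple of [B(P + 1, m + 1) / kap].  This Beta value is combined with [h_m^2 / h_n^2] into
   [B(n + 1, m + alpha + 1)], for which an inequality of Stirling type gives the decay
   [(n + m + alpha + 1)^(-1/2)] of [|K|^2].

   When [alpha] is not an integer and [t rho > 1], the circle crosses the cut of [(1 + t z)^P].  The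
   contribution of the two sides of the cut is the integral of a function of [rho] growing at least
   like the solution of [g' = n g / (2 rho^2)], and it is dominated by its value at the end point. *)

(* Cauchy's formula is obtained by real calculus in the radius. Replacing z by z / t turns the
   generating function into (1 + z)^P (a - z)^m with a = t^2, whose branch point is -1; as it is
   real on the real axis near 0, the real part over the upper half circle suffices. If J is the arc
   integral at radius rho, the polar Cauchy-Riemann equations give J / rho^n the derivative I /
   rho^(n+1), with I the imaginary part at the end of the arc. It vanishes for the full half circle
   inside the unit disc and is the cut contribution outside. Ending the arc at PI - d keeps
   everything smooth while rho passes 1.

   The radius comes from a minimum. With b = m + alpha and rho^2 = a w, the dominant factor of the
   estimate is (1 + w)^(n + b) / w^n, smallest at w = n / b. Raising n and b by one matches the
   arguments n + 1 and b + 1 of the Beta function and stays finite at b = 0. The constants combine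
   to 80 sqrt 2 / PI^2 < 16 for the squared modulus, hence 4 in the theorem. *)
Require Import Defs.
From Stdlib Require Import Reals Lra Lia FunctionalExtensionality.
From Coquelicot Require Import Coquelicot.
Open Scope R_scope.

(** * Powers of [1 + z] on a circle *)

(* Modulus squared and principal argument of [w = 1 + rho e^(i th)]; the half angle formula
   [2 atan (y / (|w| + x))] is smooth off the cut [(-oo, 0]], where [circ_den] is positive. *)
Definition circ_sq (rho th : R) : R := 1 + 2 * rho * cos th + rho ^ 2.
Definition circ_den (rho th : R) : R := sqrt (circ_sq rho th) + (1 + rho * cos th).
Definition circ_arg (rho th : R) : R := 2 * atan (rho * sin th / circ_den rho th).

(* Real and imaginary part of [(1 + rho e^(i th))^P e^(- i kap th)]. *)
Definition circ_re (P kap rho th : R) : R :=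
  Rpower (circ_sq rho th) (P / 2) * cos (P * circ_arg rho th - kap * th).
Definition circ_im (P kap rho th : R) : R :=
  Rpower (circ_sq rho th) (P / 2) * sin (P * circ_arg rho th - kap * th).

Lemma circ_sq_eq (rho th : R) : circ_sq rho th = (1 + rho * cos th) ^ 2 + (rho * sin th) ^ 2.
Proof.
unfold circ_sq.
assert (H := sin2_cos2 th); unfold Rsqr in H.
replace ((1 + rho * cos th) ^ 2 + (rho * sin th) ^ 2)
  with (1 + 2 * rho * cos th + rho ^ 2 * (sin th * sin th + cos th * cos th)) by ring.
rewrite H; ring.
Qed.

Lemma circ_sq_nonneg (rho th : R) : 0 <= circ_sq rho th.
Proof. rewrite circ_sq_eq; apply Rplus_le_le_0_compat; apply pow2_ge_0. Qed.

Lemma circ_sq_pos (rho th : R) : 0 < circ_den rho th -> 0 < circ_sq rho th.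
Proof.
intros H.
destruct (Rle_lt_or_eq_dec _ _ (circ_sq_nonneg rho th)) as [h|h]; [exact h|].
exfalso. unfold circ_den in H. rewrite <- h, sqrt_0 in H.
rewrite circ_sq_eq in h.
assert (h1 := pow2_ge_0 (rho * sin th)). nra.
Qed.

Lemma circ_den_pos_small (rho th : R) : Rabs rho < 1 -> 0 < circ_den rho th.
Proof.
intros H. unfold circ_den.
assert (h := sqrt_pos (circ_sq rho th)).
enough (Rabs (rho * cos th) < 1) by (apply Rabs_def2 in H0; lra).
rewrite Rabs_mult. assert (h1 : Rabs (cos th) <= 1) by (apply Rabs_le, COS_bound).
assert (h2 := Rabs_pos rho). nra.
Qed.

Lemma circ_den_pos (rho th : R) : 0 <= rho -> - PI < th < PI -> 0 < circ_den rho th.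
Proof.
intros HR Hth. unfold circ_den.
destruct (Rlt_le_dec 0 (1 + rho * cos th)) as [h|h].
{ assert (h' := sqrt_pos (circ_sq rho th)). lra. }
assert (Hs : rho * sin th <> 0).
{ intros E. apply Rmult_integral in E. destruct E as [E|E].
  - rewrite E in h. lra.
  - destruct (Rtotal_order th 0) as [h1|[h1|h1]].
    + assert (0 < sin (- th)) by (apply sin_gt_0; lra).
      rewrite sin_neg in H. lra.
    + rewrite h1, cos_0 in h. lra.
    + assert (0 < sin th) by (apply sin_gt_0; lra). lra. }
enough (- (1 + rho * cos th) < sqrt (circ_sq rho th)) by lra.
apply Rsqr_incrst_0; [|lra|apply sqrt_pos].
rewrite Rsqr_sqrt by apply circ_sq_nonneg. rewrite circ_sq_eq. unfold Rsqr.
assert (0 < (rho * sin th) ^ 2) by (apply pow2_gt_0; exact Hs). nra.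
Qed.

Lemma is_derive_eq (f : R -> R) (x l l' : R) : is_derive f x l -> l = l' -> is_derive f x l'.
Proof. intros H <-; exact H. Qed.

Lemma polar_derive (x y : R -> R) (u x' y' : R) :
  is_derive x u x' -> is_derive y u y' ->
  0 < sqrt (x u ^ 2 + y u ^ 2) + x u ->
  is_derive (fun v => 2 * atan (y v / (sqrt (x v ^ 2 + y v ^ 2) + x v))) u
    ((x u * y' - y u * x') / (x u ^ 2 + y u ^ 2)).
Proof.
intros Hx Hy Hd.
assert (Hq : 0 < x u ^ 2 + y u ^ 2).
{ destruct (Rle_lt_or_eq_dec 0 (x u ^ 2 + y u ^ 2)) as [h|h];
    [apply Rplus_le_le_0_compat; apply pow2_ge_0|exact h|].
  rewrite <- h, sqrt_0 in Hd. assert (h1 := pow2_ge_0 (y u)). nra. }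
assert (Hs : sqrt (x u ^ 2 + y u ^ 2) * sqrt (x u ^ 2 + y u ^ 2) = x u ^ 2 + y u ^ 2)
  by (apply sqrt_sqrt; lra).
assert (Hs0 : 0 < sqrt (x u ^ 2 + y u ^ 2)) by (apply sqrt_lt_R0; exact Hq).
evar_last.
- apply (is_derive_scal (fun v => atan (y v / (sqrt (x v ^ 2 + y v ^ 2) + x v)))).
  apply (is_derive_comp atan).
  + apply is_derive_atan.
  + apply is_derive_div; [exact Hy| |lra].
    apply @is_derive_plus; [|exact Hx].
    apply is_derive_sqrt; [|exact Hq].
    apply @is_derive_plus; apply is_derive_pow; eassumption.
- unfold scal, plus; simpl; unfold mult; simpl. unfold Rsqr.
  set (s := sqrt (x u * (x u * 1) + y u * (y u * 1))) in *.
  change (sqrt (x u ^ 2 + y u ^ 2)) with s in *.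
  assert (Hy2 : y u * y u = s * s - x u * x u) by lra.
  (* With s the modulus, (s + x)^2 + y^2 = 2 s (s + x); this collapses the derivative of the half
     angle formula. *)
  assert (E1 : 1 + y u / (s + x u) * (y u / (s + x u)) = 2 * s / (s + x u)).
  { replace (y u / (s + x u) * (y u / (s + x u))) with (y u * y u / ((s + x u) * (s + x u)))
      by (field; lra).
    rewrite Hy2. field. lra. }
  rewrite E1. clear E1.
  replace (x u * (x u * 1) + y u * (y u * 1)) with (s * s) by lra.
  apply Rmult_eq_reg_r with (s * s * (s + x u)); [|nra].
  transitivity ((y' * (s + x u) * s - y u * (x u * x' + y u * y' + s * x'))).
  { field. split; lra. }
  transitivity ((x u * y' - y u * x') * (s + x u)).
  2:{ field. lra. }
  replace (y' * (s + x u) * s - y u * (x u * x' + y u * y' + s * x')) with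
   (y' * (s * s + x u * s) - y u * x u * x' - (y u * y u) * y' - y u * s * x') by ring.
  rewrite Hy2. ring.
Qed.

Lemma circ_arg_eq (rho th : R) : circ_arg rho th =
  2 * atan (rho * sin th / (sqrt ((1 + rho * cos th) ^ 2 + (rho * sin th) ^ 2) + (1 + rho * cos th))).
Proof. unfold circ_arg, circ_den. rewrite circ_sq_eq. reflexivity. Qed.

Lemma circ_arg_derive_R (rho th : R) : 0 < circ_den rho th -> is_derive (fun u => circ_arg u th) rho
  (sin th / circ_sq rho th).
Proof.
intros H.
assert (Hq := circ_sq_pos _ _ H).
apply (is_derive_ext (fun u => 2 * atan (u * sin th / (sqrt ((1 + u * cos th) ^ 2 + (u * sin th) ^ 2) +
  (1 + u * cos th))))).
{ intros u; symmetry; apply circ_arg_eq. }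
unfold circ_den in H. rewrite circ_sq_eq in H.
eapply is_derive_eq.
- apply (polar_derive (fun u => 1 + u * cos th) (fun u => u * sin th) rho (cos th) (sin th)).
  + auto_derive; auto; ring.
  + auto_derive; auto; ring.
  + exact H.
- cbv beta. rewrite <- circ_sq_eq. f_equal. ring.
Qed.

Lemma circ_arg_derive_th (rho th : R) : 0 < circ_den rho th ->
  is_derive (fun v => circ_arg rho v) th (rho * (rho + cos th) / circ_sq rho th).
Proof.
intros H.
assert (Hq := circ_sq_pos _ _ H).
apply (is_derive_ext (fun u => 2 * atan (rho * sin u / (sqrt ((1 + rho * cos u) ^ 2 + (rho * sin u) ^
  2) + (1 + rho * cos u))))).
{ intros u; symmetry; apply circ_arg_eq. }
unfold circ_den in H. rewrite circ_sq_eq in H.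
eapply is_derive_eq.
- apply (polar_derive (fun u => 1 + rho * cos u) (fun u => rho * sin u) th (- rho * sin th) (rho * cos th)).
  + auto_derive; auto; ring.
  + auto_derive; auto; ring.
  + exact H.
- cbv beta. rewrite <- circ_sq_eq. f_equal.
  assert (h := sin2_cos2 th); unfold Rsqr in h.
  replace (rho * (rho + cos th)) with (rho * (rho * (sin th * sin th + cos th * cos th) + cos th))
    by (rewrite h; ring). ring.
Qed.

Lemma Rpower_derive_comp (f : R -> R) (x l p : R) :
  0 < f x -> is_derive f x l ->
  is_derive (fun u => Rpower (f u) p) x (p * l / f x * Rpower (f x) p).
Proof.
intros Hf Hd. unfold Rpower.
eapply is_derive_eq.
- apply (is_derive_comp exp (fun u => p * ln (f u))).
  + apply is_derive_exp.
  + apply (is_derive_scal (fun u => ln (f u))).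
    apply (is_derive_comp ln f); [apply is_derive_ln; exact Hf|exact Hd].
- unfold scal; simpl; unfold mult; simpl. field. lra.
Qed.

Lemma circ_sq_derive_R (rho th : R) : is_derive (fun u => circ_sq u th) rho (2 * (rho + cos th)).
Proof. unfold circ_sq. auto_derive; auto; ring. Qed.

Lemma circ_sq_derive_th (rho th : R) : is_derive (fun v => circ_sq rho v) th (- 2 * rho * sin th).
Proof. unfold circ_sq. auto_derive; auto; ring. Qed.

(** Real part of P e^(i th) w^(P - 1) e^(- i kap th) for w = 1 + z, using e^(i th) / w = (rho + e^(i
    th)) / |w|^2. *)
Definition circ_re_drho (P kap rho th : R) : R :=
  P / circ_sq rho th * Rpower (circ_sq rho th) (P / 2) *
  ((rho + cos th) * cos (P * circ_arg rho th - kap * th) - sin th * sin (P * circ_arg rho th - kap * th)).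

Lemma circ_re_derive_R (P kap rho th : R) : 0 < circ_den rho th ->
  is_derive (fun u => circ_re P kap u th) rho (circ_re_drho P kap rho th).
Proof.
intros H. assert (Hq := circ_sq_pos _ _ H). unfold circ_re.
eapply is_derive_eq.
- apply (is_derive_mult (fun u => Rpower (circ_sq u th) (P / 2)) (fun u => cos (P * circ_arg u th - kap
    * th))).
  + apply (Rpower_derive_comp (fun u => circ_sq u th)); [exact Hq|apply circ_sq_derive_R].
  + apply (is_derive_comp cos (fun u => P * circ_arg u th - kap * th)); [apply is_derive_cos|].
    apply @is_derive_minus; [|apply @is_derive_const].
    apply (is_derive_scal (fun u => circ_arg u th)). apply circ_arg_derive_R; exact H.
  + intros; apply Rmult_comm.
- unfold circ_re_drho, scal, plus, minus, opp, zero; simpl; unfold mult, plus, opp; simpl. field. lra.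
Qed.

(** The polar Cauchy-Riemann equation d/dth = i rho d/drho for (1 + z)^P; the factor e^(- i kap th)
    adds the term in kap. *)
Lemma circ_im_derive_th (P kap rho th : R) : 0 < circ_den rho th ->
  is_derive (fun v => circ_im P kap rho v) th (rho * circ_re_drho P kap rho th - kap * circ_re P kap
    rho th).
Proof.
intros H. assert (Hq := circ_sq_pos _ _ H). unfold circ_im.
eapply is_derive_eq.
- apply (is_derive_mult (fun v => Rpower (circ_sq rho v) (P / 2)) (fun v => sin (P * circ_arg rho v -
    kap * v))).
  + apply (Rpower_derive_comp (fun v => circ_sq rho v)); [exact Hq|apply circ_sq_derive_th].
  + apply (is_derive_comp sin (fun v => P * circ_arg rho v - kap * v)); [apply is_derive_sin|].
    apply @is_derive_minus.
    * apply (is_derive_scal (fun v => circ_arg rho v)). apply circ_arg_derive_th; exact H.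
    * apply is_derive_scal. apply @is_derive_id.
  + intros; apply Rmult_comm.
- unfold circ_re_drho, circ_re, scal, plus, minus, opp, one; simpl; unfold mult, plus, opp, one; simpl.
    field. lra.
Qed.

Lemma circ_arg_half (rho th : R) : 0 < circ_den rho th ->
  cos (circ_arg rho th / 2) = sqrt (circ_den rho th / (2 * sqrt (circ_sq rho th))) /\
  sin (circ_arg rho th / 2) = rho * sin th / circ_den rho th * sqrt (circ_den rho th / (2 * sqrt
    (circ_sq rho th))).
Proof.
intros H. assert (Hq := circ_sq_pos _ _ H).
unfold circ_arg. replace (2 * atan (rho * sin th / circ_den rho th) / 2) with (atan (rho * sin th /
  circ_den rho th)) by field.
set (h := rho * sin th / circ_den rho th).
assert (Hs0 := sqrt_lt_R0 _ Hq).
assert (E : 1 + h ^ 2 = 2 * sqrt (circ_sq rho th) / circ_den rho th).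
{ unfold h. replace ((rho * sin th / circ_den rho th) ^ 2) with ((rho * sin th) ^ 2 / circ_den rho th ^
    2) by (field; lra).
  assert (hq2 := circ_sq_eq rho th). assert (Hss := sqrt_sqrt _ (circ_sq_nonneg rho th)).
  replace ((rho * sin th) ^ 2) with (sqrt (circ_sq rho th) ^ 2 - (1 + rho * cos th) ^ 2) by nra.
  unfold circ_den in *. field. lra. }
assert (E2 : / sqrt (1 + h ^ 2) = sqrt (circ_den rho th / (2 * sqrt (circ_sq rho th)))).
{ rewrite E, <- sqrt_inv. f_equal. field. lra. }
rewrite cos_atan, sin_atan. unfold Rsqr. replace (h * h) with (h ^ 2) by ring.
rewrite <- E2. split; field; apply Rgt_not_eq, sqrt_lt_R0; nra.
Qed.

Lemma circ_arg_cos_sin (rho th : R) : 0 < circ_den rho th ->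
  cos (circ_arg rho th) = (1 + rho * cos th) / sqrt (circ_sq rho th) /\
  sin (circ_arg rho th) = rho * sin th / sqrt (circ_sq rho th).
Proof.
intros H. assert (Hq := circ_sq_pos _ _ H).
assert (Hs0 := sqrt_lt_R0 _ Hq).
destruct (circ_arg_half rho th H) as [Hc Hs].
replace (circ_arg rho th) with (2 * (circ_arg rho th / 2)) by field.
assert (Ess : sqrt (circ_den rho th / (2 * sqrt (circ_sq rho th))) * sqrt (circ_den rho th / (2 * sqrt
  (circ_sq rho th))) =
  circ_den rho th / (2 * sqrt (circ_sq rho th))).
{ apply sqrt_sqrt. apply Rlt_le, Rdiv_lt_0_compat; lra. }
rewrite cos_2a_cos, sin_2a, Hc, Hs.
replace (2 * sqrt (circ_den rho th / (2 * sqrt (circ_sq rho th))) * sqrt (circ_den rho th / (2 * sqrt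
  (circ_sq rho th)))) with
  (2 * (sqrt (circ_den rho th / (2 * sqrt (circ_sq rho th))) * sqrt (circ_den rho th / (2 * sqrt
    (circ_sq rho th))))) by ring.
rewrite Ess.
replace (2 * (rho * sin th / circ_den rho th * sqrt (circ_den rho th / (2 * sqrt (circ_sq rho th)))) *
  sqrt (circ_den rho th / (2 * sqrt (circ_sq rho th))))
 with (2 * (rho * sin th / circ_den rho th) * (sqrt (circ_den rho th / (2 * sqrt (circ_sq rho th))) *
   sqrt (circ_den rho th / (2 * sqrt (circ_sq rho th))))) by ring.
rewrite Ess.
split; [|field; lra].
unfold circ_den at 1. field. lra.
Qed.

(** The factor e^(i th) produced by d/drho lowers kap by one. The derivative thus stays in the same
    family, which gives its continuity and the recursion for Taylor coefficients. *)
Lemma circ_re_drho_shift (P kap rho th : R) : 0 < circ_den rho th ->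
  circ_re_drho P kap rho th = P * circ_re (P - 1) (kap - 1) rho th.
Proof.
intros H. assert (Hq := circ_sq_pos _ _ H).
assert (Hs0 := sqrt_lt_R0 _ Hq).
destruct (circ_arg_cos_sin rho th H) as [Hc Hs].
unfold circ_re_drho, circ_re.
replace ((P - 1) * circ_arg rho th - (kap - 1) * th) with ((P * circ_arg rho th - kap * th) + (th -
  circ_arg rho th)) by ring.
set (A := P * circ_arg rho th - kap * th).
rewrite (cos_plus A), cos_minus, sin_minus, Hc, Hs.
replace ((P - 1) / 2) with (P / 2 + - / 2) by field.
rewrite Rpower_plus, (Rpower_Ropp _ (/ 2)), Rpower_sqrt by exact Hq.
assert (Hss := sqrt_sqrt _ (circ_sq_nonneg rho th)).
assert (h := sin2_cos2 th); unfold Rsqr in h.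
replace (/ circ_sq rho th) with (/ (sqrt (circ_sq rho th) * sqrt (circ_sq rho th))) by (rewrite Hss;
  reflexivity).
unfold Rdiv at 1.
replace (/ circ_sq rho th) with (/ (sqrt (circ_sq rho th) * sqrt (circ_sq rho th))) by (rewrite Hss;
  reflexivity).
set (s := sqrt (circ_sq rho th)) in *.
set (RP := Rpower (circ_sq rho th) (P / 2)).
replace (cos th * ((1 + rho * cos th) / s) + sin th * (rho * sin th / s)) with
  ((cos th + rho * (sin th * sin th + cos th * cos th)) / s) by (field; lra).
rewrite h. field. lra.
Qed.

Lemma continuous_2d_pt_snd (f : R -> R -> R) (x y : R) :
  continuity_2d_pt f x y -> continuous (f x) y.
Proof.
intros H. apply continuity_pt_filterlim. intros eps Heps.
destruct (H (mkposreal eps Heps)) as [d Hd].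
exists d. split; [apply cond_pos|].
intros z [_ Hz]. apply Hd; [|exact Hz].
rewrite Rminus_diag, Rabs_R0. apply cond_pos.
Qed.

Lemma circ_sq_cont (x y : R) : continuity_2d_pt circ_sq x y.
Proof.
unfold circ_sq.
apply continuity_2d_pt_plus; [apply continuity_2d_pt_plus|].
- apply continuity_2d_pt_const.
- apply continuity_2d_pt_mult; [apply continuity_2d_pt_mult|].
  + apply continuity_2d_pt_const.
  + apply continuity_2d_pt_id1.
  + apply (continuity_1d_2d_pt_comp cos); [apply continuity_cos|apply continuity_2d_pt_id2].
- apply (continuity_1d_2d_pt_comp (fun z => z ^ 2)); [|apply continuity_2d_pt_id1].
  apply derivable_continuous_pt, derivable_pt_pow.
Qed.

Lemma circ_den_cont (x y : R) : continuity_2d_pt circ_den x y.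
Proof.
unfold circ_den.
apply continuity_2d_pt_plus; [|apply continuity_2d_pt_plus].
- apply (continuity_1d_2d_pt_comp sqrt); [apply continuity_pt_sqrt, circ_sq_nonneg|apply circ_sq_cont].
- apply continuity_2d_pt_const.
- apply continuity_2d_pt_mult; [apply continuity_2d_pt_id1|].
  apply (continuity_1d_2d_pt_comp cos); [apply continuity_cos|apply continuity_2d_pt_id2].
Qed.

Lemma circ_den_pos_loc (x y : R) : 0 < circ_den x y -> locally_2d (fun u v => 0 < circ_den u v) x y.
Proof.
intros H. destruct (circ_den_cont x y (mkposreal _ H)) as [d Hd].
exists d. intros u v Hu Hv. specialize (Hd u v Hu Hv). simpl in Hd.
apply Rabs_def2 in Hd. lra.
Qed.

Lemma circ_arg_cont (x y : R) : 0 < circ_den x y -> continuity_2d_pt circ_arg x y.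
Proof.
intros H. unfold circ_arg.
apply continuity_2d_pt_mult; [apply continuity_2d_pt_const|].
apply (continuity_1d_2d_pt_comp atan).
{ apply derivable_continuous_pt, derivable_pt_atan. }
unfold Rdiv. apply continuity_2d_pt_mult.
- apply continuity_2d_pt_mult; [apply continuity_2d_pt_id1|].
  apply (continuity_1d_2d_pt_comp sin); [apply continuity_sin|apply continuity_2d_pt_id2].
- apply continuity_2d_pt_inv; [apply circ_den_cont|lra].
Qed.

Lemma Rpower_cont (x p : R) : 0 < x -> continuity_pt (fun z => Rpower z p) x.
Proof.
intros H. apply continuity_pt_filterlim, (ex_derive_continuous (fun z => Rpower z p)).
eexists. apply (Rpower_derive_comp (fun z => z)); [exact H|apply @is_derive_id].
Qed.

Lemma phase_cont (P kap x y : R) : 0 < circ_den x y ->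
  continuity_2d_pt (fun u v => P * circ_arg u v - kap * v) x y.
Proof.
intros H. apply continuity_2d_pt_minus; apply continuity_2d_pt_mult;
  [apply continuity_2d_pt_const|apply circ_arg_cont; exact H|apply continuity_2d_pt_const|apply
    continuity_2d_pt_id2].
Qed.

Lemma circ_pow_cont (P x y : R) : 0 < circ_den x y ->
  continuity_2d_pt (fun u v => Rpower (circ_sq u v) (P / 2)) x y.
Proof.
intros H. apply (continuity_1d_2d_pt_comp (fun z => Rpower z (P / 2)));
  [apply Rpower_cont, circ_sq_pos, H|apply circ_sq_cont].
Qed.

Lemma circ_re_cont (P kap x y : R) : 0 < circ_den x y -> continuity_2d_pt (circ_re P kap) x y.
Proof.
intros H. unfold circ_re. apply continuity_2d_pt_mult; [apply circ_pow_cont; exact H|].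
apply (continuity_1d_2d_pt_comp cos); [apply continuity_cos|apply phase_cont; exact H].
Qed.

Lemma circ_re_drho_cont (P kap x y : R) : 0 < circ_den x y -> continuity_2d_pt (circ_re_drho P kap) x y.
Proof.
intros H.
apply (continuity_2d_pt_ext_loc (fun u v => P * circ_re (P - 1) (kap - 1) u v)).
{ destruct (circ_den_pos_loc _ _ H) as [d Hd]. exists d. intros u v Hu Hv.
  symmetry. apply circ_re_drho_shift, Hd; assumption. }
apply continuity_2d_pt_mult; [apply continuity_2d_pt_const|apply circ_re_cont; exact H].
Qed.

(* The radii for which the arc [0 <= arg <= T] misses the cut. *)
Definition arc_ok (T rho : R) : Prop := Rabs rho < 1 \/ (0 < rho /\ T < PI).

Lemma arc_ok_loc (T rho : R) : arc_ok T rho -> locally rho (arc_ok T).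
Proof.
intros [H|[H H1]].
- apply (filter_imp (fun z => -1 < z /\ z < 1)).
  + intros z Hz. left. apply Rabs_def1; lra.
  + apply Rabs_def2 in H.
    apply filter_and; [apply open_gt|apply open_lt]; lra.
- apply (filter_imp (fun z => 0 < z)).
  + intros z Hz. right. split; assumption.
  + apply open_gt. exact H.
Qed.

Lemma arc_ok_pos (T rho th : R) : T <= PI -> arc_ok T rho -> 0 <= th <= T -> 0 < circ_den rho th.
Proof.
intros HT [H|[H H1]] Hth.
- apply circ_den_pos_small; exact H.
- apply circ_den_pos; [lra|]. assert (h := PI_RGT_0). lra.
Qed.

(** * Arc integrals and Taylor coefficients *)

Definition arc_int (P kap T rho : R) : R := RInt (fun th => circ_re P kap rho th) 0 T.

Lemma circ_re_ex_RInt (T P kap rho : R) : 0 <= T <= PI -> arc_ok T rho -> ex_RInt (fun th => circ_re P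
  kap rho th) 0 T.
Proof.
intros HT H. apply (ex_RInt_continuous (fun th => circ_re P kap rho th)). intros th Hth.
rewrite Rmin_left, Rmax_right in Hth by lra.
apply continuous_2d_pt_snd, circ_re_cont, (arc_ok_pos T); tauto.
Qed.

Lemma arc_int_derive (T P kap rho : R) : 0 <= T <= PI -> arc_ok T rho ->
  is_derive (fun z => arc_int P kap T z) rho (RInt (fun th => circ_re_drho P kap rho th) 0 T).
Proof.
intros HT H.
assert (Hl := arc_ok_loc _ _ H).
assert (E : RInt (fun th => circ_re_drho P kap rho th) 0 T = RInt (fun th => Derive (fun u => circ_re P
  kap u th) rho) 0 T).
{ apply RInt_ext. intros th Hth. rewrite Rmin_left, Rmax_right in Hth by lra.
  symmetry. apply is_derive_unique, circ_re_derive_R, (arc_ok_pos T); tauto || lra. }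
rewrite E. unfold arc_int. apply is_derive_RInt_param.
- apply (filter_imp (arc_ok T)); [|exact Hl].
  intros z Hz th Hth. rewrite Rmin_left, Rmax_right in Hth by lra.
  eexists. apply circ_re_derive_R, (arc_ok_pos T); tauto.
- intros th Hth. rewrite Rmin_left, Rmax_right in Hth by lra.
  assert (Hd : 0 < circ_den rho th) by (apply (arc_ok_pos T); tauto).
  apply (continuity_2d_pt_ext_loc (circ_re_drho P kap)); [|apply circ_re_drho_cont; exact Hd].
  destruct (circ_den_pos_loc _ _ Hd) as [d Hd']. exists d. intros u v Hu Hv.
  symmetry. apply is_derive_unique, circ_re_derive_R, Hd'; assumption.
- apply (filter_imp (arc_ok T)); [|exact Hl].
  intros z Hz. apply circ_re_ex_RInt; assumption.
Qed.

Lemma circ_im_0 (P kap rho : R) : circ_im P kap rho 0 = 0.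
Proof.
unfold circ_im, circ_arg. rewrite sin_0. unfold Rdiv. rewrite Rmult_0_r, Rmult_0_l, atan_0.
rewrite !Rmult_0_r, Rminus_0_r, sin_0. ring.
Qed.

(** [circ_im_derive_th] integrated over the arc; the end th = 0 contributes nothing because the
    function is real there. *)
Lemma circ_re_drho_RInt (T P kap rho : R) : 0 <= T <= PI -> arc_ok T rho ->
  rho * RInt (fun th => circ_re_drho P kap rho th) 0 T = kap * arc_int P kap T rho + circ_im P kap rho T.
Proof.
intros HT H.
assert (Hex : ex_RInt (fun th => circ_re_drho P kap rho th) 0 T).
{ apply (ex_RInt_continuous (fun th => circ_re_drho P kap rho th)). intros th Hth.
  rewrite Rmin_left, Rmax_right in Hth by lra.
  apply continuous_2d_pt_snd, circ_re_drho_cont, (arc_ok_pos T); tauto. }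
assert (Hi : is_RInt (fun th => rho * circ_re_drho P kap rho th - kap * circ_re P kap rho th) 0 T
  (minus (circ_im P kap rho T) (circ_im P kap rho 0))).
{ apply (is_RInt_derive (fun v => circ_im P kap rho v)).
  - intros th Hth. rewrite Rmin_left, Rmax_right in Hth by lra.
    apply circ_im_derive_th, (arc_ok_pos T); tauto.
  - intros th Hth. rewrite Rmin_left, Rmax_right in Hth by lra.
    assert (Hd : 0 < circ_den rho th) by (apply (arc_ok_pos T); tauto).
    apply (continuous_2d_pt_snd (fun u v => rho * circ_re_drho P kap u v - kap * circ_re P kap u v) rho th).
    apply continuity_2d_pt_minus; apply continuity_2d_pt_mult;
      [apply continuity_2d_pt_const|apply circ_re_drho_cont, Hd|apply continuity_2d_pt_const|apply
        circ_re_cont, Hd]. }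
assert (Hj : is_RInt (fun th => rho * circ_re_drho P kap rho th - kap * circ_re P kap rho th) 0 T
  (rho * RInt (fun th => circ_re_drho P kap rho th) 0 T - kap * arc_int P kap T rho)).
{ apply @is_RInt_minus; apply @is_RInt_scal.
  - apply (RInt_correct (fun th => circ_re_drho P kap rho th)); exact Hex.
  - apply (RInt_correct (fun th => circ_re P kap rho th)), circ_re_ex_RInt; assumption. }
assert (E := is_RInt_unique _ _ _ _ Hi). rewrite (is_RInt_unique _ _ _ _ Hj) in E.
rewrite circ_im_0 in E. unfold minus, plus, opp in E; simpl in E. lra.
Qed.

Lemma circ_re_drho_RInt_shift (T P kap rho : R) : 0 <= T <= PI -> arc_ok T rho ->
  RInt (fun th => circ_re_drho P kap rho th) 0 T = P * arc_int (P - 1) (kap - 1) T rho.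
Proof.
intros HT H. unfold arc_int. rewrite <- (RInt_scal (fun th => circ_re (P - 1) (kap - 1) rho th)) by
  (apply circ_re_ex_RInt; assumption).
apply RInt_ext. intros th Hth. rewrite Rmin_left, Rmax_right in Hth by lra.
apply circ_re_drho_shift, (arc_ok_pos T); tauto || lra.
Qed.

(** The generalized binomial coefficient, recursing on P as the derivative of (1 + z)^P does. *)
Fixpoint gbinom (P : R) (k : nat) : R :=
  match k with O => 1 | S j => P / (INR j + 1) * gbinom (P - 1) j end.

Lemma sin_INR_PI (k : nat) : sin (INR k * PI) = 0.
Proof. rewrite INR_IZR_INZ. apply sin_eq_0_1. eexists; reflexivity. Qed.

(** For rho >= 1 the point lies on the cut or at its tip, [circ_den] vanishes and the value is only
    the default of 0 / 0; the applications have rho < 1. *)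
Lemma circ_arg_PI (rho : R) : circ_arg rho PI = 0.
Proof. unfold circ_arg. rewrite sin_PI. unfold Rdiv. rewrite Rmult_0_r, Rmult_0_l, atan_0. ring. Qed.

Lemma circ_im_PI (P kap rho : R) : sin (kap * PI) = 0 -> circ_im P kap rho PI = 0.
Proof.
intros H. unfold circ_im. rewrite circ_arg_PI.
replace (P * 0 - kap * PI) with (- (kap * PI)) by ring.
rewrite sin_neg, H. ring.
Qed.

Lemma circ_re_0 (P kap th : R) : circ_re P kap 0 th = cos (kap * th).
Proof.
unfold circ_re, circ_arg, circ_sq. replace (1 + 2 * 0 * cos th + 0 ^ 2) with 1 by ring.
unfold Rpower. rewrite ln_1, Rmult_0_r, exp_0. unfold Rdiv. rewrite Rmult_0_l, Rmult_0_l, atan_0.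
replace (P * (2 * 0) - kap * th) with (- (kap * th)) by ring.
rewrite cos_neg. ring.
Qed.

Lemma MVT_zero (f df : R -> R) (a b : R) : a <= b ->
  (forall z, a <= z <= b -> is_derive f z (df z)) ->
  (forall z, a < z < b -> df z = 0) -> f b = f a.
Proof.
intros [Hab| ->] Hd H0; [|reflexivity].
destruct (MVT_cor2 f df a b Hab) as [c [Hc1 Hc2]].
{ intros c Hc. apply is_derive_Reals, Hd, Hc. }
rewrite (H0 c Hc2) in Hc1. lra.
Qed.

Lemma PI_arc : 0 <= PI <= PI.
Proof. assert (h := PI_RGT_0). lra. Qed.

(** By the Cauchy-Riemann identity rho^(j + 1) times the integral is constant in rho, and it
    vanishes at 0. *)
Lemma arc_int_full_neg (P rho : R) (j : nat) : 0 < rho < 1 -> arc_int P (- (INR j + 1)) PI rho = 0.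
Proof.
intros Hr.
assert (Ha : forall z, 0 <= z <= rho -> arc_ok PI z).
{ intros z Hz. left. rewrite Rabs_pos_eq; lra. }
assert (E : rho ^ S j * arc_int P (- (INR j + 1)) PI rho = 0 ^ S j * arc_int P (- (INR j + 1)) PI 0).
{ apply (MVT_zero (fun z => z ^ S j * arc_int P (- (INR j + 1)) PI z)
   (fun z => z ^ j * ((INR j + 1) * arc_int P (- (INR j + 1)) PI z +
      z * RInt (fun th => circ_re_drho P (- (INR j + 1)) z th) 0 PI)) 0 rho); [lra| |].
  - intros z Hz. eapply is_derive_eq.
    + apply (is_derive_mult (fun z => z ^ S j) (fun z => arc_int P (- (INR j + 1)) PI z)).
      * apply is_derive_pow, @is_derive_id.
      * apply arc_int_derive; [apply PI_arc|apply Ha, Hz].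
      * intros; apply Rmult_comm.
    + change (INR (S j) * 1 * z ^ j * arc_int P (- (INR j + 1)) PI z +
        z ^ S j * RInt (fun th => circ_re_drho P (- (INR j + 1)) z th) 0 PI =
        z ^ j * ((INR j + 1) * arc_int P (- (INR j + 1)) PI z +
          z * RInt (fun th => circ_re_drho P (- (INR j + 1)) z th) 0 PI)).
      rewrite S_INR. simpl pow. ring.
  - intros z Hz. rewrite circ_re_drho_RInt; [|apply PI_arc|apply Ha; lra].
    rewrite circ_im_PI; [ring|].
    replace (- (INR j + 1) * PI) with (- (INR (S j) * PI)) by (rewrite S_INR; ring).
    rewrite sin_neg, sin_INR_PI. ring. }
rewrite (pow_ne_zero (S j)), Rmult_0_l in E by lia.
apply Rmult_integral in E. destruct E as [E|E]; [|exact E].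
exfalso. apply (pow_nonzero rho (S j)) in E; [exact E|lra].
Qed.

(** Computing the rho-derivative of the integral in two ways gives k J(P, k) = P rho J(P - 1, k -
    1), the recursion of [gbinom]; for k = 0 the integral is constant in rho. *)
Lemma arc_int_full (k : nat) : forall P rho : R, 0 < rho < 1 ->
  arc_int P (INR k) PI rho = PI * gbinom P k * rho ^ k.
Proof.
induction k as [|k IH]; intros P rho Hr.
- assert (Ha : forall z, 0 <= z <= rho -> arc_ok PI z).
  { intros z Hz. left. rewrite Rabs_pos_eq; lra. }
  transitivity (arc_int P 0 PI 0).
  + apply (MVT_zero (fun z => arc_int P 0 PI z) (fun z => RInt (fun th => circ_re_drho P 0 z th) 0
      PI)); [lra| |].
    * intros z Hz. apply arc_int_derive; [apply PI_arc|apply Ha, Hz].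
    * intros z Hz. assert (E := circ_re_drho_RInt PI P 0 z PI_arc (Ha z ltac:(lra))).
      rewrite circ_im_PI in E by (rewrite Rmult_0_l; apply sin_0).
      apply Rmult_eq_reg_l with z; lra.
  + unfold arc_int. transitivity (RInt (fun _ => 1) 0 PI).
    * apply RInt_ext. intros x _. rewrite circ_re_0, Rmult_0_l. apply cos_0.
    * rewrite RInt_const. unfold scal; simpl; unfold mult; simpl. ring.
- assert (Ha : arc_ok PI rho) by (left; rewrite Rabs_pos_eq; lra).
  assert (E := circ_re_drho_RInt PI P (INR (S k)) rho PI_arc Ha).
  rewrite circ_im_PI in E by apply sin_INR_PI.
  rewrite (circ_re_drho_RInt_shift PI P (INR (S k)) rho PI_arc Ha) in E.
  replace (INR (S k) - 1) with (INR k) in E by (rewrite S_INR; ring).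
  rewrite IH in E by exact Hr.
  assert (h := pos_INR k).
  apply Rmult_eq_reg_l with (INR (S k)); [|rewrite S_INR; lra].
  rewrite Rplus_0_r in E. rewrite <- E. cbn [gbinom]. rewrite S_INR. simpl pow. field. lra.
Qed.

(* Real and imaginary part of [(1 + z)^P (a - z)^m e^(- i kap th)], [z = rho e^(i th)],
   and the coefficient of [z^k] in [(1 + z)^P (a - z)^m]. *)
Fixpoint ker_re (a P : R) (m : nat) (kap rho th : R) : R :=
  match m with
  | O => circ_re P kap rho th
  | S p => a * ker_re a P p kap rho th - rho * ker_re a P p (kap - 1) rho th
  end.

Fixpoint ker_im (a P : R) (m : nat) (kap rho th : R) : R :=
  match m with
  | O => circ_im P kap rho th
  | S p => a * ker_im a P p kap rho th - rho * ker_im a P p (kap - 1) rho th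
  end.

Fixpoint ker_coef (a P : R) (m k : nat) : R :=
  match m with
  | O => gbinom P k
  | S p => a * ker_coef a P p k - match k with O => 0 | S j => ker_coef a P p j end
  end.

Lemma ker_re_ex_RInt (a P kap T rho : R) (m : nat) : 0 <= T <= PI -> arc_ok T rho ->
  ex_RInt (fun th => ker_re a P m kap rho th) 0 T.
Proof.
intros HT H. revert kap. induction m as [|m IH]; intros kap; cbn [ker_re].
- apply circ_re_ex_RInt; assumption.
- apply @ex_RInt_minus; apply @ex_RInt_scal; apply IH.
Qed.

Lemma ker_re_RInt_S (a P kap T rho : R) (m : nat) : 0 <= T <= PI -> arc_ok T rho ->
  RInt (fun th => ker_re a P (S m) kap rho th) 0 T =
  a * RInt (fun th => ker_re a P m kap rho th) 0 T - rho * RInt (fun th => ker_re a P m (kap - 1) rho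
    th) 0 T.
Proof.
intros HT H. apply is_RInt_unique.
apply @is_RInt_minus; apply @is_RInt_scal; apply (RInt_correct (fun th => ker_re a P m _ rho th));
  apply ker_re_ex_RInt; assumption.
Qed.

(** Nonnegative and negative indices go through the induction together because the factor a - z
    lowers kap and so sends index 0 to -1. *)
Lemma ker_re_full (a P rho : R) (m : nat) : 0 < rho < 1 ->
  (forall k, RInt (fun th => ker_re a P m (INR k) rho th) 0 PI = PI * ker_coef a P m k * rho ^ k) /\
  (forall j, RInt (fun th => ker_re a P m (- (INR j + 1)) rho th) 0 PI = 0).
Proof.
intros Hr.
assert (Ha : arc_ok PI rho) by (left; rewrite Rabs_pos_eq; lra).
induction m as [|m [IH1 IH2]]; split.
- intros k. apply arc_int_full, Hr.
- intros j. apply arc_int_full_neg, Hr.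
- intros k. rewrite ker_re_RInt_S by (apply PI_arc || exact Ha). rewrite IH1.
  destruct k as [|k].
  + replace (INR 0 - 1) with (- (INR 0 + 1)) by (simpl; ring). rewrite IH2. cbn [ker_coef]. match goal
      with |- @eq _ ?x ?y => change (@eq R x y) end. ring.
  + replace (INR (S k) - 1) with (INR k) by (rewrite S_INR; ring). rewrite IH1. cbn [ker_coef].
    match goal with |- @eq _ ?x ?y => change (@eq R x y) end. simpl pow. ring.
- intros j. rewrite ker_re_RInt_S by (apply PI_arc || exact Ha). rewrite IH2.
  replace (- (INR j + 1) - 1) with (- (INR (S j) + 1)) by (rewrite S_INR; ring).
  rewrite IH2. match goal with |- @eq _ ?x ?y => change (@eq R x y) end. ring.
Qed.

(* The Cauchy-Riemann equations, integrated over the arc: [ker_im] at the end point measures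
   the failure of the integral to be proportional to [rho^kap]. *)
Lemma ker_re_Cauchy (a P kap T rho : R) (m : nat) : 0 <= T <= PI -> arc_ok T rho ->
  exists D, is_derive (fun z => RInt (fun th => ker_re a P m kap z th) 0 T) rho D /\
    rho * D = kap * RInt (fun th => ker_re a P m kap rho th) 0 T + ker_im a P m kap rho T.
Proof.
intros HT H. revert kap. induction m as [|m IH]; intros kap.
- exists (RInt (fun th => circ_re_drho P kap rho th) 0 T). split.
  + apply arc_int_derive; assumption.
  + apply circ_re_drho_RInt; assumption.
- destruct (IH kap) as [D1 [H1 E1]]. destruct (IH (kap - 1)) as [D2 [H2 E2]].
  exists (a * D1 - (RInt (fun th => ker_re a P m (kap - 1) rho th) 0 T + rho * D2)). split.
  + apply (is_derive_ext_loc (fun z => a * RInt (fun th => ker_re a P m kap z th) 0 T -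
      z * RInt (fun th => ker_re a P m (kap - 1) z th) 0 T)).
    { apply (filter_imp (arc_ok T)); [|apply arc_ok_loc, H].
      intros z Hz. symmetry. apply ker_re_RInt_S; assumption. }
    apply @is_derive_minus.
    * apply is_derive_scal. exact H1.
    * eapply is_derive_eq.
      -- apply (is_derive_mult (fun z => z) (fun z => RInt (fun th => ker_re a P m (kap - 1) z th) 0 T));
           [apply @is_derive_id|exact H2|intros; apply Rmult_comm].
      -- apply (f_equal (fun u => u + rho * D2)). apply Rmult_1_l.
  + rewrite ker_re_RInt_S by assumption. cbn [ker_im].
    replace (rho * (a * D1 - (RInt (fun th => ker_re a P m (kap - 1) rho th) 0 T + rho * D2))) with
      (a * (rho * D1) - rho * (RInt (fun th => ker_re a P m (kap - 1) rho th) 0 T + rho * D2)) by ring.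
    rewrite E1, E2. ring.
Qed.

(** Lowering kap multiplies by e^(i th), a rotation of the pair. Hence each new factor a - z
    multiplies the squared modulus by |a - z|^2 in [ker_re_modulus]. *)
Lemma ker_re_shift (a P kap rho th : R) (m : nat) :
  ker_re a P m (kap - 1) rho th = cos th * ker_re a P m kap rho th - sin th * ker_im a P m kap rho th /\
  ker_im a P m (kap - 1) rho th = sin th * ker_re a P m kap rho th + cos th * ker_im a P m kap rho th.
Proof.
revert kap. induction m as [|m IH]; intros kap; cbn [ker_re ker_im].
- unfold circ_re, circ_im. replace (P * circ_arg rho th - (kap - 1) * th) with ((P * circ_arg rho th -
    kap * th) + th) by ring.
  set (A := P * circ_arg rho th - kap * th). rewrite cos_plus, sin_plus. split; ring.
- destruct (IH kap) as [H1 H2]. destruct (IH (kap - 1)) as [H3 H4].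
  rewrite H3, H4, H1, H2. split; ring.
Qed.

Lemma ker_re_modulus (a P kap rho th : R) (m : nat) :
  ker_re a P m kap rho th ^ 2 + ker_im a P m kap rho th ^ 2 =
  (Rpower (circ_sq rho th) (P / 2)) ^ 2 * (a ^ 2 + rho ^ 2 - 2 * a * rho * cos th) ^ m.
Proof.
assert (h := sin2_cos2 th); unfold Rsqr in h.
induction m as [|m IH].
- cbn [ker_re ker_im]. unfold circ_re, circ_im. set (A := P * circ_arg rho th - kap * th).
  assert (hA := sin2_cos2 A); unfold Rsqr in hA.
  simpl pow. rewrite !Rmult_1_r. set (RP := Rpower (circ_sq rho th) (P / 2)).
  replace (RP * cos A * (RP * cos A) + RP * sin A * (RP * sin A)) with
    (RP * RP * (sin A * sin A + cos A * cos A)) by ring. rewrite hA. ring.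
- cbn [ker_re ker_im]. destruct (ker_re_shift a P kap rho th m) as [H1 H2]. rewrite H1, H2.
  cbn [pow] in *. set (X := ker_re a P m kap rho th) in *. set (Y := ker_im a P m kap rho th) in *.
  transitivity ((X * (X * 1) + Y * (Y * 1)) * (a ^ 2 + rho ^ 2 * (sin th * sin th + cos th * cos th) -
    2 * a * rho * cos th)).
  + ring.
  + rewrite IH, h. ring.
Qed.

(** * Cauchy's estimate across the branch cut *)

(* [x ^ P] for [0 <= x] and [0 < P]; unlike [Rpower x P] it vanishes for [x <= 0]. *)
Definition rpow (x P : R) : R := if Rle_dec x 0 then 0 else Rpower x P.

Lemma rpow_Rpower (x P : R) : 0 < x -> rpow x P = Rpower x P.
Proof. intros H. unfold rpow. destruct (Rle_dec x 0) as [h|h]; [exfalso; lra|reflexivity]. Qed.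

Lemma rpow_neg (x P : R) : x <= 0 -> rpow x P = 0.
Proof. intros H. unfold rpow. destruct (Rle_dec x 0) as [h|h]; [reflexivity|contradiction]. Qed.

Lemma rpow_0 (P : R) : rpow 0 P = 0.
Proof. apply rpow_neg. lra. Qed.

Lemma rpow_nonneg (x P : R) : 0 <= rpow x P.
Proof. unfold rpow. destruct (Rle_dec x 0); [lra|apply Rlt_le, exp_pos]. Qed.

Lemma rpow_mult (x y P : R) : 0 <= x -> 0 <= y -> rpow (x * y) P = rpow x P * rpow y P.
Proof.
intros [Hx|<-] [Hy|<-]; try (rewrite ?Rmult_0_l, ?Rmult_0_r, !rpow_0; ring).
rewrite !rpow_Rpower by (try apply Rmult_lt_0_compat; assumption).
symmetry. apply Rpower_mult_distr; assumption.
Qed.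

Lemma rpow_le (x y P : R) : 0 <= P -> x <= y -> rpow x P <= rpow y P.
Proof.
intros HP Hxy. destruct (Rle_lt_dec x 0) as [Hx|Hx].
- rewrite (rpow_neg x) by exact Hx. apply rpow_nonneg.
- rewrite !rpow_Rpower by lra. apply Rle_Rpower_l; lra.
Qed.

Lemma rpow_succ (x P : R) : rpow x (P + 1) = x * rpow x P.
Proof.
destruct (Rle_lt_dec x 0) as [Hx|Hx].
- rewrite !rpow_neg by exact Hx. ring.
- rewrite !rpow_Rpower, Rpower_plus, Rpower_1 by exact Hx. ring.
Qed.

Lemma rpow_le_1 (x P : R) : 0 <= P -> x <= 1 -> rpow x P <= 1.
Proof.
intros HP Hx. apply Rle_trans with (1 := rpow_le x 1 P HP Hx).
rewrite rpow_Rpower by lra. unfold Rpower. rewrite ln_1, Rmult_0_r, exp_0. lra.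
Qed.

Lemma rpow_le_id (x P : R) : 1 <= P -> x <= 1 -> rpow x P <= Rabs x.
Proof.
intros HP Hx. replace P with (P - 1 + 1) by ring. rewrite rpow_succ.
destruct (Rle_lt_dec x 0) as [h|h].
- rewrite rpow_neg by exact h. rewrite Rmult_0_r. apply Rabs_pos.
- rewrite Rabs_pos_eq by lra. assert (h1 := rpow_le_1 x (P - 1) ltac:(lra) Hx).
  assert (h2 := rpow_nonneg x (P - 1)). nra.
Qed.

(** At 0 the extension by zero has a two-sided derivative: the difference quotient is [rpow] h P, at
    most |h| for small h since 1 <= P. *)
Lemma rpow_derive (x P : R) : 1 <= P -> 0 <= x -> is_derive (fun z => rpow z (P + 1)) x ((P + 1) * rpow
  x P).
Proof.
intros HP [Hx|<-].
- apply (is_derive_ext_loc (fun z => Rpower z (P + 1))).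
  { apply (filter_imp (fun z => 0 < z)); [|apply open_gt, Hx].
    intros z Hz. symmetry. apply rpow_Rpower, Hz. }
  eapply is_derive_eq; [apply (Rpower_derive_comp (fun z => z)); [exact Hx|apply @is_derive_id]|].
  rewrite rpow_Rpower, Rpower_plus, Rpower_1 by exact Hx. unfold one; simpl. field. lra.
- rewrite rpow_0, Rmult_0_r. apply is_derive_Reals. intros eps Heps.
  assert (h0 : 0 < Rmin eps 1) by (apply Rmin_pos; lra).
  exists (mkposreal _ h0). intros h hnz Hh. simpl in Hh.
  assert (h1 := Rmin_l eps 1). assert (h2 := Rmin_r eps 1).
  rewrite Rplus_0_l, rpow_0, rpow_succ, !Rminus_0_r.
  replace (h * rpow h P / h) with (rpow h P) by (field; exact hnz).
  rewrite Rabs_pos_eq by apply rpow_nonneg.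
  apply Rle_lt_trans with (Rabs h); [|lra].
  apply rpow_le_id; [exact HP|]. apply Rabs_def2 in Hh. lra.
Qed.

Lemma rpow_cont (x P : R) : 1 <= P -> 0 <= x -> continuity_pt (fun z => rpow z P) x.
Proof.
intros HP [Hx|<-].
- apply continuity_pt_filterlim. apply (continuous_ext_loc (fun z => rpow z P) (fun z => Rpower z P) x).
  + apply (filter_imp (fun z => 0 < z)); [|apply open_gt, Hx].
    intros z Hz. symmetry. apply rpow_Rpower, Hz.
  + apply continuity_pt_filterlim, Rpower_cont, Hx.
- intros eps Heps. exists (Rmin eps 1). split; [apply Rmin_pos; lra|].
  intros z [_ Hz]. change R in z.
  change (Rabs (z - 0) < Rmin eps 1) in Hz. change (Rabs (rpow z P - rpow 0 P) < eps).
  rewrite rpow_0, Rminus_0_r in *.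
  assert (h1 := Rmin_l eps 1). assert (h2 := Rmin_r eps 1).
  rewrite Rabs_pos_eq by apply rpow_nonneg.
  apply Rle_lt_trans with (Rabs z); [|lra].
  apply rpow_le_id; [exact HP|]. apply Rabs_def2 in Hz. lra.
Qed.

(** Stands in for integrating a bound on the derivative: only a primitive of the majorant has to be
    exhibited. *)
Lemma derive_compare (f B df dB : R -> R) (a b : R) : a <= b ->
  (forall z, a <= z <= b -> is_derive f z (df z)) ->
  (forall z, a <= z <= b -> is_derive B z (dB z)) ->
  (forall z, a <= z <= b -> Rabs (df z) <= dB z) ->
  Rabs (f b - f a) <= B b - B a.
Proof.
intros [Hab| ->] Hf HB Hd; [|rewrite !Rminus_diag, Rabs_R0; lra].
apply Rabs_le. split.
- destruct (MVT_cor2 (fun z => B z + f z) (fun z => dB z + df z) a b Hab) as [c [Hc1 Hc2]].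
  { intros c Hc. apply is_derive_Reals. apply @is_derive_plus; auto. }
  specialize (Hd c ltac:(lra)). apply Rabs_le_between in Hd. nra.
- destruct (MVT_cor2 (fun z => B z - f z) (fun z => dB z - df z) a b Hab) as [c [Hc1 Hc2]].
  { intros c Hc. apply is_derive_Reals. apply @is_derive_minus; auto. }
  specialize (Hd c ltac:(lra)). apply Rabs_le_between in Hd. nra.
Qed.

Lemma Rabs_sin_le (x : R) : 0 <= x -> Rabs (sin x) <= x.
Proof.
intros H. replace (sin x) with (sin x - sin 0) by (rewrite sin_0; ring).
replace x with (x - 0) at 2 by ring.
apply (derive_compare sin (fun z => z) cos (fun _ => 1)); [exact H| | |].
- intros z _. apply is_derive_sin.
- intros z _. apply @is_derive_id.
- intros z _. apply Rabs_le, COS_bound.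
Qed.

Lemma atan_le (x : R) : 0 <= x -> 0 <= atan x <= x.
Proof.
intros H. split.
- rewrite <- atan_0. destruct H as [H|<-]; [apply Rlt_le, atan_increasing, H|lra].
- apply Rle_trans with (Rabs (atan x - atan 0)); [rewrite atan_0, Rminus_0_r; apply Rle_abs|].
  replace x with (x - 0) at 2 by ring.
  apply (derive_compare atan (fun z => z) (fun z => / (1 + Rsqr z)) (fun _ => 1)); [exact H| | |].
  + intros z _. apply is_derive_atan.
  + intros z _. apply @is_derive_id.
  + intros z _. assert (h := Rle_0_sqr z). rewrite Rabs_pos_eq.
    * rewrite <- Rinv_1. apply Rinv_le_contravar; lra.
    * apply Rlt_le, Rinv_0_lt_compat. lra.
Qed.

Lemma limit_le (F : R -> R) (A d : R) : 0 < d -> continuity_pt F 0 ->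
  (forall x, 0 < x < d -> A <= F x) -> A <= F 0.
Proof.
intros Hd Hc H. apply Rnot_lt_le. intros Hl.
destruct (Hc (A - F 0)) as [e [He1 He2]]; [lra|].
assert (h1 := Rmin_l e d). assert (h2 := Rmin_r e d).
assert (h3 : 0 < Rmin e d) by (apply Rmin_pos; lra).
specialize (He2 (Rmin e d / 2)). specialize (H (Rmin e d / 2) ltac:(lra)).
simpl in He2. unfold R_dist in He2.
enough (Rabs (F (Rmin e d / 2) - F 0) < A - F 0) by (apply Rabs_def2 in H0; lra).
apply He2. split; [split; [exact I|lra]|]. rewrite Rminus_0_r, Rabs_pos_eq; lra.
Qed.

Lemma circ_sq_le_4 (rho th : R) : 0 <= rho <= 1 -> circ_sq rho th <= 4.
Proof. intros H. unfold circ_sq. assert (h := COS_bound th). nra. Qed.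

(** Controls the piece of the half circle of radius 1/2 that is lost when the arc is cut off at PI -
    d. *)
Lemma ker_re_bounded (a P : R) (m : nat) : 0 <= a -> 0 <= P -> forall kap,
  exists M, 0 <= M /\ forall rho th, 0 <= rho <= 1 -> 0 < circ_den rho th -> Rabs (ker_re a P m kap rho
    th) <= M.
Proof.
intros Ha HP. induction m as [|m IH]; intros kap.
- exists (Rpower 4 (P / 2)). split; [apply Rlt_le, exp_pos|].
  intros rho th Hr Hd. cbn [ker_re]. unfold circ_re.
  rewrite Rabs_mult, (Rabs_pos_eq (Rpower _ _)) by apply Rlt_le, exp_pos.
  rewrite <- (Rmult_1_r (Rpower 4 _)). apply Rmult_le_compat.
  + apply Rlt_le, exp_pos.
  + apply Rabs_pos.
  + apply Rle_Rpower_l; [lra|]. split; [apply circ_sq_pos, Hd|apply circ_sq_le_4, Hr].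
  + apply Rabs_le, COS_bound.
- destruct (IH kap) as [M1 [HM1 H1]]. destruct (IH (kap - 1)) as [M2 [HM2 H2]].
  exists (a * M1 + M2). split; [nra|]. intros rho th Hr Hd. cbn [ker_re].
  specialize (H1 rho th Hr Hd). specialize (H2 rho th Hr Hd).
  apply Rle_trans with (1 := Rabs_triang _ _). rewrite Rabs_Ropp, !Rabs_mult.
  rewrite (Rabs_pos_eq a), (Rabs_pos_eq rho) by lra.
  assert (h := Rabs_pos (ker_re a P m (kap - 1) rho th)). nra.
Qed.

(* The bound is uniform up to the branch point [rho = 1] because [|w| arg w = O(d)] and [1 <= P]. *)
Lemma ker_im_small (a P : R) (m : nat) : 0 <= a -> 1 <= P -> forall kap, sin (kap * PI) = 0 ->
  exists M, 0 <= M /\ forall rho d, 0 <= rho <= 1 -> 0 < d < 1 ->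
    Rabs (ker_im a P m kap rho (PI - d)) <= M * d.
Proof.
intros Ha HP. induction m as [|m IH]; intros kap Hk.
- exists (Rpower 4 ((P - 1) / 2) * (2 * P) + Rpower 4 (P / 2) * Rabs kap).
  assert (e1 := exp_pos ((P - 1) / 2 * ln 4)). fold (Rpower 4 ((P - 1) / 2)) in e1.
  assert (e2 := exp_pos (P / 2 * ln 4)). fold (Rpower 4 (P / 2)) in e2.
  assert (hk := Rabs_pos kap).
  split; [nra|]. intros rho d Hr Hd. cbn [ker_im]. unfold circ_im.
  assert (hpi : 3 < PI) by (assert (h := PI2_3_2); unfold PI2 in h; lra).
  assert (Hdw : 0 < circ_den rho (PI - d)) by (apply circ_den_pos; lra).
  assert (Hq := circ_sq_pos _ _ Hdw).
  assert (Hs0 := sqrt_lt_R0 _ Hq).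
  assert (Hsd : 0 <= sin d <= d).
  { split; [apply Rlt_le, sin_gt_0; lra|]. apply Rlt_le, sin_lt_x; lra. }
  assert (Hdl : sqrt (circ_sq rho (PI - d)) <= circ_den rho (PI - d)).
  { unfold circ_den. assert (h := COS_bound (PI - d)). nra. }
  assert (Haw : 0 <= circ_arg rho (PI - d) /\ sqrt (circ_sq rho (PI - d)) * circ_arg rho (PI - d) <= 2 * d).
  { unfold circ_arg. rewrite sin_PI_x.
    assert (Hx : 0 <= rho * sin d / circ_den rho (PI - d)).
    { apply Rmult_le_pos; [nra|]. apply Rlt_le, Rinv_0_lt_compat, Hdw. }
    assert (h := atan_le _ Hx). split; [lra|].
    apply Rle_trans with (sqrt (circ_sq rho (PI - d)) * (2 * (rho * sin d / circ_den rho (PI - d))));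
      [nra|].
    replace (sqrt (circ_sq rho (PI - d)) * (2 * (rho * sin d / circ_den rho (PI - d)))) with
      (2 * (rho * sin d) * (sqrt (circ_sq rho (PI - d)) / circ_den rho (PI - d))) by (field; lra).
    assert (h2 : sqrt (circ_sq rho (PI - d)) / circ_den rho (PI - d) <= 1).
    { apply Rmult_le_reg_r with (circ_den rho (PI - d)); [exact Hdw|].
      unfold Rdiv. rewrite Rmult_assoc, Rinv_l by lra. lra. }
    assert (h3 : 0 <= rho * sin d <= d) by nra. nra. }
  destruct Haw as [Ha1 Ha2].
  (* As sin (kap PI) = 0, only the small angle P arg w + kap d enters. *)
  assert (Hsin : Rabs (sin (P * circ_arg rho (PI - d) - kap * (PI - d))) <= P * circ_arg rho (PI - d) +
    Rabs kap * d).
  { replace (P * circ_arg rho (PI - d) - kap * (PI - d)) with ((P * circ_arg rho (PI - d) + kap * d) -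
      kap * PI) by ring.
    rewrite sin_minus, Hk, Rmult_0_r, Rminus_0_r, Rabs_mult.
    assert (h1 : Rabs (cos (kap * PI)) <= 1) by (apply Rabs_le, COS_bound).
    assert (h2 : Rabs (sin (P * circ_arg rho (PI - d) + kap * d)) <= P * circ_arg rho (PI - d) + Rabs
      kap * d).
    { apply Rle_trans with (Rabs (P * circ_arg rho (PI - d) + kap * d)).
      - destruct (Rle_lt_dec 0 (P * circ_arg rho (PI - d) + kap * d)) as [h|h].
        + rewrite (Rabs_pos_eq (P * circ_arg rho (PI - d) + kap * d)) by exact h. apply Rabs_sin_le, h.
        + rewrite <- Rabs_Ropp, <- sin_neg.
          rewrite (Rabs_left (P * circ_arg rho (PI - d) + kap * d)) by exact h. apply Rabs_sin_le. lra.
      - apply Rle_trans with (1 := Rabs_triang _ _). rewrite !Rabs_mult.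
        rewrite (Rabs_pos_eq P), (Rabs_pos_eq d), (Rabs_pos_eq (circ_arg _ _)) by lra. lra. }
    assert (h3 := Rabs_pos (cos (kap * PI))).
    assert (h4 := Rabs_pos (sin (P * circ_arg rho (PI - d) + kap * d))). nra. }
  rewrite Rabs_mult, (Rabs_pos_eq (Rpower _ _)) by apply Rlt_le, exp_pos.
  assert (E : Rpower (circ_sq rho (PI - d)) (P / 2) =
    Rpower (circ_sq rho (PI - d)) ((P - 1) / 2) * sqrt (circ_sq rho (PI - d))).
  { rewrite <- Rpower_sqrt, <- Rpower_plus by exact Hq. f_equal. field. }
  assert (Q1 : Rpower (circ_sq rho (PI - d)) ((P - 1) / 2) <= Rpower 4 ((P - 1) / 2)).
  { apply Rle_Rpower_l; [lra|]. split; [exact Hq|apply circ_sq_le_4, Hr]. }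
  assert (Q2 : Rpower (circ_sq rho (PI - d)) (P / 2) <= Rpower 4 (P / 2)).
  { apply Rle_Rpower_l; [lra|]. split; [exact Hq|apply circ_sq_le_4, Hr]. }
  assert (Q3 : 0 < Rpower (circ_sq rho (PI - d)) ((P - 1) / 2)) by apply exp_pos.
  assert (Q4 : 0 < Rpower (circ_sq rho (PI - d)) (P / 2)) by apply exp_pos.
  apply Rle_trans with (Rpower (circ_sq rho (PI - d)) (P / 2) * (P * circ_arg rho (PI - d)) +
    Rpower (circ_sq rho (PI - d)) (P / 2) * (Rabs kap * d)).
  { rewrite <- Rmult_plus_distr_l. apply Rmult_le_compat_l; [lra|exact Hsin]. }
  rewrite Rmult_plus_distr_r. apply Rplus_le_compat.
  + rewrite E.
    replace (Rpower (circ_sq rho (PI - d)) ((P - 1) / 2) * sqrt (circ_sq rho (PI - d)) * (P * circ_arg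
      rho (PI - d))) with
      (Rpower (circ_sq rho (PI - d)) ((P - 1) / 2) * (P * (sqrt (circ_sq rho (PI - d)) * circ_arg rho
        (PI - d)))) by ring.
    rewrite Rmult_assoc. apply Rmult_le_compat; [lra| |exact Q1|].
    * apply Rmult_le_pos; [lra|]. apply Rmult_le_pos; lra.
    * rewrite (Rmult_comm 2 P), Rmult_assoc. apply Rmult_le_compat_l; lra.
  + rewrite Rmult_assoc. apply Rmult_le_compat_r; [nra|exact Q2].
- assert (Hk' : sin ((kap - 1) * PI) = 0).
  { replace ((kap - 1) * PI) with (kap * PI - PI) by ring.
    rewrite sin_minus, Hk, sin_PI. ring. }
  destruct (IH kap Hk) as [M1 [HM1 H1]]. destruct (IH (kap - 1) Hk') as [M2 [HM2 H2]].
  exists (a * M1 + M2). split; [nra|]. intros rho d Hr Hd. cbn [ker_im].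
  specialize (H1 rho d Hr Hd). specialize (H2 rho d Hr Hd).
  apply Rle_trans with (1 := Rabs_triang _ _). rewrite Rabs_Ropp, !Rabs_mult.
  rewrite (Rabs_pos_eq a), (Rabs_pos_eq rho) by lra.
  assert (h := Rabs_pos (ker_im a P m (kap - 1) rho (PI - d))).
  assert (a * Rabs (ker_im a P m kap rho (PI - d)) <= a * (M1 * d)) by (apply Rmult_le_compat_l; lra).
  nra.
Qed.

(** Modulus of the integrand. Written with [rpow] it is continuous on the whole half circle, branch
    point and cut included, so its integral up to PI bounds every truncated arc. *)
Definition ker_mod (a P : R) (m : nat) (rho th : R) : R :=
  sqrt (rpow (circ_sq rho th) P * (a ^ 2 + rho ^ 2 - 2 * a * rho * cos th) ^ m).

Lemma chord_nonneg (a rho th : R) : 0 <= a -> 0 <= rho -> 0 <= a ^ 2 + rho ^ 2 - 2 * a * rho * cos th.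
Proof.
intros Ha Hr. assert (h := COS_bound th).
assert (0 <= (a - rho) ^ 2) by apply pow2_ge_0.
assert (0 <= a * rho) by nra. nra.
Qed.

Lemma ker_re_im_le_mod (a P kap rho th : R) (m : nat) : 0 < circ_den rho th ->
  Rabs (ker_re a P m kap rho th) <= ker_mod a P m rho th /\ Rabs (ker_im a P m kap rho th) <= ker_mod a
    P m rho th.
Proof.
intros Hd. assert (Hq := circ_sq_pos _ _ Hd).
assert (E : rpow (circ_sq rho th) P = Rpower (circ_sq rho th) (P / 2) ^ 2).
{ rewrite rpow_Rpower by exact Hq. simpl pow. rewrite Rmult_1_r, <- Rpower_plus. f_equal. field. }
unfold ker_mod. rewrite E, <- (ker_re_modulus a P kap rho th m).
rewrite <- !sqrt_Rsqr_abs. unfold Rsqr.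
split; apply sqrt_le_1_alt;
  assert (h1 := pow2_ge_0 (ker_re a P m kap rho th)); assert (h2 := pow2_ge_0 (ker_im a P m kap rho
    th)); simpl pow in *; lra.
Qed.

Lemma ker_mod_ex_RInt (a P rho : R) (m : nat) (u v : R) : 0 <= a -> 0 <= rho -> 1 <= P ->
  ex_RInt (fun th => ker_mod a P m rho th) u v.
Proof.
intros Ha Hr HP. apply (ex_RInt_continuous (fun th => ker_mod a P m rho th)). intros th _.
apply continuity_pt_filterlim. unfold ker_mod.
apply (continuity_pt_comp (fun th => rpow (circ_sq rho th) P * (a ^ 2 + rho ^ 2 - 2 * a * rho * cos th)
  ^ m) sqrt).
- apply continuity_pt_mult.
  + apply (continuity_pt_comp (fun th => circ_sq rho th) (fun z => rpow z P)).
    * apply continuity_pt_filterlim, (ex_derive_continuous (fun th => circ_sq rho th)).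
      eexists. apply circ_sq_derive_th.
    * apply rpow_cont; [exact HP|apply circ_sq_nonneg].
  + apply continuity_pt_filterlim, (ex_derive_continuous (fun th => (a ^ 2 + rho ^ 2 - 2 * a * rho *
      cos th) ^ m)).
    auto_derive. auto.
- apply continuity_pt_sqrt. apply Rmult_le_pos; [apply rpow_nonneg|apply pow_le, chord_nonneg; assumption].
Qed.

Lemma ker_mod_PI (a P rho : R) (m : nat) : 0 <= a -> 1 <= rho ->
  ker_mod a P m rho PI = rpow (rho - 1) P * (a + rho) ^ m.
Proof.
intros Ha Hr. unfold ker_mod, circ_sq. rewrite cos_PI.
replace (1 + 2 * rho * -1 + rho ^ 2) with ((rho - 1) * (rho - 1)) by ring.
replace (a ^ 2 + rho ^ 2 - 2 * a * rho * -1) with ((a + rho) * (a + rho)) by ring.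
rewrite rpow_mult by lra. rewrite Rpow_mult_distr.
replace (rpow (rho - 1) P * rpow (rho - 1) P * ((a + rho) ^ m * (a + rho) ^ m)) with
  ((rpow (rho - 1) P * (a + rho) ^ m) * (rpow (rho - 1) P * (a + rho) ^ m)) by ring.
apply sqrt_square. apply Rmult_le_pos; [apply rpow_nonneg|apply pow_le; lra].
Qed.

Lemma ker_re_RInt_le (a P kap rho T : R) (m : nat) : 0 <= a -> 0 <= rho -> 1 <= P ->
  0 <= T <= PI -> arc_ok T rho ->
  Rabs (RInt (fun th => ker_re a P m kap rho th) 0 T) <= RInt (fun th => ker_mod a P m rho th) 0 PI.
Proof.
intros Ha Hr HP HT Hok.
apply Rle_trans with (RInt (fun th => ker_mod a P m rho th) 0 T).
- apply Rle_trans with (RInt (fun th => Rabs (ker_re a P m kap rho th)) 0 T).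
  + apply abs_RInt_le; [lra|]. apply ker_re_ex_RInt; assumption.
  + apply RInt_le; [lra| |apply ker_mod_ex_RInt; assumption|].
    * apply (ex_RInt_norm (fun th => ker_re a P m kap rho th)), ker_re_ex_RInt; assumption.
    * intros th Hth. apply ker_re_im_le_mod, (arc_ok_pos T); tauto || lra.
- rewrite <- (RInt_Chasles (fun th => ker_mod a P m rho th) 0 T PI) by (apply ker_mod_ex_RInt; assumption).
  unfold plus; simpl.
  assert (0 <= RInt (fun th => ker_mod a P m rho th) T PI).
  { apply RInt_ge_0; [lra|apply ker_mod_ex_RInt; assumption|]. intros; apply sqrt_pos. }
  lra.
Qed.

(** At angle PI - d, |1 + z|^2 = (rho - 1)^2 + 2 rho (1 - cos d) <= (rho - 1)^2 + e^2. The shift e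
    keeps the base positive at rho = 1 and tends to 0 with d. *)
Lemma ker_im_le_cut (a P kap rho d e : R) (m : nat) : 0 <= a -> 1 <= P -> 1 <= rho -> 0 < d < 1 ->
  0 < e -> rho * d ^ 2 <= e ^ 2 ->
  Rabs (ker_im a P m kap rho (PI - d)) <= Rpower (rho - 1 + e) P * (a + rho) ^ m.
Proof.
intros Ha HP Hr Hd He Hde.
assert (hpi : 3 < PI) by (assert (h := PI2_3_2); unfold PI2 in h; lra).
assert (Hdw : 0 < circ_den rho (PI - d)) by (apply circ_den_pos; lra).
assert (Hq := circ_sq_pos _ _ Hdw).
assert (Hcos : cos (PI - d) = - cos d).
{ rewrite cos_minus, cos_PI, sin_PI. ring. }
assert (Hc : 1 - d ^ 2 / 2 <= cos d).
{ replace d with (2 * (d / 2)) at 2 by field. rewrite cos_2a_sin.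
  assert (h1 : 0 < sin (d / 2)) by (apply sin_gt_0; lra).
  assert (h2 : sin (d / 2) < d / 2) by (apply sin_lt_x; lra). nra. }
assert (Hq2 : circ_sq rho (PI - d) <= (rho - 1 + e) * (rho - 1 + e)).
{ unfold circ_sq. rewrite Hcos.
  assert (h3 : 2 * rho * (1 - cos d) <= e ^ 2).
  { apply Rle_trans with (2 := Hde). nra. }
  assert (0 <= (rho - 1) * e) by (apply Rmult_le_pos; lra). nra. }
assert (Hch : 0 <= a ^ 2 + rho ^ 2 - 2 * a * rho * cos (PI - d) <= (a + rho) * (a + rho)).
{ split; [apply chord_nonneg; lra|]. rewrite Hcos. assert (h := COS_bound d).
  assert (0 <= a * rho) by nra. nra. }
apply Rle_trans with (1 := proj2 (ker_re_im_le_mod a P kap rho (PI - d) m Hdw)).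
rewrite <- (sqrt_square (Rpower (rho - 1 + e) P * (a + rho) ^ m)).
2:{ apply Rmult_le_pos; [apply Rlt_le, exp_pos|apply pow_le; lra]. }
unfold ker_mod. apply sqrt_le_1_alt.
replace (Rpower (rho - 1 + e) P * (a + rho) ^ m * (Rpower (rho - 1 + e) P * (a + rho) ^ m)) with
  (rpow (rho - 1 + e) P * rpow (rho - 1 + e) P * ((a + rho) ^ m * (a + rho) ^ m))
  by (rewrite rpow_Rpower by lra; ring).
rewrite <- rpow_mult, <- Rpow_mult_distr by lra.
apply Rmult_le_compat.
- apply rpow_nonneg.
- apply pow_le, Hch.
- apply rpow_le; [lra|exact Hq2].
- apply pow_incr, Hch.
Qed.

(** Majorant of the cut term divided by z^n, as an exponential so that its logarithmic derivative
    can be read off. *)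
Definition cut_mod (a P e : R) (m n : nat) (z : R) : R :=
  exp (P * ln (z - 1 + e) + INR m * ln (a + z) - INR n * ln z).

Lemma cut_mod_eq (a P e z : R) (m n : nat) : 0 <= a -> 0 < e -> 1 <= z ->
  cut_mod a P e m n z = Rpower (z - 1 + e) P * (a + z) ^ m / z ^ n.
Proof.
intros Ha He Hz. unfold cut_mod.
rewrite <- !Rpower_pow by lra. unfold Rpower, Rminus, Rdiv.
rewrite !exp_plus, exp_Ropp. reflexivity.
Qed.

Lemma cut_mod_derive (a P e z : R) (m n : nat) : 0 <= a -> 0 < e -> 1 <= z ->
  is_derive (cut_mod a P e m n) z
   (cut_mod a P e m n z * (P / (z - 1 + e) + INR m / (a + z) - INR n / z)).
Proof.
intros Ha He Hz. unfold cut_mod. eapply is_derive_eq.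
- apply (is_derive_comp exp (fun z => P * ln (z - 1 + e) + INR m * ln (a + z) - INR n * ln z));
    [apply is_derive_exp|].
  instantiate (1 := P / (z - 1 + e) + INR m / (a + z) - INR n / z).
  auto_derive; [repeat split; lra|]. field. repeat split; lra.
- apply Rmult_comm.
Qed.

(* AM-GM: [g / z <= sqrt (2 / n) sqrt (g g')] because [n g / (2 z^2) <= g'] *)
Lemma cut_mod_step (a P e z w : R) (m n : nat) : 0 <= a -> 0 < e <= / 2 -> 1 <= z -> 0 < w ->
  (1 <= n)%nat -> INR n <= P ->
  0 <= P / (z - 1 + e) + INR m / (a + z) - INR n / z /\
  cut_mod a P e m n z / z <= sqrt (2 / INR n) / 2 *
    (w * (cut_mod a P e m n z * (P / (z - 1 + e) + INR m / (a + z) - INR n / z)) + cut_mod a P e m n z / w).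
Proof.
intros Ha He Hz Hw Hn HP.
assert (Hn' : 1 <= INR n) by (apply (le_INR 1), Hn).
set (L := P / (z - 1 + e) + INR m / (a + z) - INR n / z).
(* Here n <= P and e <= 1/2 enter: P / (z - 1 + e) - n / z >= n (1 - e) / (z (z - 1 + e)) >= n / (2
   z^2). *)
assert (hL : INR n / 2 / (z * z) <= L).
{ unfold L. assert (h1 : INR n / (z - 1 + e) <= P / (z - 1 + e)).
  { apply Rmult_le_compat_r; [apply Rlt_le, Rinv_0_lt_compat; lra|exact HP]. }
  assert (h2 : 0 <= INR m / (a + z)).
  { apply Rmult_le_pos; [apply pos_INR|apply Rlt_le, Rinv_0_lt_compat; lra]. }
  assert (h3 : INR n / (z - 1 + e) - INR n / z = INR n * (1 - e) / (z * (z - 1 + e))) by (field; lra).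
  assert (h4 : INR n / 2 / (z * z) <= INR n * (1 - e) / (z * (z - 1 + e))).
  { apply Rmult_le_compat; [nra|apply Rlt_le, Rinv_0_lt_compat; nra|nra|].
    apply Rinv_le_contravar; nra. }
  lra. }
assert (hn0 : 0 < INR n / 2 / (z * z)).
{ repeat apply Rdiv_lt_0_compat; nra. }
split; [lra|].
assert (hG : 0 < cut_mod a P e m n z) by apply exp_pos.
set (G := cut_mod a P e m n z) in *.
set (mu := sqrt (2 / INR n)).
assert (hmu : mu * mu = 2 / INR n).
{ apply sqrt_sqrt. apply Rlt_le, Rdiv_lt_0_compat; lra. }
assert (hmu0 : 0 < mu) by (apply sqrt_lt_R0, Rdiv_lt_0_compat; lra).
assert (hL2 : 1 <= mu * mu * L * (z * z)).
{ rewrite hmu. replace 1 with (2 / INR n * (INR n / 2 / (z * z)) * (z * z)) by (field; lra).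
  apply Rmult_le_compat_r; [nra|]. apply Rmult_le_compat_l; [|exact hL].
  apply Rlt_le, Rdiv_lt_0_compat; lra. }
replace (mu / 2 * (w * (G * L) + G / w)) with (G / z * (mu / 2 * (w * L * z + z / w))) by (field; lra).
rewrite <- (Rmult_1_r (G / z)) at 1. apply Rmult_le_compat_l.
{ apply Rlt_le, Rdiv_lt_0_compat; lra. }
assert (hw : z / w * (w * L * z) = L * (z * z)) by (field; lra).
set (x := w * L * z) in *. set (y := z / w) in *.
assert (hx : 0 < x) by (unfold x; apply Rmult_lt_0_compat; [apply Rmult_lt_0_compat|]; lra).
assert (hy : 0 < y) by (unfold y; apply Rdiv_lt_0_compat; lra).
assert (hxy : 1 <= mu * mu * (x * y)) by nra.
assert (h4 : 4 * (x * y) <= (x + y) * (x + y)) by (assert (h := pow2_ge_0 (x - y)); nra).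
apply Rsqr_incr_0_var; [unfold Rsqr|].
- assert (0 < mu * mu) by nra. nra.
- nra.
Qed.

(** Inside the unit disc this is Cauchy's estimate. Otherwise E = J / z^n is followed from radius
    1/2, where it is PI times the coefficient up to O(d), through 1 to rho. It moves by O(d) on
    [1/2, 1] and by the cut term on [1, rho]; finally d tends to 0. *)
Lemma cauchy_bound (a P rho : R) (m n : nat) : 0 <= a -> 1 <= P -> (1 <= n)%nat -> INR n <= P -> 0 < rho ->
  PI * Rabs (ker_coef a P m n) * rho ^ n <=
  RInt (fun th => ker_mod a P m rho th) 0 PI + sqrt (2 * rho / INR n) * ker_mod a P m rho PI.
Proof.
intros Ha HP Hn HnP Hr.
assert (hpi : 3 < PI) by (assert (h := PI2_3_2); unfold PI2 in h; lra).
assert (Hn' : 1 <= INR n) by (apply (le_INR 1), Hn).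
destruct (Rlt_le_dec rho 1) as [Hr1|Hr1].
{ destruct (ker_re_full a P rho m (conj Hr Hr1)) as [Hf _]. specialize (Hf n).
  apply Rle_trans with (RInt (fun th => ker_mod a P m rho th) 0 PI).
  - replace (PI * Rabs (ker_coef a P m n) * rho ^ n) with (Rabs (PI * ker_coef a P m n * rho ^ n)).
    + rewrite <- Hf. apply ker_re_RInt_le; try lra. left. rewrite Rabs_pos_eq; lra.
    + rewrite !Rabs_mult, (Rabs_pos_eq PI), (Rabs_pos_eq (rho ^ n)); [reflexivity|apply pow_le; lra|lra].
  - assert (0 <= sqrt (2 * rho / INR n) * ker_mod a P m rho PI) by (apply Rmult_le_pos; apply
      sqrt_pos). lra. }
destruct (ker_im_small a P m Ha HP (INR n) (sin_INR_PI n)) as [M1 [HM1 H1]].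
destruct (ker_re_bounded a P m Ha ltac:(lra) (INR n)) as [M2 [HM2 H2]].
assert (h2n : 0 < (/ 2) ^ n) by (apply pow_lt; lra).
assert (hrn : 0 < rho ^ n) by (apply pow_lt; lra).
(* This k is the AM-GM weight that balances both terms at the end point rho, and the shift e = k d
   satisfies rho d^2 = e^2. *)
set (k := sqrt rho).
assert (hk : k * k = rho) by (apply sqrt_sqrt; lra).
assert (hk1 : 1 <= k) by (rewrite <- sqrt_1; apply sqrt_le_1_alt; exact Hr1).
set (I0 := RInt (fun th => ker_mod a P m rho th) 0 PI).
set (mu := sqrt (2 / INR n)).
set (M3 := M2 / (/ 2) ^ n + M1 / (/ 2) ^ S n).
rewrite ker_mod_PI by lra.
assert (Emu : sqrt (2 * rho / INR n) = mu * k).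
{ unfold mu, k. rewrite <- sqrt_mult_alt; [f_equal; field; lra|].
  apply Rlt_le, Rdiv_lt_0_compat; lra. }
rewrite Emu.
(* The range of d makes k d <= 1/2, as [cut_mod_step] asks. [M3] collects the errors up to radius 1
   and is independent of d. *)
assert (Key : forall d, 0 < d < / (2 * k) ->
  PI * Rabs (ker_coef a P m n) <= I0 / rho ^ n + M3 * d + mu * k * (rpow (rho - 1 + k * d) P * (a +
    rho) ^ m / rho ^ n)).
{ intros d Hd.
  assert (hd1 : k * d <= / 2).
  { apply Rle_trans with (k * / (2 * k)); [apply Rmult_le_compat_l; lra|]. right. field. lra. }
  assert (hd2 : 0 < k * d) by (apply Rmult_lt_0_compat; lra).
  assert (hd3 : 0 < d < 1) by nra.
  set (T := PI - d).
  assert (HT : 0 <= T <= PI) by (unfold T; lra).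
  assert (Hok : forall z, 0 < z -> arc_ok T z) by (intros z Hz; right; unfold T; lra).
  set (J := fun z => RInt (fun th => ker_re a P m (INR n) z th) 0 T).
  set (E := fun z => J z / z ^ n).
  assert (HE : forall z, 0 < z -> is_derive E z (ker_im a P m (INR n) z T / z ^ S n)).
  { intros z Hz. destruct (ker_re_Cauchy a P (INR n) T z m HT (Hok z Hz)) as [D [HD1 HD2]].
    fold (J z) in HD2. assert (hz : 0 < z ^ n) by (apply pow_lt, Hz).
    eapply is_derive_eq.
    - apply is_derive_div; [exact HD1|apply is_derive_pow, @is_derive_id|lra].
    - change ((D * z ^ n - J z * (INR n * 1 * z ^ pred n)) / (z ^ n) ^ 2 = ker_im a P m (INR n) z T / z
        ^ S n).
      replace (ker_im a P m (INR n) z T) with (z * D - INR n * J z) by lra.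
      destruct n as [|n']; [lia|]. simpl pred. simpl pow. simpl pow in hz. field.
      assert (z ^ n' <> 0) by (apply pow_nonzero; lra). lra. }
  assert (A1 : Rabs (J (/ 2) - PI * ker_coef a P m n * (/ 2) ^ n) <= M2 * d).
  { destruct (ker_re_full a P (/ 2) m ltac:(lra)) as [Hf _]. rewrite <- Hf.
    assert (Hok2 : arc_ok PI (/ 2)) by (left; rewrite Rabs_pos_eq; lra).
    assert (Hex : ex_RInt (fun th => ker_re a P m (INR n) (/ 2) th) 0 PI) by (apply ker_re_ex_RInt;
      [lra|exact Hok2]).
    assert (Hex1 : ex_RInt (fun th => ker_re a P m (INR n) (/ 2) th) 0 T) by (apply ker_re_ex_RInt;
      [lra|apply Hok; lra]).
    assert (Hex2 : ex_RInt (fun th => ker_re a P m (INR n) (/ 2) th) T PI).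
    { apply (@ex_RInt_Chasles_2 R_CompleteNormedModule _ 0); [lra|exact Hex]. }
    rewrite <- (RInt_Chasles _ 0 T PI Hex1 Hex2). unfold plus; simpl. fold (J (/ 2)).
    match goal with |- Rabs (?x - (?x + ?y)) <= _ => replace (x - (x + y)) with (- y) by ring end.
    rewrite Rabs_Ropp.
    apply Rle_trans with ((PI - T) * M2); [|unfold T; right; ring].
    apply abs_RInt_le_const; [lra|exact Hex2|].
    intros th Hth. apply H2; [lra|]. apply circ_den_pos_small. rewrite Rabs_pos_eq; lra. }
  assert (A2 : Rabs (E 1 - E (/ 2)) <= M1 / (/ 2) ^ S n * d).
  { apply Rle_trans with (M1 * d / (/ 2) ^ S n * 1 - M1 * d / (/ 2) ^ S n * / 2).
    - apply (derive_compare E (fun z => M1 * d / (/ 2) ^ S n * z) (fun z => ker_im a P m (INR n) z T /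
        z ^ S n)
        (fun _ => M1 * d / (/ 2) ^ S n)); [lra| | |].
      + intros z Hz. apply HE. lra.
      + intros z Hz. eapply is_derive_eq; [apply is_derive_scal, @is_derive_id|apply Rmult_1_r].
      + intros z Hz. assert (hz : 0 < z ^ S n) by (apply pow_lt; lra).
        unfold Rdiv. rewrite Rabs_mult, (Rabs_pos_eq (/ _)) by (apply Rlt_le, Rinv_0_lt_compat, hz).
        apply Rmult_le_compat; [apply Rabs_pos|apply Rlt_le, Rinv_0_lt_compat, hz| |].
        * apply H1; lra.
        * apply Rinv_le_contravar; [apply pow_lt; lra|]. apply pow_incr; lra.
    - assert (h : 0 < / (/ 2) ^ S n) by (apply Rinv_0_lt_compat, pow_lt; lra).
      unfold Rdiv. assert (0 <= M1 * d) by nra.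
      assert (0 <= M1 * d * / (/ 2) ^ S n) by (apply Rmult_le_pos; lra). nra. }
  set (G := cut_mod a P (k * d) m n).
  assert (GG : forall z, 1 <= z <= rho -> G z <= G rho).
  { intros z Hz.
    destruct (Rle_lt_or_eq_dec z rho ltac:(lra)) as [hz|hz]; [|rewrite hz; lra].
    destruct (MVT_cor2 G (fun z => G z * (P / (z - 1 + k * d) + INR m / (a + z) - INR n / z)) z rho hz)
      as [c [Hc1 Hc2]].
    { intros c Hc. apply is_derive_Reals, cut_mod_derive; lra. }
    destruct (cut_mod_step a P (k * d) c 1 m n) as [h _]; try lra; try assumption.
    assert (0 <= G c) by (apply Rlt_le, exp_pos).
    assert (0 <= G c * (P / (c - 1 + k * d) + INR m / (a + c) - INR n / c)) by (apply Rmult_le_pos;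
      assumption).
    nra. }
  assert (A3 : Rabs (E rho - E 1) <= mu * k * G rho).
  (* The comparison function is a primitive of mu / 2 (k G' + G(rho) / k), using G <= G(rho). Since
     rho / k = k, its two terms at rho add up to mu k G(rho). *)
  { apply Rle_trans with (mu / 2 * (k * G rho + G rho / k * rho) - mu / 2 * (k * G 1 + G rho / k * 1)).
    - apply (derive_compare E (fun z => mu / 2 * (k * G z + G rho / k * z)) (fun z => ker_im a P m (INR
        n) z T / z ^ S n)
        (fun z => mu / 2 * (k * (G z * (P / (z - 1 + k * d) + INR m / (a + z) - INR n / z)) + G rho /
          k))); [lra| | |].
      + intros z Hz. apply HE. lra.
      + intros z Hz. apply is_derive_scal. apply @is_derive_plus.
        * apply is_derive_scal. apply cut_mod_derive; lra.
        * eapply is_derive_eq; [apply is_derive_scal, @is_derive_id|apply Rmult_1_r].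
      + intros z Hz. assert (hz : 0 < z ^ n) by (apply pow_lt; lra).
        apply Rle_trans with (G z / z).
        * unfold G. rewrite cut_mod_eq by lra. simpl pow.
          unfold Rdiv. rewrite Rabs_mult, (Rabs_pos_eq (/ _)) by (apply Rlt_le, Rinv_0_lt_compat; nra).
          rewrite Rinv_mult, (Rmult_comm (/ z)), <- Rmult_assoc.
          apply Rmult_le_compat_r; [apply Rlt_le, Rinv_0_lt_compat; lra|].
          apply Rmult_le_compat_r; [apply Rlt_le, Rinv_0_lt_compat; lra|].
          apply ker_im_le_cut; try lra.
          replace ((k * d) ^ 2) with (rho * d ^ 2) by (rewrite <- hk; ring).
          apply Rmult_le_compat_r; [apply pow2_ge_0|lra].
        * destruct (cut_mod_step a P (k * d) z k m n) as [_ h]; try lra; try assumption.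
          apply Rle_trans with (1 := h). fold G. fold mu.
          apply Rmult_le_compat_l; [assert (h' := sqrt_pos (2 / INR n)); fold mu in h'; lra|].
          apply Rplus_le_compat_l. apply Rmult_le_compat_r; [apply Rlt_le, Rinv_0_lt_compat; lra|].
          apply GG, Hz.
    - assert (hG1 : 0 < G 1) by apply exp_pos. assert (hGr : 0 < G rho) by apply exp_pos.
      assert (hmu : 0 <= mu) by apply sqrt_pos.
      replace (G rho / k * rho) with (k * G rho) by (rewrite <- hk; field; lra).
      assert (0 <= G rho / k * 1) by (rewrite Rmult_1_r; apply Rlt_le, Rdiv_lt_0_compat; lra).
      assert (0 <= mu / 2 * (k * G 1 + G rho / k * 1)).
      { apply Rmult_le_pos; [lra|]. apply Rplus_le_le_0_compat; [|assumption]. nra. }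
      lra. }
  assert (A4 : Rabs (E rho) <= I0 / rho ^ n).
  { unfold E, Rdiv. rewrite Rabs_mult, (Rabs_pos_eq (/ _)) by (apply Rlt_le, Rinv_0_lt_compat, hrn).
    apply Rmult_le_compat_r; [apply Rlt_le, Rinv_0_lt_compat, hrn|].
    apply ker_re_RInt_le; try lra. apply Hok; lra. }
  assert (A5 : Rabs (E (/ 2) - PI * ker_coef a P m n) <= M2 / (/ 2) ^ n * d).
  { replace (E (/ 2) - PI * ker_coef a P m n) with ((J (/ 2) - PI * ker_coef a P m n * (/ 2) ^ n) / (/
      2) ^ n)
      by (unfold E; set (q := (/ 2) ^ n) in *; field; lra).
    unfold Rdiv at 1. rewrite Rabs_mult, (Rabs_pos_eq (/ _)) by (apply Rlt_le, Rinv_0_lt_compat, h2n).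
    replace (M2 / (/ 2) ^ n * d) with (M2 * d * / (/ 2) ^ n) by (unfold Rdiv; ring).
    apply Rmult_le_compat_r; [apply Rlt_le, Rinv_0_lt_compat, h2n|exact A1]. }
  replace (PI * Rabs (ker_coef a P m n)) with (Rabs (PI * ker_coef a P m n)) by (rewrite Rabs_mult,
    (Rabs_pos_eq PI); lra).
  replace (PI * ker_coef a P m n) with (E rho - (E rho - E 1) - (E 1 - E (/ 2)) - (E (/ 2) - PI *
    ker_coef a P m n)) by ring.
  replace (rpow (rho - 1 + k * d) P * (a + rho) ^ m / rho ^ n) with (G rho)
    by (unfold G; rewrite cut_mod_eq, rpow_Rpower by lra; reflexivity).
  unfold M3.
  apply Rle_trans with (Rabs (E rho) + Rabs (E rho - E 1) + Rabs (E 1 - E (/ 2)) + Rabs (E (/ 2) - PI *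
    ker_coef a P m n)).
  2:{ lra. }
  set (x1 := E rho - E 1). set (x2 := E 1 - E (/ 2)). set (x3 := E (/ 2) - PI * ker_coef a P m n).
assert (t1 := Rabs_triang (E rho - x1 - x2) (- x3)). assert (t2 := Rabs_triang (E rho - x1) (- x2)).
  assert (t3 := Rabs_triang (E rho) (- x1)). rewrite Rabs_Ropp in t1, t2, t3.
  unfold Rminus in *. lra. }
(* At rho = 1 the base of the power tends to 0, so the limit rests on the continuity of [rpow] at
   0. *)
assert (Lim : PI * Rabs (ker_coef a P m n) <= I0 / rho ^ n + M3 * 0 + mu * k * (rpow (rho - 1 + k * 0)
  P * (a + rho) ^ m / rho ^ n)).
{ apply (limit_le (fun d => I0 / rho ^ n + M3 * d + mu * k * (rpow (rho - 1 + k * d) P * (a + rho) ^ m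
    / rho ^ n))
    _ (/ (2 * k))); [apply Rinv_0_lt_compat; lra| |exact Key].
  apply continuity_pt_plus.
  - apply continuity_pt_filterlim, (ex_derive_continuous (fun d => I0 / rho ^ n + M3 * d)).
      auto_derive. auto.
  - apply (continuity_pt_scal (fun d => rpow (rho - 1 + k * d) P * (a + rho) ^ m / rho ^ n) (mu * k)).
    apply (continuity_pt_ext (fun d => ((a + rho) ^ m / rho ^ n) * rpow (rho - 1 + k * d) P)).
    { intros d. field. lra. }
    apply (continuity_pt_scal (fun d => rpow (rho - 1 + k * d) P)).
    apply (continuity_pt_comp (fun d => rho - 1 + k * d) (fun z => rpow z P)).
    + apply continuity_pt_filterlim, (ex_derive_continuous (fun d => rho - 1 + k * d)). auto_derive; auto.
    + apply rpow_cont; lra. }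
rewrite !Rmult_0_r, !Rplus_0_r in Lim.
apply (Rmult_le_compat_r (rho ^ n)) in Lim; [|lra].
apply Rle_trans with (1 := Lim). right. field. lra.
Qed.

(** * Beta integrals *)

Definition beta_fun (P : R) (m : nat) (x : R) : R := rpow x P * (1 - x) ^ m.

(* Euler's Beta function at [(P + 1, m + 1)]. *)
Fixpoint beta_val (P : R) (m : nat) : R :=
  match m with O => / (P + 1) | S j => (INR j + 1) / (P + INR j + 2) * beta_val P j end.

Lemma beta_val_pos (P : R) (m : nat) : 0 <= P -> 0 < beta_val P m.
Proof.
intros HP. induction m as [|m IH]; cbn [beta_val].
- apply Rinv_0_lt_compat. lra.
- assert (h := pos_INR m). apply Rmult_lt_0_compat; [apply Rdiv_lt_0_compat; lra|exact IH].
Qed.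

(** [beta_val] recurses on m with P fixed, whereas integration by parts trades a unit of m for a
    unit of P; this reconciles the two. *)
Lemma beta_val_shift (m : nat) : forall P : R, 0 <= P -> beta_val P (S m) = (INR m + 1) / (P + 1) *
  beta_val (P + 1) m.
Proof.
induction m as [|m IH]; intros P HP.
- cbn [beta_val]. simpl INR. field. lra.
- assert (h := pos_INR m). cbn [beta_val] in *. rewrite IH by exact HP. rewrite S_INR. field. lra.
Qed.

Lemma beta_fun_nonneg (P x : R) (m : nat) : x <= 1 -> 0 <= beta_fun P m x.
Proof. intros H. apply Rmult_le_pos; [apply rpow_nonneg|apply pow_le; lra]. Qed.

Lemma beta_fun_cont (P x : R) (m : nat) : 1 <= P -> 0 <= x -> continuity_pt (beta_fun P m) x.
Proof.
intros HP Hx. apply (continuity_pt_mult (fun x => rpow x P) (fun x => (1 - x) ^ m)).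
- apply rpow_cont; assumption.
- apply continuity_pt_filterlim, (ex_derive_continuous (fun x => (1 - x) ^ m)). auto_derive. auto.
Qed.

Lemma beta_fun_ex_RInt (P u v : R) (m : nat) : 1 <= P -> 0 <= u -> 0 <= v -> ex_RInt (beta_fun P m) u v.
Proof.
intros HP Hu Hv. apply (ex_RInt_continuous (beta_fun P m)). intros x Hx.
apply continuity_pt_filterlim, beta_fun_cont; [exact HP|].
apply Rle_trans with (2 := proj1 Hx). apply Rmin_glb; assumption.
Qed.

Lemma rpow_RInt (P u v : R) : 1 <= P -> 0 <= u -> 0 <= v ->
  is_RInt (fun x => rpow x P) u v (rpow v (P + 1) / (P + 1) - rpow u (P + 1) / (P + 1)).
Proof.
intros HP Hu Hv.
assert (h : forall x, Rmin u v <= x -> 0 <= x).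
{ intros x Hx. apply Rle_trans with (2 := Hx). apply Rmin_glb; assumption. }
apply (is_RInt_derive (fun x => rpow x (P + 1) / (P + 1)) (fun x => rpow x P)).
- intros x [Hx _]. apply (is_derive_ext (fun x => / (P + 1) * rpow x (P + 1))).
  { intros z. apply Rmult_comm. }
  eapply is_derive_eq; [apply is_derive_scal, rpow_derive; [exact HP|apply h, Hx]|].
  field. lra.
- intros x [Hx _]. apply continuity_pt_filterlim, rpow_cont; [exact HP|apply h, Hx].
Qed.

(** Integration by parts with x^(P + 1) (1 - x)^(m + 1), which vanishes at both ends. *)
Lemma beta_fun_RInt (m : nat) : forall P : R, 1 <= P -> RInt (beta_fun P m) 0 1 = beta_val P m.
Proof.
induction m as [|m IH]; intros P HP.
- apply is_RInt_unique. apply (is_RInt_ext (fun x => rpow x P)).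
  { intros x _. unfold beta_fun. simpl. ring. }
  replace (beta_val P 0) with (rpow 1 (P + 1) / (P + 1) - rpow 0 (P + 1) / (P + 1)).
  + apply rpow_RInt; lra.
  + cbn [beta_val]. rewrite rpow_0, rpow_Rpower by lra. unfold Rpower. rewrite ln_1, Rmult_0_r, exp_0.
      field. lra.
- rewrite beta_val_shift by lra. rewrite <- IH by lra.
  assert (Hi : is_RInt (fun x => (P + 1) * beta_fun P (S m) x - (INR m + 1) * beta_fun (P + 1) m x) 0 1
     (minus (beta_fun (P + 1) (S m) 1) (beta_fun (P + 1) (S m) 0))).
  { apply (is_RInt_derive (beta_fun (P + 1) (S m))); intros x Hx; rewrite Rmin_left, Rmax_right in Hx
      by lra.
    - unfold beta_fun. eapply is_derive_eq.
      + apply (is_derive_mult (fun x => rpow x (P + 1)) (fun x => (1 - x) ^ S m)).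
        * apply rpow_derive; lra.
        * apply (is_derive_pow (fun x => 1 - x) (S m) x (-1)). auto_derive; auto; ring.
        * intros; apply Rmult_comm.
      + change ((P + 1) * rpow x P * (1 - x) ^ S m + rpow x (P + 1) * (INR (S m) * -1 * (1 - x) ^ m) =
         (P + 1) * (rpow x P * (1 - x) ^ S m) - (INR m + 1) * (rpow x (P + 1) * (1 - x) ^ m)).
        rewrite S_INR. ring.
    - apply @continuous_minus.
      + apply (continuous_scal_r (P + 1) (beta_fun P (S m))), continuity_pt_filterlim, beta_fun_cont; lra.
      + apply (continuous_scal_r (INR m + 1) (beta_fun (P + 1) m)), continuity_pt_filterlim,
          beta_fun_cont; lra. }
  assert (Hj : is_RInt (fun x => (P + 1) * beta_fun P (S m) x - (INR m + 1) * beta_fun (P + 1) m x) 0 1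
    ((P + 1) * RInt (beta_fun P (S m)) 0 1 - (INR m + 1) * RInt (beta_fun (P + 1) m) 0 1)).
  { apply @is_RInt_minus; apply @is_RInt_scal; apply (RInt_correct (beta_fun _ _)), beta_fun_ex_RInt; lra. }
  assert (E := is_RInt_unique _ _ _ _ Hi). rewrite (is_RInt_unique _ _ _ _ Hj) in E.
  assert (E1 : beta_fun (P + 1) (S m) 1 = 0) by (unfold beta_fun; simpl; ring).
  assert (E2 : beta_fun (P + 1) (S m) 0 = 0) by (unfold beta_fun; rewrite rpow_0; ring).
  rewrite E1, E2 in E. unfold minus, plus, opp in E; simpl in E.
  apply Rmult_eq_reg_l with (P + 1); [|lra].
  transitivity ((INR m + 1) * RInt (beta_fun (P + 1) m) 0 1); [|field; lra].
  lra.
Qed.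

(** Freeze the factor (1 - u)^m at x on [0, x] and the factor u^P at x on [x, 1], where each is
    smallest. The two pieces give f(x) x / (P + 1) and f(x) (1 - x) / (m + 1), both denominators
    being at most P + m + 1. *)
Lemma beta_fun_le_beta_val (P x : R) (m : nat) : 1 <= P -> 0 <= x <= 1 -> beta_fun P m x <= (P + INR m
  + 1) * beta_val P m.
Proof.
intros HP Hx. assert (hm0 := pos_INR m).
rewrite <- beta_fun_RInt by exact HP.
rewrite <- (RInt_Chasles (beta_fun P m) 0 x 1) by (apply beta_fun_ex_RInt; lra). unfold plus; simpl.
assert (I1 : beta_fun P m x * x / (P + 1) <= RInt (beta_fun P m) 0 x).
{ apply Rle_trans with (RInt (fun u => (1 - x) ^ m * rpow u P) 0 x).
  - right. symmetry. apply is_RInt_unique.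
    replace (beta_fun P m x * x / (P + 1)) with ((1 - x) ^ m * (rpow x (P + 1) / (P + 1) - rpow 0 (P +
      1) / (P + 1))).
    + apply (is_RInt_scal (fun u => rpow u P)), rpow_RInt; lra.
    + rewrite rpow_succ, rpow_0. unfold beta_fun. field. lra.
  - apply RInt_le; [lra| |apply beta_fun_ex_RInt; lra|].
    + apply (ex_RInt_scal (fun u => rpow u P)). eexists. apply rpow_RInt; lra.
    + intros u Hu. unfold beta_fun. rewrite Rmult_comm. apply Rmult_le_compat_l; [apply rpow_nonneg|].
      apply pow_incr. lra. }
assert (I2 : beta_fun P m x * (1 - x) / (INR m + 1) <= RInt (beta_fun P m) x 1).
{ assert (Hr : is_RInt (fun u => rpow x P * (1 - u) ^ m) x 1 (beta_fun P m x * (1 - x) / (INR m + 1))).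
  { replace (beta_fun P m x * (1 - x) / (INR m + 1)) with
      (minus (rpow x P * (- (1 - 1) ^ S m / (INR m + 1))) (rpow x P * (- (1 - x) ^ S m / (INR m + 1)))).
    2:{ unfold minus, plus, opp, beta_fun; simpl. field. lra. }
    apply (is_RInt_derive (fun u => rpow x P * (- (1 - u) ^ S m / (INR m + 1)))).
    - intros u _. eapply is_derive_eq.
      + apply is_derive_scal. instantiate (1 := (1 - u) ^ m).
        apply (is_derive_ext (fun u => - / (INR m + 1) * (1 - u) ^ S m)).
        { intros z. simpl. field. lra. }
        eapply is_derive_eq.
        * apply is_derive_scal. apply (is_derive_pow (fun x => 1 - x) (S m) u (-1)). auto_derive; auto;
            ring.
        * cbn [pred]. rewrite S_INR. field. lra.
      + reflexivity.
    - intros u _. apply (ex_derive_continuous (fun u => rpow x P * (1 - u) ^ m)). auto_derive. auto. }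
  rewrite <- (is_RInt_unique _ _ _ _ Hr).
  apply RInt_le; [lra|eexists; exact Hr|apply beta_fun_ex_RInt; lra|].
  intros u Hu. unfold beta_fun. apply Rmult_le_compat_r; [apply pow_le; lra|]. apply rpow_le; lra. }
assert (h0 := beta_fun_nonneg P x m ltac:(lra)).
assert (J1 : beta_fun P m x * x / (P + INR m + 1) <= beta_fun P m x * x / (P + 1)).
{ apply Rmult_le_compat_l; [nra|]. apply Rinv_le_contravar; lra. }
assert (J2 : beta_fun P m x * (1 - x) / (P + INR m + 1) <= beta_fun P m x * (1 - x) / (INR m + 1)).
{ apply Rmult_le_compat_l; [nra|]. apply Rinv_le_contravar; lra. }
apply Rle_trans with ((P + INR m + 1) * (beta_fun P m x * x / (P + INR m + 1) + beta_fun P m x * (1 -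
  x) / (P + INR m + 1))).
- right. field. lra.
- apply Rmult_le_compat_l; lra.
Qed.

(* With [p] the maximum point, this AM-GM inequality replaces a Gaussian bound around the maximum. *)
Lemma beta_fun_midpoint (P x p : R) (m : nat) : 0 <= P -> 0 <= x <= 1 -> 0 <= p <= 1 ->
  sqrt (beta_fun P m x) * sqrt (beta_fun P m p) <= beta_fun P m (/ 2 * x + / 2 * p).
Proof.
intros HP Hx Hp. rewrite <- sqrt_mult_alt by (apply beta_fun_nonneg; lra).
set (z := / 2 * x + / 2 * p).
rewrite <- (sqrt_square (beta_fun P m z)) by (apply beta_fun_nonneg; unfold z; lra).
apply sqrt_le_1_alt. unfold beta_fun.
replace (rpow x P * (1 - x) ^ m * (rpow p P * (1 - p) ^ m)) with (rpow x P * rpow p P * ((1 - x) ^ m *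
  (1 - p) ^ m)) by ring.
replace (rpow z P * (1 - z) ^ m * (rpow z P * (1 - z) ^ m)) with (rpow z P * rpow z P * ((1 - z) ^ m *
  (1 - z) ^ m)) by ring.
rewrite <- !rpow_mult, <- !Rpow_mult_distr by (unfold z; lra).
assert (h := pow2_ge_0 (x - p)).
apply Rmult_le_compat; [apply rpow_nonneg|apply pow_le, Rmult_le_pos; lra| |].
- apply rpow_le; [exact HP|]. unfold z. nra.
- apply pow_incr. split; [apply Rmult_le_pos; lra|]. unfold z. nra.
Qed.

(** * Square roots of Beta densities integrated over a circle *)

Lemma sin_ge_half (x : R) : 0 <= x <= PI / 2 -> x / 2 <= sin x.
Proof.
intros Hx.
(* At y = x / 2 and doubled, this gives sin x >= x (cos (x / 2))^2, and the squared cosine is at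
   least 1/2 on this range. *)
assert (h : forall y, 0 <= y <= PI / 4 -> y * cos y <= sin y).
{ intros y [[Hy|<-] Hy2]; [|rewrite sin_0; lra].
  destruct (MVT_cor2 (fun z => sin z - z * cos z) (fun z => z * sin z) 0 y Hy) as [c [Hc1 Hc2]].
  { intros c _. apply is_derive_Reals. auto_derive; auto. ring. }
  rewrite sin_0 in Hc1. assert (0 <= sin c) by (apply sin_ge_0; lra).
  assert (0 <= c * sin c * (y - 0)) by (apply Rmult_le_pos; [apply Rmult_le_pos|]; lra). lra. }
specialize (h (x / 2) ltac:(lra)).
assert (hc : 0 <= cos x) by (apply cos_ge_0; lra).
assert (hc2 : 0 <= cos (x / 2)) by (apply cos_ge_0; lra).
replace x with (2 * (x / 2)) in hc by field. rewrite cos_2a_cos in hc.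
replace (sin x) with (sin (2 * (x / 2))) by (f_equal; field). rewrite sin_2a.
assert (x / 2 * cos (x / 2) * cos (x / 2) <= sin (x / 2) * cos (x / 2)) by (apply Rmult_le_compat_r;
  assumption).
nra.
Qed.

Lemma sin_ge_arc (d x : R) : 0 <= d -> d <= x <= PI - d -> d / 2 <= sin x.
Proof.
intros Hd Hx. destruct (Rle_lt_dec x (PI / 2)) as [h|h].
- apply Rle_trans with (x / 2); [lra|]. apply sin_ge_half. lra.
- rewrite <- sin_PI_x. apply Rle_trans with ((PI - x) / 2); [lra|]. apply sin_ge_half. lra.
Qed.

Lemma beta_fun_max (P : R) (m : nat) : 1 <= P -> exists p, 0 <= p <= 1 /\ 0 < beta_fun P m p /\
  forall x, 0 <= x <= 1 -> beta_fun P m x <= beta_fun P m p.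
Proof.
intros HP. destruct (continuity_ab_maj (beta_fun P m) 0 1 ltac:(lra)) as [p [Hp1 Hp2]].
{ intros c Hc. apply beta_fun_cont; lra. }
exists p. split; [exact Hp2|]. split; [|exact Hp1].
apply Rlt_le_trans with (2 := Hp1 (/ 2) ltac:(lra)).
unfold beta_fun. rewrite rpow_Rpower by lra. apply Rmult_lt_0_compat; [apply exp_pos|apply pow_lt; lra].
Qed.

Lemma sqrt_beta_fun_cont (P x : R) (m : nat) : 1 <= P -> 0 <= x <= 1 -> continuous (fun z => sqrt
  (beta_fun P m z)) x.
Proof.
intros HP Hx. apply continuity_pt_filterlim, (continuity_pt_comp (beta_fun P m) sqrt).
- apply beta_fun_cont; lra.
- apply continuity_pt_sqrt, beta_fun_nonneg. lra.
Qed.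

Lemma sqrt_beta_fun_ex_RInt (P u v : R) (m : nat) : 1 <= P -> 0 <= u <= 1 -> 0 <= v <= 1 ->
  ex_RInt (fun z => sqrt (beta_fun P m z)) u v.
Proof.
intros HP Hu Hv. apply (ex_RInt_continuous (fun z => sqrt (beta_fun P m z))). intros x Hx.
apply sqrt_beta_fun_cont; [exact HP|].
assert (h1 : 0 <= Rmin u v) by (apply Rmin_glb; lra).
assert (h2 : Rmax u v <= 1) by (apply Rmax_lub; lra). lra.
Qed.

(** The midpoint map sends [0, 1] to an interval of half the length, hence the factor 2. At the
    maximum point p, with value H, the integral of the square root is thus at most 2 B / sqrt H. *)
Lemma sqrt_beta_fun_RInt (P p : R) (m : nat) : 1 <= P -> 0 <= p <= 1 ->
  sqrt (beta_fun P m p) * RInt (fun z => sqrt (beta_fun P m z)) 0 1 <= 2 * beta_val P m.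
Proof.
intros HP Hp.
rewrite <- (RInt_scal (fun z => sqrt (beta_fun P m z))) by (apply sqrt_beta_fun_ex_RInt; lra).
apply Rle_trans with (RInt (fun x => 2 * (/ 2 * beta_fun P m (/ 2 * x + / 2 * p))) 0 1).
- apply RInt_le; [lra| | |].
  + apply (ex_RInt_scal (fun z => sqrt (beta_fun P m z))), sqrt_beta_fun_ex_RInt; lra.
  + apply (ex_RInt_scal (fun x => / 2 * beta_fun P m (/ 2 * x + / 2 * p))).
    apply (ex_RInt_comp_lin (beta_fun P m)), beta_fun_ex_RInt; lra.
  + intros x Hx. assert (h := beta_fun_midpoint P x p m ltac:(lra) ltac:(lra) Hp).
    change (sqrt (beta_fun P m p) * sqrt (beta_fun P m x) <= 2 * (/ 2 * beta_fun P m (/ 2 * x + / 2 *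
      p))). lra.
- rewrite (RInt_scal (fun x => / 2 * beta_fun P m (/ 2 * x + / 2 * p)))
    by (apply (ex_RInt_comp_lin (beta_fun P m)), beta_fun_ex_RInt; lra).
  apply Rmult_le_compat_l; [lra|].
  rewrite (RInt_comp_lin (beta_fun P m)) by (apply beta_fun_ex_RInt; lra).
  rewrite <- beta_fun_RInt by exact HP.
  rewrite <- (RInt_Chasles (beta_fun P m) 0 (/ 2 * 0 + / 2 * p) 1) by (apply beta_fun_ex_RInt; lra).
  rewrite <- (RInt_Chasles (beta_fun P m) (/ 2 * 0 + / 2 * p) (/ 2 * 1 + / 2 * p) 1) by (apply
    beta_fun_ex_RInt; lra).
  unfold plus; simpl.
  assert (0 <= RInt (beta_fun P m) 0 (/ 2 * 0 + / 2 * p)).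
  { apply RInt_ge_0; [lra|apply beta_fun_ex_RInt; lra|]. intros x Hx. apply beta_fun_nonneg. lra. }
  assert (0 <= RInt (beta_fun P m) (/ 2 * 1 + / 2 * p) 1).
  { apply RInt_ge_0; [lra|apply beta_fun_ex_RInt; lra|]. intros x Hx. apply beta_fun_nonneg. lra. }
  lra.
Qed.

Lemma sqrt_beta_fun_circle (P x0 kap : R) (m : nat) : 1 <= P -> 0 < kap ->
  (forall th, 0 <= x0 + kap * cos th <= 1) ->
  RInt (fun th => sqrt (beta_fun P m (x0 + kap * cos th))) 0 PI ^ 2 <= 32 * beta_val P m / kap.
Proof.
intros HP Hk HX.
assert (hpi := PI_RGT_0).
destruct (beta_fun_max P m HP) as [p [Hp [Hp0 Hpm]]].
set (H := beta_fun P m p) in *. set (B := beta_val P m).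
assert (HB : 0 < B) by (apply beta_val_pos; lra).
set (s := fun th => sqrt (beta_fun P m (x0 + kap * cos th))).
assert (Hs : forall u v, ex_RInt s u v).
{ intros u v. apply (ex_RInt_continuous s). intros th _.
  apply (continuous_comp (fun th => x0 + kap * cos th) (fun z => sqrt (beta_fun P m z))).
  - apply (ex_derive_continuous (fun th => x0 + kap * cos th)). auto_derive. auto.
  - apply sqrt_beta_fun_cont; [exact HP|apply HX]. }
assert (Hs0 : forall th, 0 <= s th) by (intros; apply sqrt_pos).
assert (HsH : forall th, s th <= sqrt H) by (intros th; apply sqrt_le_1_alt, Hpm, HX).
assert (HH : sqrt H * sqrt H = H) by (apply sqrt_sqrt; lra).
assert (HH0 : 0 < sqrt H) by (apply sqrt_lt_R0, Hp0).
(* This d equalizes the bound 2 d sqrt H for the two end arcs and the bound 4 B / (kap d sqrt H) for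
   the middle one, where sin th >= d / 2. The total 4 d sqrt H has square 32 B / kap. *)
set (d := sqrt (2 * B / (kap * H))).
assert (Hdd : d * d = 2 * B / (kap * H)).
{ apply sqrt_sqrt. apply Rlt_le, Rdiv_lt_0_compat; nra. }
assert (Hd0 : 0 < d) by (apply sqrt_lt_R0, Rdiv_lt_0_compat; nra).
assert (E : 32 * B / kap = (4 * d * sqrt H) ^ 2).
{ replace ((4 * d * sqrt H) ^ 2) with (16 * (d * d) * (sqrt H * sqrt H)) by ring.
  rewrite Hdd, HH. field. lra. }
rewrite E.
assert (HI0 : 0 <= RInt s 0 PI) by (apply RInt_ge_0; [lra|apply Hs|intros; apply Hs0]).
apply pow_incr. split; [exact HI0|].
assert (Hcst : forall u v, u <= v -> RInt s u v <= (v - u) * sqrt H).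
{ intros u v Huv. apply Rle_trans with (RInt (fun _ => sqrt H) u v).
  - apply RInt_le; [exact Huv|apply Hs|apply ex_RInt_const|]. intros; apply HsH.
  - rewrite RInt_const. right. reflexivity. }
destruct (Rle_lt_dec (PI / 2) d) as [hd|hd].
{ apply Rle_trans with (1 := Hcst 0 PI ltac:(lra)). nra. }
rewrite <- (RInt_Chasles s 0 d PI) by apply Hs.
rewrite <- (RInt_Chasles s d (PI - d) PI) by apply Hs.
unfold plus; simpl.
assert (I1 := Hcst 0 d ltac:(lra)). assert (I3 := Hcst (PI - d) PI ltac:(lra)).
assert (Hcos : forall th, cos (PI - th) = - cos th).
{ intros th. rewrite cos_minus, cos_PI, sin_PI. ring. }
assert (I2 : d / 2 * RInt s d (PI - d) <= RInt (fun z => sqrt (beta_fun P m z)) 0 1 / kap).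
{ assert (Hc : is_RInt (fun th => - kap * sin th * s th) d (PI - d)
    (RInt (fun z => sqrt (beta_fun P m z)) (x0 + kap * cos d) (x0 + kap * cos (PI - d)))).
  { apply (is_RInt_comp (fun z => sqrt (beta_fun P m z)) (fun th => x0 + kap * cos th) (fun th => - kap
      * sin th)).
    - intros th _. apply sqrt_beta_fun_cont; [exact HP|apply HX].
    - intros th _. split; [auto_derive; auto; ring|].
      apply (ex_derive_continuous (fun th => - kap * sin th)). auto_derive. auto. }
  assert (Hc2 : RInt (fun th => sin th * s th) d (PI - d) =
    RInt (fun z => sqrt (beta_fun P m z)) (x0 + kap * cos (PI - d)) (x0 + kap * cos d) / kap).
  { apply is_RInt_unique.
    apply (is_RInt_ext (fun th => - / kap * (- kap * sin th * s th))).
    { intros th _. match goal with |- @eq _ ?x ?y => change (@eq R x y) end. field. lra. }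
    replace (RInt (fun z => sqrt (beta_fun P m z)) (x0 + kap * cos (PI - d)) (x0 + kap * cos d) / kap)
      with (- / kap * RInt (fun z => sqrt (beta_fun P m z)) (x0 + kap * cos d) (x0 + kap * cos (PI - d))).
    - apply (is_RInt_scal (fun th => - kap * sin th * s th)). exact Hc.
    - assert (Hsw : RInt (fun z => sqrt (beta_fun P m z)) (x0 + kap * cos (PI - d)) (x0 + kap * cos d) =
        - RInt (fun z => sqrt (beta_fun P m z)) (x0 + kap * cos d) (x0 + kap * cos (PI - d))).
      { symmetry. apply (opp_RInt_swap (fun z => sqrt (beta_fun P m z))).
        apply sqrt_beta_fun_ex_RInt; [exact HP|apply HX|apply HX]. }
      rewrite Hsw. match goal with |- @eq _ ?x ?y => change (@eq R x y) end. field. lra. }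
  apply Rle_trans with (RInt (fun th => sin th * s th) d (PI - d)).
  - rewrite <- (RInt_scal s) by apply Hs.
    apply RInt_le; [lra| | |].
    + apply (ex_RInt_scal s), Hs.
    + apply (ex_RInt_ext (fun th => - / kap * (- kap * sin th * s th))).
      { intros th _. match goal with |- @eq _ ?x ?y => change (@eq R x y) end. field. lra. }
      apply (ex_RInt_scal (fun th => - kap * sin th * s th)). eexists. exact Hc.
    + intros th Hth. apply Rmult_le_compat_r; [apply Hs0|]. apply sin_ge_arc; lra.
  - rewrite Hc2. apply Rmult_le_compat_r; [apply Rlt_le, Rinv_0_lt_compat, Hk|].
    assert (hcd : 0 < cos d) by (apply cos_gt_0; lra).
    assert (hX1 := HX d). assert (hX2 := HX (PI - d)).
    rewrite <- (RInt_Chasles (fun z => sqrt (beta_fun P m z)) 0 (x0 + kap * cos (PI - d)) 1)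
      by (apply sqrt_beta_fun_ex_RInt; lra).
    rewrite <- (RInt_Chasles (fun z => sqrt (beta_fun P m z)) (x0 + kap * cos (PI - d)) (x0 + kap * cos
      d) 1)
      by (apply sqrt_beta_fun_ex_RInt; lra).
    unfold plus; simpl.
    assert (0 <= RInt (fun z => sqrt (beta_fun P m z)) 0 (x0 + kap * cos (PI - d))).
    { apply RInt_ge_0; [lra|apply sqrt_beta_fun_ex_RInt; lra|]. intros; apply sqrt_pos. }
    assert (0 <= RInt (fun z => sqrt (beta_fun P m z)) (x0 + kap * cos d) 1).
    { apply RInt_ge_0; [lra|apply sqrt_beta_fun_ex_RInt; lra|]. intros; apply sqrt_pos. }
    lra. }
assert (I4 := sqrt_beta_fun_RInt P p m HP Hp). fold H B in I4.
assert (I5 : RInt s d (PI - d) <= 2 * d * sqrt H).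
{ apply Rmult_le_reg_l with (d / 2 * sqrt H); [apply Rmult_lt_0_compat; lra|].
  apply Rle_trans with (sqrt H * (RInt (fun z => sqrt (beta_fun P m z)) 0 1 / kap)).
  - rewrite (Rmult_comm (d / 2)), Rmult_assoc. apply Rmult_le_compat_l; [lra|exact I2].
  - replace (d / 2 * sqrt H * (2 * d * sqrt H)) with ((d * d) * (sqrt H * sqrt H)) by field.
    rewrite Hdd, HH. replace (2 * B / (kap * H) * H) with (2 * B / kap) by (field; lra).
    unfold Rdiv. rewrite <- Rmult_assoc. apply Rmult_le_compat_r; [apply Rlt_le, Rinv_0_lt_compat,
      Hk|exact I4]. }
replace (PI - (PI - d)) with d in I3 by ring. rewrite Rminus_0_r in I1. lra.
Qed.

(* [(alpha + 1)_k / k!], the squared norm of the Laguerre polynomial of degree [k]. *)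
Fixpoint lag_sq (alpha : R) (k : nat) : R :=
  match k with O => 1 | S j => (INR j + 1 + alpha) / (INR j + 1) * lag_sq alpha j end.

Lemma lag_sq_pos (alpha : R) (k : nat) : 0 <= alpha -> 0 < lag_sq alpha k.
Proof.
intros H. induction k as [|k IH]; cbn [lag_sq]; [lra|].
assert (h := pos_INR k). apply Rmult_lt_0_compat; [apply Rdiv_lt_0_compat; lra|exact IH].
Qed.

Lemma beta_val_sym (n : nat) (b : R) : 0 <= b -> beta_val (b + 1) n * (b + INR n + 2) = beta_val b n *
  (b + 1).
Proof.
intros Hb. assert (h := pos_INR n).
assert (E := beta_val_shift n b Hb). cbn [beta_val] in E.
apply (Rmult_eq_compat_l ((b + INR n + 2) * (b + 1) / (INR n + 1))) in E.
replace ((b + INR n + 2) * (b + 1) / (INR n + 1) * ((INR n + 1) / (b + INR n + 2) * beta_val b n))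
  with (beta_val b n * (b + 1)) in E by (field; lra).
rewrite E. field. lra.
Qed.

(* [B(P + 1, m + 1)] with [P = n + alpha] and [B(n + 1, m + alpha + 1)] have the same denominator
   [Gamma(n + m + alpha + 2)]. *)
Lemma lag_sq_beta_val (alpha : R) (n m : nat) : 0 <= alpha ->
  lag_sq alpha m * beta_val (INR n + alpha) m = lag_sq alpha n * beta_val (INR m + alpha) n.
Proof.
intros Ha. assert (hn := pos_INR n).
induction m as [|m IH].
- simpl INR. rewrite Rplus_0_l. cbn [lag_sq beta_val]. rewrite Rmult_1_l.
  induction n as [|n IHn].
  + simpl. field. lra.
  + assert (h := pos_INR n). cbn [lag_sq beta_val]. specialize (IHn h). rewrite S_INR.
    transitivity ((INR n + alpha + 1) / (INR n + 1 + alpha + 1) * / (INR n + alpha + 1)); [field; lra|].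
    rewrite IHn. field. lra.
- assert (h := pos_INR m). cbn [lag_sq beta_val].
  transitivity ((INR m + 1 + alpha) / (INR n + alpha + INR m + 2) * (lag_sq alpha m * beta_val (INR n +
    alpha) m)); [field; lra|].
  rewrite IH. assert (E := beta_val_sym n (INR m + alpha) ltac:(lra)).
  rewrite S_INR. replace (INR m + 1 + alpha) with (INR m + alpha + 1) by ring.
  apply Rmult_eq_reg_r with (INR m + alpha + INR n + 2); [|lra].
  transitivity (lag_sq alpha n * (beta_val (INR m + alpha) n * (INR m + alpha + 1))); [field; lra|].
  rewrite <- E. ring.
Qed.

(** * A Stirling inequality for the Beta function *)

Lemma ln_ratio_le (u : R) : 0 < u -> ln (1 + u) <= u * (2 + u) / (2 * (1 + u)).
Proof.
intros Hu.
destruct (MVT_cor2 (fun z => z * (2 + z) / (2 * (1 + z)) - ln (1 + z))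
  (fun z => / 2 * (1 - / (1 + z)) ^ 2) 0 u Hu) as [c [Hc1 Hc2]].
{ intros c Hc. apply is_derive_Reals. auto_derive; [repeat split; lra|]. field. lra. }
replace (ln (1 + 0)) with 0 in Hc1 by (rewrite Rplus_0_r, ln_1; reflexivity).
assert (h := pow2_ge_0 (1 - / (1 + c))).
assert (0 <= / 2 * (1 - / (1 + c)) ^ 2 * (u - 0)) by (apply Rmult_le_pos; lra).
lra.
Qed.

(** The derivative is the integral of 1 / z over [c, c + 1] minus its trapezoidal value, negative
    because 1 / z is convex; [ln_ratio_le] at u = 1 / c is this bound. *)
Lemma stirling_factor_decr (x y : R) : 0 < x -> x <= y ->
  (y + / 2) * (ln (y + 1) - ln y) <= (x + / 2) * (ln (x + 1) - ln x).
Proof.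
intros Hx [Hxy| <-]; [|lra].
destruct (MVT_cor2 (fun z => (z + / 2) * (ln (z + 1) - ln z))
  (fun z => ln (z + 1) - ln z - (2 * z + 1) / (2 * z * (z + 1))) x y Hxy) as [c [Hc1 Hc2]].
{ intros c Hc. apply is_derive_Reals. auto_derive; [repeat split; lra|]. field. lra. }
assert (h := ln_ratio_le (/ c) ltac:(apply Rinv_0_lt_compat; lra)).
replace (1 + / c) with ((c + 1) / c) in h by (field; lra).
rewrite ln_div in h by lra.
replace (/ c * (2 + / c) / (2 * ((c + 1) / c))) with ((2 * c + 1) / (2 * c * (c + 1))) in h by (field; lra).
assert ((ln (c + 1) - ln c - (2 * c + 1) / (2 * c * (c + 1))) * (y - x) <= 0) by nra.
lra.
Qed.

(** Stirling's formula for B(n + 1, b + 1) with 2 sqrt 2 in place of sqrt (2 PI), an equality at n =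
    b = 0. The left side decreases in n: one step changes it by the difference of the Stirling
    factors at n + b + 2 and n + 1. The case n = 0 compares the factors at b + 1 and 1. *)
Lemma ln_beta_val_le (n : nat) (b : R) : 0 <= b ->
  ln (beta_val b n) + (INR n + b + 3 / 2) * ln (INR n + b + 2) - (INR n + / 2) * ln (INR n + 1)
    - (b + / 2) * ln (b + 1) <= 3 / 2 * ln 2.
Proof.
intros Hb. induction n as [|n IH].
- cbn [beta_val]. simpl INR. rewrite ln_Rinv by lra. rewrite !Rplus_0_l, ln_1.
  assert (h := stirling_factor_decr 1 (b + 1) ltac:(lra) ltac:(lra)).
  rewrite ln_1 in h. replace (b + 1 + 1) with (b + 2) in h by ring.
  replace (1 + 1) with 2 in h by ring. lra.
- assert (hn := pos_INR n). assert (hb := beta_val_pos b n Hb).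
  cbn [beta_val]. rewrite ln_mult, ln_div, S_INR by (try apply Rdiv_lt_0_compat; lra).
  assert (h := stirling_factor_decr (INR n + 1) (INR n + b + 2) ltac:(lra) ltac:(lra)).
  replace (INR n + 1 + b + 2) with (INR n + b + 2 + 1) by ring.
  replace (b + INR n + 2) with (INR n + b + 2) by ring. lra.
Qed.

(** The exponentiated bound, grouped as it occurs in [kernel_sq_bound]: with N = n + b + 2 the left
    side is B N^(n + b + 1) / ((n + 1)^(n + 1/2) (b + 1)^(b + 1/2)). *)
Lemma beta_val_stirling (n : nat) (b : R) : 0 <= b ->
  beta_val b n * Rpower ((INR n + b + 2) / (b + 1)) (INR n + b) * ((b + 1) / (INR n + 1)) ^ n *
    (INR n + b + 2) / sqrt ((INR n + 1) * (b + 1)) <= 2 * sqrt 2 / sqrt (INR n + b + 2).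
Proof.
intros Hb. assert (hn := pos_INR n). assert (hb := beta_val_pos b n Hb).
assert (L := ln_beta_val_le n b Hb).
assert (e : forall x, 0 < x -> sqrt x = exp (/ 2 * ln x)).
{ intros x Hx. rewrite <- Rpower_sqrt by exact Hx. reflexivity. }
rewrite <- Rpower_pow by (apply Rdiv_lt_0_compat; lra).
rewrite !e by (try apply Rmult_lt_0_compat; lra).
unfold Rpower.
replace (beta_val b n) with (exp (ln (beta_val b n))) by (apply exp_ln, hb).
replace (2 * exp (/ 2 * ln 2)) with (exp (ln 2) * exp (/ 2 * ln 2)) by (rewrite exp_ln; lra).
set (N := INR n + b + 2) in *.
assert (hN : 0 < N) by (unfold N; lra).
assert (EN : N = exp (ln N)) by (symmetry; apply exp_ln, hN).
replace (exp (ln (beta_val b n)) * exp ((INR n + b) * ln (N / (b + 1))) * exp (INR n * ln ((b + 1) /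
  (INR n + 1))) * N
  / exp (/ 2 * ln ((INR n + 1) * (b + 1)))) with
 (exp (ln (beta_val b n)) * exp ((INR n + b) * ln (N / (b + 1))) * exp (INR n * ln ((b + 1) / (INR n +
   1))) * exp (ln N)
  / exp (/ 2 * ln ((INR n + 1) * (b + 1)))) by (rewrite <- EN; reflexivity).
unfold Rdiv at 1 4. rewrite <- !exp_Ropp, <- !exp_plus.
rewrite !ln_div, ln_mult by lra.
apply Rnot_lt_le. intros hlt. apply exp_lt_inv in hlt. revert hlt. apply Rle_not_lt.
replace (INR n + b + 3 / 2) with ((INR n + b + 1) + / 2) in L by field. lra.
Qed.

(** * The estimate for the explicit kernel *)

(** On |z| = rho the terms in cos th cancel in a |1 + z|^2 + |a - z|^2 = S, so x and 1 - x are the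
    shares of the two summands in S. *)
Lemma ker_mod_beta_fun (a P rho th : R) (m : nat) : 0 < a -> 1 <= P -> 0 < rho ->
  let S := (1 + a) * (a + rho ^ 2) in
  let x := a * (1 + rho ^ 2) / S + 2 * a * rho / S * cos th in
  0 <= x <= 1 /\ ker_mod a P m rho th = sqrt (rpow (S / a) P * S ^ m) * sqrt (beta_fun P m x).
Proof.
intros Ha HP Hr S x.
assert (hS : 0 < S) by (unfold S; nra).
assert (E1 : circ_sq rho th = S / a * x) by (unfold x, circ_sq; field; lra).
assert (E2 : a ^ 2 + rho ^ 2 - 2 * a * rho * cos th = S * (1 - x)).
{ replace (S * (1 - x)) with (S - a * (1 + rho ^ 2) - 2 * a * rho * cos th) by (unfold x; field; lra).
  unfold S. ring. }
assert (hq := circ_sq_nonneg rho th). assert (hc := chord_nonneg a rho th ltac:(lra) ltac:(lra)).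
assert (hSa : 0 < S / a) by (apply Rdiv_lt_0_compat; lra).
assert (hx : 0 <= x <= 1).
{ rewrite E1 in hq. rewrite E2 in hc. split; nra. }
split; [exact hx|]. unfold ker_mod. rewrite E1, E2.
rewrite rpow_mult, Rpow_mult_distr by lra.
rewrite <- sqrt_mult_alt.
- f_equal. unfold beta_fun. ring.
- apply Rmult_le_pos; [apply rpow_nonneg|apply pow_le; lra].
Qed.

(** The square of the two-term Cauchy estimate is at most twice the sum of squares. The circle term
    is bounded with kap = 2 a rho / S, the cut term by the pointwise bound
    [beta_fun_le_beta_val]. *)
Lemma ker_coef_sq_bound (a P rho : R) (m n : nat) : 0 < a -> 1 <= P -> (1 <= n)%nat -> INR n <= P -> 0
  < rho ->
  let S := (1 + a) * (a + rho ^ 2) in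
  PI ^ 2 * ker_coef a P m n ^ 2 * (rho ^ 2) ^ n <=
  2 * (rpow (S / a) P * S ^ m) * beta_val P m * (16 * S / (a * rho) + 2 * rho / INR n * (P + INR m + 1)).
Proof.
intros Ha HP Hn HnP Hr S.
assert (hS : 0 < S) by (unfold S; nra).
assert (Hn' : 1 <= INR n) by (apply (le_INR 1), Hn). assert (hmn := pos_INR m).
assert (hB : 0 < beta_val P m) by (apply beta_val_pos; lra).
set (W := rpow (S / a) P * S ^ m).
assert (hW : 0 <= W) by (apply Rmult_le_pos; [apply rpow_nonneg|apply pow_le; lra]).
set (x := fun th => a * (1 + rho ^ 2) / S + 2 * a * rho / S * cos th).
assert (hx : forall th, 0 <= x th <= 1) by (intros th; apply (ker_mod_beta_fun a P rho th m Ha HP Hr)).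
assert (hmd : forall th, ker_mod a P m rho th = sqrt W * sqrt (beta_fun P m (x th))) by (intros th;
  apply (ker_mod_beta_fun a P rho th m Ha HP Hr)).
assert (hC := cauchy_bound a P rho m n ltac:(lra) HP Hn HnP Hr).
assert (hk : 0 < 2 * a * rho / S) by (apply Rdiv_lt_0_compat; nra).
assert (hI := sqrt_beta_fun_circle P (a * (1 + rho ^ 2) / S) (2 * a * rho / S) m HP hk hx).
fold x in hI. change (fun th => sqrt (beta_fun P m (a * (1 + rho ^ 2) / S + 2 * a * rho / S * cos th))) with
  (fun th => sqrt (beta_fun P m (x th))) in hI.
rewrite hmd in hC.
set (I := RInt (fun th => sqrt (beta_fun P m (x th))) 0 PI) in *.
assert (EI : RInt (fun th => ker_mod a P m rho th) 0 PI = sqrt W * I).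
{ unfold I. rewrite (RInt_ext _ (fun th => scal (sqrt W) (sqrt (beta_fun P m (x th))))).
  - apply (RInt_scal (fun th => sqrt (beta_fun P m (x th))) 0 PI (sqrt W)). apply (ex_RInt_continuous
      (fun th => sqrt (beta_fun P m (x th)))). intros th _.
    apply (continuous_comp x (fun z => sqrt (beta_fun P m z))).
    + apply (ex_derive_continuous x). unfold x. auto_derive. auto.
    + apply sqrt_beta_fun_cont; [exact HP|apply hx].
  - intros th _. apply hmd. }
rewrite EI in hC.
set (h := beta_fun P m (x PI)) in *.
assert (hh0 : 0 <= h) by (apply beta_fun_nonneg, hx).
assert (hhb : h <= (P + INR m + 1) * beta_val P m) by (apply beta_fun_le_beta_val; [exact HP|apply hx]).
set (q := 2 * rho / INR n).
assert (hq : 0 < q) by (apply Rdiv_lt_0_compat; lra).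
assert (hI0 : 0 <= I).
{ unfold I. assert (hpi := PI_RGT_0). apply RInt_ge_0; [lra| |intros; apply sqrt_pos].
  apply (ex_RInt_continuous (fun th => sqrt (beta_fun P m (x th)))). intros th _.
  apply (continuous_comp x (fun z => sqrt (beta_fun P m z))).
  - apply (ex_derive_continuous x). unfold x. auto_derive. auto.
  - apply sqrt_beta_fun_cont; [exact HP|apply hx]. }
fold q in hC.
replace (PI ^ 2 * ker_coef a P m n ^ 2 * (rho ^ 2) ^ n) with ((PI * Rabs (ker_coef a P m n) * rho ^ n) ^ 2).
2:{ rewrite !Rpow_mult_distr, pow2_abs, <- !pow_mult. f_equal. f_equal. lia. }
apply Rle_trans with ((sqrt W * I + sqrt q * (sqrt W * sqrt h)) ^ 2).
{ apply pow_incr. split; [|exact hC]. assert (hpi := PI_RGT_0).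
  apply Rmult_le_pos; [apply Rmult_le_pos; [lra|apply Rabs_pos]|apply pow_le; lra]. }
apply Rle_trans with (2 * W * (I ^ 2 + q * h)).
{ assert (EW := sqrt_sqrt W hW). assert (Eq := sqrt_sqrt q ltac:(lra)). assert (Eh := sqrt_sqrt h hh0).
  replace (2 * W * (I ^ 2 + q * h)) with
    (2 * (sqrt W * sqrt W) * (I ^ 2 + (sqrt q * sqrt q) * (sqrt h * sqrt h))) by (rewrite EW, Eq, Eh; ring).
  assert (hz := pow2_ge_0 (sqrt W * (I - sqrt q * sqrt h))). nra. }
replace (2 * W * beta_val P m * (16 * S / (a * rho) + q * (P + INR m + 1))) with
  (2 * W * (32 * beta_val P m / (2 * a * rho / S) + q * ((P + INR m + 1) * beta_val P m))) by (field; lra).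
apply Rmult_le_compat_l; [lra|]. apply Rplus_le_compat; [exact hI|].
apply Rmult_le_compat_l; lra.
Qed.

Lemma kernel_sq_bound (alpha t : R) (m n : nat) : 0 <= alpha -> 0 < t -> (1 <= n)%nat ->
  let P := INR n + alpha in
  lag_sq alpha m / lag_sq alpha n * Rpower (1 + t ^ 2) (- (1 + P + INR m)) * (t ^ n / t ^ m * ker_coef
    (t ^ 2) P m n) ^ 2
  <= 16 / (t * sqrt (INR n + INR m + alpha + 1)).
Proof.
intros Hal Ht Hn P.
assert (Hn' : 1 <= INR n) by (apply (le_INR 1), Hn). assert (hmn := pos_INR m).
set (a := t ^ 2). assert (Ha : 0 < a) by (apply pow_lt, Ht).
set (b := INR m + alpha). assert (hb : 0 <= b) by (unfold b; lra).
set (N := INR n + b + 2). assert (hN : 3 <= N) by (unfold N; lra).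
set (V := N / (b + 1)). assert (hV : 0 < V) by (apply Rdiv_lt_0_compat; lra).
set (w := (INR n + 1) / (b + 1)). assert (hw : 0 < w) by (apply Rdiv_lt_0_compat; lra).
(* With this radius S = a (1 + a) V, and the powers of V and w that arise are those of
   [beta_val_stirling]. *)
set (rho := t * sqrt w).
assert (hsw : 0 < sqrt w) by (apply sqrt_lt_R0, hw).
assert (Hr : 0 < rho) by (apply Rmult_lt_0_compat; assumption).
assert (Er : rho ^ 2 = a * w).
{ unfold rho. rewrite Rpow_mult_distr. fold a. rewrite pow2_sqrt by lra. reflexivity. }
assert (HP : 1 <= P) by (unfold P; lra).
assert (hG := ker_coef_sq_bound a P rho m n Ha HP Hn ltac:(unfold P; lra) Hr). cbv zeta in hG.
rewrite Er in hG.
replace ((1 + a) * (a + a * w)) with (a * ((1 + a) * V)) in hG by (unfold V, w, N; field; lra).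
replace (a * ((1 + a) * V) / a) with ((1 + a) * V) in hG by (field; lra).
set (g := ker_coef a P m n) in *. set (B := beta_val P m) in *.
assert (hB : 0 < B) by (apply beta_val_pos; lra).
assert (EW : rpow ((1 + a) * V) P * (a * ((1 + a) * V)) ^ m = a ^ m * (Rpower (1 + a) (P + INR m) *
  Rpower V (P + INR m))).
{ assert (0 < (1 + a) * V) by (apply Rmult_lt_0_compat; lra).
  rewrite rpow_Rpower, Rpow_mult_distr, <- (Rpower_pow m ((1 + a) * V)) by assumption.
  rewrite Rpower_mult_distr by lra. rewrite Rpower_plus. ring. }
rewrite EW in hG.
set (RA := Rpower (1 + a) (P + INR m)) in *. set (RV := Rpower V (P + INR m)) in *.
assert (hRA : 0 < RA) by apply exp_pos. assert (hRV : 0 < RV) by apply exp_pos.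
set (s := sqrt ((INR n + 1) * (b + 1))).
assert (hs0 : 0 < s) by (apply sqrt_lt_R0; nra).
assert (Es : sqrt w = s / (b + 1)).
{ unfold s, w. rewrite sqrt_div_alt, sqrt_mult_alt by lra.
  assert (h := sqrt_sqrt (b + 1) ltac:(lra)). assert (0 < sqrt (b + 1)) by (apply sqrt_lt_R0; lra).
  rewrite <- h at 3. field. lra. }
assert (hss : s * s = (INR n + 1) * (b + 1)) by (apply sqrt_sqrt; nra).
(* The circle contributes 16 and the cut 4, the latter because (n + 1) / n <= 2. *)
assert (hbr : 16 * (a * ((1 + a) * V)) / (a * rho) + 2 * rho / INR n * (P + INR m + 1) <= 20 * (1 + a)
  * N / (t * s)).
{ assert (J1 : 16 * (a * ((1 + a) * V)) / (a * rho) = 16 * (1 + a) * N / (t * s)).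
  { unfold rho. rewrite Es. unfold V. field. repeat split; lra. }
  assert (J2 : 2 * rho / INR n * (P + INR m + 1) <= 4 * (1 + a) * N / (t * s)).
  { unfold rho. rewrite Es.
    replace (2 * (t * (s / (b + 1))) / INR n * (P + INR m + 1)) with
      (2 * (t * t) * (N - 1) * ((s * s) / (b + 1) / INR n) / (t * s)) by (unfold N, P, b; field; unfold
        b in *; repeat split; lra).
    rewrite hss. unfold Rdiv at 1 4. apply Rmult_le_compat_r; [apply Rlt_le, Rinv_0_lt_compat,
      Rmult_lt_0_compat; lra|].
    replace ((INR n + 1) * (b + 1) / (b + 1) / INR n) with (1 + / INR n) by (field; lra).
    assert (hi : / INR n <= 1) by (rewrite <- Rinv_1; apply Rinv_le_contravar; lra).
    assert (hi0 : 0 < / INR n) by (apply Rinv_0_lt_compat; lra).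
    replace (t * t) with a by (unfold a; ring).
    assert (a * (N - 1) <= (1 + a) * N) by nra.
    assert (0 <= a * (N - 1)) by nra. nra. }
  rewrite J1. lra. }
assert (hn0 := lag_sq_pos alpha n Hal). assert (hm0 := lag_sq_pos alpha m Hal).
assert (Esym := lag_sq_beta_val alpha n m Hal). fold P in Esym. fold b in Esym. fold B in Esym.
assert (hS := beta_val_stirling n b hb). fold N in hS. fold V in hS. fold s in hS.
replace (INR n + b) with (P + INR m) in hS by (unfold P, b; ring). fold RV in hS.
assert (hpi : 9 < PI ^ 2).
{ assert (h := PI2_3_2). unfold PI2 in h. nra. }
assert (hwn : 0 < w ^ n) by (apply pow_lt, hw).
assert (han : 0 < a ^ n) by (apply pow_lt, Ha). assert (ham : 0 < a ^ m) by (apply pow_lt, Ha).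
replace ((t ^ n / t ^ m * g) ^ 2) with (a ^ n / a ^ m * g ^ 2).
2:{ unfold a. rewrite <- !pow_mult, !(Nat.mul_comm 2), !pow_mult. field. apply pow_nonzero. lra. }
replace (Rpower (1 + a) (- (1 + P + INR m))) with (/ (1 + a) / RA).
2:{ replace (- (1 + P + INR m)) with (- (1) + - (P + INR m)) by ring.
    rewrite Rpower_plus, !Rpower_Ropp, Rpower_1 by lra. reflexivity. }
assert (hg2 : g ^ 2 <= 2 * (a ^ m * (RA * RV)) * B * (20 * (1 + a) * N / (t * s)) / (PI ^ 2 * (a ^ n *
  w ^ n))).
{ assert (hden : 0 < PI ^ 2 * (a ^ n * w ^ n)).
  { apply Rmult_lt_0_compat; [lra|]. apply Rmult_lt_0_compat; assumption. }
  apply (proj1 (Rle_div_r _ _ _ hden)).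
  rewrite Rpow_mult_distr in hG.
  apply Rle_trans with (PI ^ 2 * g ^ 2 * (a ^ n * w ^ n)); [right; ring|].
  apply Rle_trans with (1 := hG). apply Rmult_le_compat_l; [|exact hbr].
  apply Rmult_le_pos; [|lra]. apply Rmult_le_pos; [lra|].
  apply Rmult_le_pos; [lra|]. apply Rmult_le_pos; lra. }
apply Rle_trans with (lag_sq alpha m / lag_sq alpha n * (/ (1 + a) / RA) * (a ^ n / a ^ m *
  (2 * (a ^ m * (RA * RV)) * B * (20 * (1 + a) * N / (t * s)) / (PI ^ 2 * (a ^ n * w ^ n))))).
{ apply Rmult_le_compat_l.
  - apply Rmult_le_pos; [apply Rlt_le, Rdiv_lt_0_compat; assumption|].
    apply Rlt_le, Rdiv_lt_0_compat; [apply Rinv_0_lt_compat; lra|exact hRA].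
  - apply Rmult_le_compat_l; [apply Rlt_le, Rdiv_lt_0_compat; assumption|exact hg2]. }
assert (Ew : ((b + 1) / (INR n + 1)) ^ n = / w ^ n).
{ unfold w. rewrite <- pow_inv. f_equal. field. lra. }
rewrite Ew in hS.
replace (lag_sq alpha m / lag_sq alpha n * (/ (1 + a) / RA) * (a ^ n / a ^ m *
  (2 * (a ^ m * (RA * RV)) * B * (20 * (1 + a) * N / (t * s)) / (PI ^ 2 * (a ^ n * w ^ n)))))
 with (40 / (PI ^ 2 * t) * (beta_val b n * RV * / w ^ n * N / s)).
2:{ replace (beta_val b n) with (lag_sq alpha m * B / lag_sq alpha n) by (rewrite Esym; field; lra).
    field. repeat split; try lra. assert (h := PI_RGT_0). lra. }
assert (hsN : 0 < sqrt N) by (apply sqrt_lt_R0; lra).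
apply Rle_trans with (40 / (PI ^ 2 * t) * (2 * sqrt 2 / sqrt N)).
{ apply Rmult_le_compat_l; [|exact hS]. apply Rlt_le, Rdiv_lt_0_compat; [lra|]. apply
    Rmult_lt_0_compat; lra. }
apply Rle_trans with (16 / (t * sqrt N)).
(* With sqrt 2 <= 3/2 and PI^2 > 9 the constant 80 sqrt 2 / PI^2 is at most 120 / 9. *)
- replace (40 / (PI ^ 2 * t) * (2 * sqrt 2 / sqrt N)) with (80 * sqrt 2 / PI ^ 2 * (/ (t * sqrt N))).
  2:{ field. repeat split; try lra. assert (h := PI_RGT_0). lra. }
  apply Rmult_le_compat_r; [apply Rlt_le, Rinv_0_lt_compat, Rmult_lt_0_compat; lra|].
  assert (h2 : sqrt 2 <= 3 / 2).
  { rewrite <- (sqrt_square (3 / 2)) by lra. apply sqrt_le_1_alt. lra. }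
  apply Rmult_le_reg_r with (PI ^ 2); [lra|]. unfold Rdiv. rewrite Rmult_assoc, Rinv_l by lra. lra.
- apply Rmult_le_compat_l; [lra|]. apply Rinv_le_contravar.
  + apply Rmult_lt_0_compat; [exact Ht|]. apply sqrt_lt_R0. lra.
  + apply Rmult_le_compat_l; [lra|]. apply sqrt_le_1_alt. unfold N, b. lra.
Qed.

(** * The explicit kernel solves the Schroedinger equation *)

Lemma gbinom_Pascal (k : nat) : forall P : R, gbinom P (S k) = gbinom (P - 1) (S k) + gbinom (P - 1) k.
Proof.
induction k as [|k IH]; intros P.
- cbn [gbinom]. simpl INR. field.
- assert (h := pos_INR k).
  assert (E1 := IH (P - 1)). cbn [gbinom] in E1 |- *. rewrite S_INR.
  set (u := gbinom (P - 1 - 1) k) in *.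
  assert (E2 : (P - 1 - 1) / (INR k + 1) * gbinom (P - 1 - 1 - 1) k = (P - 1) / (INR k + 1) * u - u) by lra.
  rewrite E2. field. lra.
Qed.

(** Multiplication by z on coefficient sequences. *)
Definition prev (f : nat -> R) (k : nat) : R := match k with O => 0 | S j => f j end.

(* The coefficient of [z^k] in [(1 + t z)^P (t - z)^m]. *)
Fixpoint ker_poly (P t : R) (m k : nat) : R :=
  match m with
  | O => gbinom P k * t ^ k
  | S p => t * ker_poly P t p k - prev (ker_poly P t p) k
  end.

(** Substituting z / t for z in t^m (1 + t z)^P (t - z)^m gives (1 + z)^P (t^2 - z)^m. *)
Lemma ker_poly_coef (P t : R) (m : nat) : forall k, ker_poly P t m k * t ^ m = t ^ k * ker_coef (t ^ 2)
  P m k.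
Proof.
induction m as [|m IH]; intros k; cbn [ker_poly ker_coef].
- simpl. ring.
- destruct k as [|k]; cbn [prev].
  + simpl pow. specialize (IH 0%nat). simpl pow in IH.
    transitivity (t * t * (ker_poly P t m 0 * t ^ m)); [ring|]. rewrite IH. ring.
  + transitivity (t * t * (ker_poly P t m (S k) * t ^ m) - t * (ker_poly P t m k * t ^ m)); [simpl pow;
      ring|].
    rewrite !IH. simpl pow. ring.
Qed.

Lemma ker_poly_lower (P t : R) (m : nat) : forall k, ker_poly P t m k = ker_poly (P - 1) t m k + t *
  prev (ker_poly (P - 1) t m) k.
Proof.
induction m as [|m IH]; intros [|k]; cbn [ker_poly prev].
- simpl. ring.
- rewrite gbinom_Pascal. simpl pow. ring.
- rewrite IH. cbn [prev]. ring.
- rewrite (IH (S k)), (IH k). cbn [prev]. ring.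
Qed.

(** The product rule for the t-derivative of the generating function. At m = 0 the default of [pred]
    is multiplied by [INR] 0. *)
Lemma ker_poly_derive (P t : R) (m : nat) : forall k,
  is_derive (fun s => ker_poly P s m k) t (P * prev (ker_poly (P - 1) t m) k + INR m * ker_poly P t
    (pred m) k).
Proof.
induction m as [|m IH]; intros k.
- cbn [ker_poly pred]. eapply is_derive_eq.
  + apply is_derive_scal, is_derive_pow, @is_derive_id.
  + unfold one; simpl one. destruct k as [|k]; cbn [prev pred gbinom ker_poly]; [simpl; ring|].
    change (one : R) with 1. assert (h := pos_INR k). rewrite S_INR. simpl. field. lra.
- cbn [ker_poly]. eapply is_derive_eq.
  + apply @is_derive_minus.
    * apply (is_derive_mult (fun s => s) (fun s => ker_poly P s m k)); [apply @is_derive_id|apply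
        IH|intros; apply Rmult_comm].
    * instantiate (1 := prev (fun j => P * prev (ker_poly (P - 1) t m) j + INR m * ker_poly P t (pred
        m) j) k).
      destruct k as [|k]; cbn [prev]; [apply @is_derive_const|apply IH].
  + change (1 * ker_poly P t m k + t * (P * prev (ker_poly (P - 1) t m) k + INR m * ker_poly P t (pred m) k)
      - prev (fun j => P * prev (ker_poly (P - 1) t m) j + INR m * ker_poly P t (pred m) j) k =
      P * prev (ker_poly (P - 1) t (S m)) k + INR (S m) * ker_poly P t m k).
    rewrite S_INR. destruct m as [|m]; destruct k as [|k]; cbn [prev pred ker_poly]; simpl INR; ring.
Qed.

(** The operator z d/dz on the generating function, with z (t - z)^(m - 1) rewritten as t (t - z)^(m
    - 1) - (t - z)^m. *)
Lemma ker_poly_Euler (P t : R) (m : nat) : forall k,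
  INR k * ker_poly P t m k = t * P * prev (ker_poly (P - 1) t m) k - INR m * (t * ker_poly P t (pred m)
    k - ker_poly P t m k).
Proof.
induction m as [|m IH]; intros k.
- destruct k as [|k]; cbn [ker_poly prev pred gbinom]; [simpl; ring|].
  assert (h := pos_INR k). rewrite S_INR. simpl. field. lra.
- assert (E : INR k * prev (ker_poly P t m) k =
    prev (fun j => t * P * prev (ker_poly (P - 1) t m) j - INR m * (t * ker_poly P t (pred m) j -
      ker_poly P t m j)) k + prev (ker_poly P t m) k).
  { destruct k as [|k]; cbn [prev]; [simpl; ring|]. rewrite <- IH, S_INR. ring. }
  transitivity (t * (INR k * ker_poly P t m k) - INR k * prev (ker_poly P t m) k); [cbn [ker_poly]; ring|].
  rewrite E, IH, S_INR. destruct m as [|m]; destruct k as [|k]; cbn [prev pred ker_poly]; simpl INR; ring.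
Qed.

Lemma ker_poly_ode1 (P t : R) (m k : nat) :
  t * (P * prev (ker_poly (P - 1) t m) k + INR m * ker_poly P t (pred m) k) =
  (INR k - INR m) * ker_poly P t m k + 2 * INR m * t * ker_poly P t (pred m) k.
Proof. assert (E := ker_poly_Euler P t m k). lra. Qed.

(** Euler's identity at m + 1 brings in the neighbour m + 1. Together with [ker_poly_ode1] it
    supplies the two real relations behind [row_sol_ode]. *)
Lemma ker_poly_ode2 (P t : R) (m k : nat) :
  (1 + t ^ 2) * (P * prev (ker_poly (P - 1) t m) k + INR m * ker_poly P t (pred m) k) =
  t * (P + INR m + 1) * ker_poly P t m k + INR m * (1 + t ^ 2) * ker_poly P t (pred m) k
  - (P + INR m + 1 - INR k) * ker_poly P t (S m) k.
Proof.
assert (E := ker_poly_Euler P t (S m) k).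
assert (E1 : prev (ker_poly P t m) k = prev (ker_poly (P - 1) t m) k + t * prev (prev (ker_poly (P - 1)
  t m)) k).
{ destruct k as [|k]; cbn [prev]; [ring|apply ker_poly_lower]. }
assert (E2 : prev (ker_poly (P - 1) t (S m)) k = t * prev (ker_poly (P - 1) t m) k - prev (prev
  (ker_poly (P - 1) t m)) k).
{ destruct k as [|k]; cbn [prev ker_poly]; ring. }
assert (E3 : ker_poly P t (S m) k = t * ker_poly P t m k - prev (ker_poly P t m) k) by reflexivity.
rewrite E2 in E. cbn [pred] in E. rewrite S_INR in E.
set (x := prev (ker_poly (P - 1) t m) k) in *. set (x2 := prev (prev (ker_poly (P - 1) t m)) k) in *.
set (r := ker_poly P t m k) in *. set (r1 := ker_poly P t (S m) k) in *. set (Y := prev (ker_poly P t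
  m) k) in *.
assert (EY : t * r - r1 = Y) by lra. rewrite EY in E.
replace (t * P * (t * x - x2)) with (P * (t ^ 2 * x - (Y - x))) in E by (rewrite E1; ring).
assert (E4 : r1 = t * r - Y) by lra. rewrite E4 in *. lra.
Qed.

(** * Derivatives of complex-valued functions and powers of 1 + i t *)

Definition cder (f : R -> C) (t : R) (l : C) : Prop :=
  is_derive (fun s => fst (f s)) t (fst l) /\ is_derive (fun s => snd (f s)) t (snd l).

Lemma cder_eq (f : R -> C) (t : R) (l l' : C) : cder f t l -> l = l' -> cder f t l'.
Proof. intros H <-; exact H. Qed.

Lemma cder_ext_loc (f g : R -> C) (t : R) (l : C) : locally t (fun s => f s = g s) -> cder f t l ->
  cder g t l.
Proof.
intros H [H1 H2]. split; eapply is_derive_ext_loc; try eassumption.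
- apply (filter_imp (fun s => f s = g s)); [|exact H]. intros s ->; reflexivity.
- apply (filter_imp (fun s => f s = g s)); [|exact H]. intros s ->; reflexivity.
Qed.

Lemma cder_unique (f : R -> C) (t : R) (l l' : C) : cder f t l -> cder f t l' -> l = l'.
Proof.
intros [H1 H2] [H3 H4]. destruct l as [a b], l' as [c d]. simpl in *.
apply is_derive_unique in H1. apply is_derive_unique in H2.
apply is_derive_unique in H3. apply is_derive_unique in H4. congruence.
Qed.

Lemma cder_const (c : C) (t : R) : cder (fun _ => c) t 0.
Proof.
split; [change (is_derive (fun _ : R => fst c) t 0)|change (is_derive (fun _ : R => snd c) t 0)];
  apply @is_derive_const.
Qed.

Lemma cder_real (f : R -> R) (t l : R) : is_derive f t l -> cder (fun s => RtoC (f s)) t l.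
Proof.
intros H. split; [exact H|].
change (is_derive (fun _ : R => 0) t 0). apply @is_derive_const.
Qed.

Lemma cder_plus (f g : R -> C) (t : R) (l l' : C) :
  cder f t l -> cder g t l' -> cder (fun s => f s + g s)%C t (l + l')%C.
Proof.
intros [H1 H2] [H3 H4]. split; simpl.
- apply (is_derive_plus (fun s => fst (f s)) (fun s => fst (g s))); assumption.
- apply (is_derive_plus (fun s => snd (f s)) (fun s => snd (g s))); assumption.
Qed.

Lemma cder_mult (f g : R -> C) (t : R) (l l' : C) :
  cder f t l -> cder g t l' -> cder (fun s => f s * g s)%C t (l * g t + f t * l')%C.
Proof.
intros [H1 H2] [H3 H4]. split; simpl.
- eapply is_derive_eq.
  + apply (is_derive_minus (fun s => fst (f s) * fst (g s)) (fun s => snd (f s) * snd (g s)));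
      [apply (is_derive_mult (fun s => fst (f s)) (fun s => fst (g s)))|
       apply (is_derive_mult (fun s => snd (f s)) (fun s => snd (g s)))];
      try eassumption; intros; apply Rmult_comm.
  + unfold minus, plus, opp, mult; simpl. ring.
- eapply is_derive_eq.
  + apply (is_derive_plus (fun s => fst (f s) * snd (g s)) (fun s => snd (f s) * fst (g s)));
      [apply (is_derive_mult (fun s => fst (f s)) (fun s => snd (g s)))|
       apply (is_derive_mult (fun s => snd (f s)) (fun s => fst (g s)))];
      try eassumption; intros; apply Rmult_comm.
  + unfold plus, mult; simpl. ring.
Qed.

Lemma cder_pow (f : R -> C) (t : R) (l : C) (m : nat) :
  cder f t l -> cder (fun s => f s ^ S m)%C t (INR (S m) * l * f t ^ m)%C.
Proof.
intros H. induction m as [|m IH].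
- eapply cder_eq; [apply (cder_ext_loc f); [|exact H]|].
  + apply filter_forall. intros s. simpl. ring.
  + simpl. ring.
- eapply cder_eq.
  + apply (cder_ext_loc (fun s => f s * f s ^ S m)%C); [|apply cder_mult; [exact H|exact IH]].
    apply filter_forall. intros s. reflexivity.
  + rewrite (S_INR (S m)), RtoC_plus. simpl Cpow. ring.
Qed.

(* [1 / (1 + i t)] and [(1 + i t) ^ (- b)] *)
Definition inv1it (t : R) : C := (/ (1 + t ^ 2), - t / (1 + t ^ 2)).
Definition pow1it (b t : R) : C :=
  (Rpower (1 + t ^ 2) (- b / 2) * cos (b * atan t), - (Rpower (1 + t ^ 2) (- b / 2) * sin (b * atan t))).

Lemma sq_pos (t : R) : 0 < 1 + t ^ 2.
Proof. assert (h := pow2_ge_0 t). lra. Qed.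

Lemma inv1it_inv (t : R) : ((1 + Ci * t) * inv1it t)%C = 1.
Proof.
assert (h := sq_pos t).
unfold inv1it, Ci, Cmult, Cplus, RtoC; simpl. f_equal; field; simpl in h; lra.
Qed.

Lemma inv1it_derive (t : R) : cder inv1it t (- Ci * (inv1it t * inv1it t))%C.
Proof.
assert (h := sq_pos t).
split; unfold inv1it; simpl.
- auto_derive; [simpl in h; lra|]. simpl in h. field. lra.
- auto_derive; [simpl in h; lra|]. simpl in h. field. lra.
Qed.

Lemma pow1it_derive (b t : R) : cder (pow1it b) t (- Ci * RtoC b * inv1it t * pow1it b t)%C.
Proof.
assert (h := sq_pos t).
assert (HR : is_derive (fun s => Rpower (1 + s ^ 2) (- b / 2)) t (- b * t / (1 + t ^ 2) * Rpower (1 + t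
  ^ 2) (- b / 2))).
{ eapply is_derive_eq.
  - apply (Rpower_derive_comp (fun s => 1 + s ^ 2)); [exact h|]. instantiate (1 := 2 * t). auto_derive;
      auto; ring.
  - field. lra. }
assert (HA : is_derive (fun s => b * atan s) t (b / (1 + t ^ 2))).
{ eapply is_derive_eq; [apply is_derive_scal, is_derive_atan|]. unfold Rsqr. field. simpl in h. lra. }
split; unfold pow1it; simpl fst; simpl snd.
- eapply is_derive_eq.
  + apply (is_derive_mult (fun s => Rpower (1 + s ^ 2) (- b / 2)) (fun s => cos (b * atan s)));
      [exact HR| |intros; apply Rmult_comm].
    apply (is_derive_comp cos (fun s => b * atan s)); [apply is_derive_cos|exact HA].
  + unfold plus, mult, scal, inv1it; simpl; unfold mult; simpl. field. simpl in h. lra.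
- eapply is_derive_eq.
  + apply (is_derive_opp (fun s => Rpower (1 + s ^ 2) (- b / 2) * sin (b * atan s))).
    apply (is_derive_mult (fun s => Rpower (1 + s ^ 2) (- b / 2)) (fun s => sin (b * atan s)));
      [exact HR| |intros; apply Rmult_comm].
    apply (is_derive_comp sin (fun s => b * atan s)); [apply is_derive_sin|exact HA].
  + unfold opp, plus, mult, scal, inv1it; simpl; unfold mult; simpl. field. simpl in h. lra.
Qed.

Lemma inv1it_Cmod (t : R) : Cmod (inv1it t) = / sqrt (1 + t ^ 2).
Proof.
assert (h := sq_pos t). rewrite <- sqrt_inv. unfold Cmod, inv1it. cbn [fst snd]. f_equal. field. lra.
Qed.

Lemma pow1it_Cmod (b t : R) : Cmod (pow1it b t) = Rpower (1 + t ^ 2) (- b / 2).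
Proof.
unfold Cmod, pow1it. cbn [fst snd].
assert (hA := sin2_cos2 (b * atan t)); unfold Rsqr in hA.
set (r := Rpower (1 + t ^ 2) (- b / 2)).
rewrite <- (sqrt_square r) at 3 by (apply Rlt_le, exp_pos). f_equal.
transitivity (r * r * (sin (b * atan t) * sin (b * atan t) + cos (b * atan t) * cos (b * atan t))); [ring|].
rewrite hA. ring.
Qed.

(** * The explicit solution *)

Definition lag_norm (alpha : R) (m : nat) : R := sqrt (lag_sq alpha m).

Lemma lag_norm_pos (alpha : R) (m : nat) : 0 <= alpha -> 0 < lag_norm alpha m.
Proof. intros H. apply sqrt_lt_R0, lag_sq_pos, H. Qed.

Lemma lag_norm_next (alpha : R) (m : nat) : 0 <= alpha ->
  sqrt ((INR m + 1) * (INR m + 1 + alpha)) * lag_norm alpha m = (INR m + 1) * lag_norm alpha (S m) /\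
  sqrt ((INR m + 1) * (INR m + 1 + alpha)) * lag_norm alpha (S m) = (INR m + 1 + alpha) * lag_norm alpha m.
Proof.
intros Ha. assert (h := pos_INR m). assert (hs0 := lag_sq_pos alpha m Ha).
unfold lag_norm. cbn [lag_sq]. rewrite !sqrt_mult_alt, sqrt_div_alt by (try apply Rlt_le,
  Rdiv_lt_0_compat; lra).
assert (e1 := sqrt_sqrt (INR m + 1) ltac:(lra)). assert (e2 := sqrt_sqrt (INR m + 1 + alpha) ltac:(lra)).
assert (p1 : 0 < sqrt (INR m + 1)) by (apply sqrt_lt_R0; lra).
set (u := sqrt (INR m + 1)) in *. set (v := sqrt (INR m + 1 + alpha)) in *. set (w := sqrt (lag_sq
  alpha m)).
split.
- rewrite <- e1. field. lra.
- rewrite <- e2. field. lra.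
Qed.

(** Leaves out the factor (-i)^n / [lag_norm] alpha n, constant in m and t, which [row_eq_row_sol]
    restores. The powers of 1 + i t add up to the exponent -(1 + alpha + n + m). *)
Definition row_sol (alpha : R) (n m : nat) (t : R) : C :=
  (RtoC (lag_norm alpha m) * (- Ci) ^ m * inv1it t ^ m * (pow1it (1 + alpha) t * inv1it t ^ n) * RtoC
    (ker_poly (INR n + alpha) t m n))%C.

Definition row_ode (alpha : R) (y : nat -> R -> C) : Prop :=
  forall m t, cder (y m) t (- Ci * tau alpha (fun k => y k t) m)%C.

Lemma inv1it_pow_derive (t : R) (m : nat) : cder (fun s => inv1it s ^ m)%C t (- Ci * RtoC (INR m) *
  inv1it t * inv1it t ^ m)%C.
Proof.
destruct m as [|m].
- apply (cder_eq _ _ 0); [|simpl INR; ring].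
  apply (cder_ext_loc (fun _ => RtoC 1)); [apply filter_forall; reflexivity|apply cder_const].
- eapply cder_eq; [apply (cder_pow inv1it), inv1it_derive|]. simpl Cpow. ring.
Qed.

Lemma row_sol_ode (alpha : R) (n : nat) : 0 <= alpha -> row_ode alpha (row_sol alpha n).
Proof.
intros Ha m t.
set (P := INR n + alpha).
set (dr := P * prev (ker_poly (P - 1) t m) n + INR m * ker_poly P t (pred m) n).
set (W := (inv1it t ^ m * (pow1it (1 + alpha) t * inv1it t ^ n))%C).
apply (cder_eq _ _ (RtoC (lag_norm alpha m) * (- Ci) ^ m * W * (- Ci * RtoC (1 + P + INR m) * inv1it t
  * RtoC (ker_poly P t m n) + RtoC dr))%C).
- apply (cder_ext_loc (fun s => RtoC (lag_norm alpha m) * (- Ci) ^ m * ((inv1it s ^ m * (pow1it (1 +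
    alpha) s * inv1it s ^ n)) * RtoC (ker_poly P s m n)))%C).
  { apply filter_forall. intros s. unfold row_sol. fold P. ring. }
  eapply cder_eq.
  + apply cder_mult; [apply cder_const|]. apply cder_mult.
    * apply cder_mult; [apply inv1it_pow_derive|]. apply cder_mult; [apply pow1it_derive|apply
        inv1it_pow_derive].
    * apply cder_real. apply ker_poly_derive.
  + fold dr. unfold W, P. rewrite !RtoC_plus. ring.
- assert (E1 := ker_poly_ode1 P t m n). assert (E2 := ker_poly_ode2 P t m n). fold dr in E1, E2.
  assert (Hd := inv1it_inv t).
  assert (Hm : (tau alpha (fun k => row_sol alpha n k t) m) =
    (RtoC (lag_norm alpha m) * (- Ci) ^ m * W *
     (RtoC (INR m) * Ci * (1 + Ci * t) * RtoC (ker_poly P t (pred m) n) + RtoC (2 * INR m + 1 + alpha)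
       * RtoC (ker_poly P t m n)
      - Ci * RtoC (INR m + 1 + alpha) * inv1it t * RtoC (ker_poly P t (S m) n)))%C).
  { unfold tau, row_sol. fold P.
    assert (T3 : (RtoC (sqrt ((INR m + 1) * (INR m + 1 + alpha))) *
       (RtoC (lag_norm alpha (S m)) * (- Ci) ^ S m * inv1it t ^ S m * (pow1it (1 + alpha) t * inv1it t
         ^ n) * RtoC (ker_poly P t (S m) n)) =
       RtoC (lag_norm alpha m) * (- Ci) ^ m * W * (- Ci * RtoC (INR m + 1 + alpha) * inv1it t * RtoC
         (ker_poly P t (S m) n)))%C).
    { destruct (lag_norm_next alpha m Ha) as [_ h].
      transitivity (RtoC (sqrt ((INR m + 1) * (INR m + 1 + alpha)) * lag_norm alpha (S m)) * (- Ci) ^ S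
        m * inv1it t ^ S m * (pow1it (1 + alpha) t * inv1it t ^ n) * RtoC (ker_poly P t (S m) n))%C.
      { rewrite RtoC_mult. ring. }
      rewrite h, RtoC_mult. unfold W. simpl Cpow. ring. }
    rewrite T3.
    (* Going down to index m - 1 costs a factor i and one power of 1 / (1 + i t), which reappears as
       1 + i t; at m = 0 both sides vanish. *)
    assert (T1 : (RtoC (sqrt (INR m * (INR m + alpha))) * match m with
       | 0%nat => 0 | S p => RtoC (lag_norm alpha p) * (- Ci) ^ p * inv1it t ^ p * (pow1it (1 + alpha)
         t * inv1it t ^ n) * RtoC (ker_poly P t p n) end =
       RtoC (lag_norm alpha m) * (- Ci) ^ m * W * (RtoC (INR m) * Ci * (1 + Ci * t) * RtoC (ker_poly P
         t (pred m) n)))%C).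
    { destruct m as [|p]; [simpl INR; ring|]. cbn [pred].
      destruct (lag_norm_next alpha p Ha) as [h _]. rewrite S_INR.
      transitivity (RtoC (sqrt ((INR p + 1) * (INR p + 1 + alpha)) * lag_norm alpha p) * (- Ci) ^ p *
        inv1it t ^ p * (pow1it (1 + alpha) t * inv1it t ^ n) * RtoC (ker_poly P t p n))%C.
      { rewrite RtoC_mult. ring. }
      rewrite h, RtoC_mult. unfold W. simpl Cpow.
      transitivity (RtoC (INR p + 1) * RtoC (lag_norm alpha (S p)) * (- Ci) ^ p * inv1it t ^ p *
        (pow1it (1 + alpha) t * inv1it t ^ n) * RtoC (ker_poly P t p n)
        * (- (Ci * Ci)) * ((1 + Ci * t) * inv1it t))%C; [|ring].
      rewrite Hd. replace (Ci * Ci)%C with (- (1))%C; [ring|].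
      unfold Ci, Cmult, Copp, RtoC; simpl; f_equal; ring. }
    rewrite T1. unfold W. ring. }
  rewrite Hm.
  transitivity (RtoC (lag_norm alpha m) * (- Ci) ^ m * W * (- Ci) *
    (RtoC (1 + P + INR m) * inv1it t * RtoC (ker_poly P t m n) + Ci * RtoC dr))%C.
  { replace (RtoC dr) with (- (Ci * Ci) * RtoC dr)%C at 1; [ring|].
    unfold Ci, Cmult, Copp, RtoC; simpl; f_equal; ring. }
  transitivity (RtoC (lag_norm alpha m) * (- Ci) ^ m * W * (- Ci) *
     (RtoC (INR m) * Ci * (1 + Ci * t) * RtoC (ker_poly P t (pred m) n) + RtoC (2 * INR m + 1 + alpha)
       * RtoC (ker_poly P t m n)
      - Ci * RtoC (INR m + 1 + alpha) * inv1it t * RtoC (ker_poly P t (S m) n)))%C; [|ring].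
  f_equal.
  (* multiplied by [1 + i t], the real part is [E1], the imaginary part [E2] minus [t E1] *)
  set (r := ker_poly P t m n) in *. set (r0 := ker_poly P t (pred m) n) in *. set (r1 := ker_poly P t
    (S m) n) in *.
  replace (P + INR m + 1 - INR n) with (INR m + 1 + alpha) in E2 by (unfold P; ring).
  assert (EP : P = INR n + alpha) by reflexivity. clearbody P r r0 r1 dr. clear T3 W Hm || clear W Hm.
  transitivity (inv1it t * (RtoC (1 + P + INR m) * RtoC r + Ci * RtoC dr * (1 + Ci * t)))%C.
  { transitivity (RtoC (1 + P + INR m) * inv1it t * RtoC r + Ci * RtoC dr * ((1 + Ci * t) * inv1it
      t))%C; [rewrite Hd|]; ring. }
  transitivity (inv1it t * ((1 + Ci * t) * (RtoC (INR m) * Ci * (1 + Ci * t) * RtoC r0 + RtoC (2 * INR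
    m + 1 + alpha) * RtoC r)
      - Ci * RtoC (INR m + 1 + alpha) * RtoC r1))%C.
  2:{ transitivity ((((1 + Ci * t) * inv1it t) * (RtoC (INR m) * Ci * (1 + Ci * t) * RtoC r0 + RtoC (2
    * INR m + 1 + alpha) * RtoC r)
      - Ci * RtoC (INR m + 1 + alpha) * inv1it t * RtoC r1))%C; [|rewrite Hd]; ring. }
  f_equal.
  assert (E3 : t * (t * dr) = t * ((INR n - INR m) * r + 2 * INR m * t * r0)) by (rewrite E1; reflexivity).
  apply injective_projections; simpl; rewrite EP in *; lra.
Qed.

(** * Matrix entries of the unitary group *)

Lemma is_series_single (f : nat -> R) (n : nat) : (forall k, k <> n -> f k = 0) -> is_series f (f n).
Proof.
intros Hf.
assert (H0 : forall N, (N < n)%nat -> sum_n f N = 0).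
{ induction N as [|N IH]; intros HN.
  - rewrite sum_O. apply Hf. lia.
  - rewrite sum_Sn, IH, Hf by lia. unfold plus; simpl. ring. }
assert (H1 : forall N, (n <= N)%nat -> sum_n f N = f n).
{ intros N HN. induction HN as [|N HN IH].
  - destruct n as [|j]; [apply sum_O|]. rewrite sum_Sn, H0 by lia. unfold plus; simpl. ring.
  - rewrite sum_Sn, IH, (Hf (S N)) by lia. unfold plus; simpl. ring. }
apply (is_lim_seq_ext_loc (fun _ => f n) (sum_n f) (f n)); [|apply is_lim_seq_const].
exists n. intros N HN. symmetry. apply H1, HN.
Qed.

Lemma Cmod_sq (z : C) : Cmod z ^ 2 = fst z ^ 2 + snd z ^ 2.
Proof. unfold Cmod. apply pow2_sqrt. apply Rplus_le_le_0_compat; apply pow2_ge_0. Qed.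

Lemma delta_eq (n : nat) : delta n n = 1.
Proof. unfold delta. rewrite Nat.eqb_refl. reflexivity. Qed.

Lemma delta_neq (n k : nat) : k <> n -> delta n k = 0.
Proof. intros H. unfold delta. apply Nat.eqb_neq in H. rewrite H. reflexivity. Qed.

Lemma Series_single (f : nat -> R) (n : nat) : (forall k, k <> n -> f k = 0) -> Series f = f n.
Proof. intros H. apply is_series_unique, is_series_single, H. Qed.

Lemma inner_delta_l (n : nat) (v : nat -> C) : inner (delta n) v = v n.
Proof.
unfold inner. apply injective_projections; cbn [fst snd]; rewrite (Series_single _ n).
- rewrite delta_eq. unfold Re, Cconj, Cmult, RtoC; simpl. ring.
- intros k Hk. rewrite (delta_neq n k Hk). unfold Re, Cconj, Cmult, RtoC; simpl. ring.
- rewrite delta_eq. unfold Im, Cconj, Cmult, RtoC; simpl. ring.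
- intros k Hk. rewrite (delta_neq n k Hk). unfold Im, Cconj, Cmult, RtoC; simpl. ring.
Qed.

Lemma inner_delta_r (n : nat) (v : nat -> C) : inner v (delta n) = Cconj (v n).
Proof.
unfold inner. apply injective_projections; cbn [fst snd]; rewrite (Series_single _ n).
- rewrite delta_eq. unfold Re, Cconj, Cmult, RtoC; simpl. ring.
- intros k Hk. rewrite (delta_neq n k Hk). unfold Re, Cconj, Cmult, RtoC; simpl. ring.
- rewrite delta_eq. unfold Im, Cconj, Cmult, RtoC; simpl. ring.
- intros k Hk. rewrite (delta_neq n k Hk). unfold Im, Cconj, Cmult, RtoC; simpl. ring.
Qed.

Lemma l2_delta (n : nat) : l2 (delta n).
Proof.
unfold l2. exists (Cmod (delta n n) ^ 2). apply (is_series_single (fun k => Cmod (delta n k) ^ 2)).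
intros k Hk. rewrite (delta_neq n k Hk), Cmod_0. ring.
Qed.

Lemma l2_linear (a b : C) (u v : nat -> C) : l2 u -> l2 v -> l2 (fun k => a * u k + b * v k)%C.
Proof.
intros Hu Hv. unfold l2.
apply (@ex_series_le R_AbsRing R_CompleteNormedModule _ (fun k => 2 * Cmod a ^ 2 * Cmod (u k) ^ 2 + 2 *
  Cmod b ^ 2 * Cmod (v k) ^ 2)).
- intros k. unfold norm; simpl. unfold abs; simpl.
  rewrite Rabs_pos_eq by (assert (h := pow2_ge_0 (Cmod (a * u k + b * v k))); simpl in h; exact h).
  assert (h := Cmod_triangle (a * u k) (b * v k)). rewrite !Cmod_mult in h.
  assert (h0 := Cmod_ge_0 (a * u k + b * v k)).
  assert (h1 := pow2_ge_0 (Cmod a * Cmod (u k) - Cmod b * Cmod (v k))).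
  nra.
- apply (ex_series_plus (fun k => 2 * Cmod a ^ 2 * Cmod (u k) ^ 2) (fun k => 2 * Cmod b ^ 2 * Cmod (v
    k) ^ 2)).
  + apply (ex_series_scal_l (2 * Cmod a ^ 2) (fun k => Cmod (u k) ^ 2)), Hu.
  + apply (ex_series_scal_l (2 * Cmod b ^ 2) (fun k => Cmod (v k) ^ 2)), Hv.
Qed.

Lemma Cmod_le_l2norm (u : nat -> C) (n : nat) : l2 u -> Cmod (u n) <= l2norm u.
Proof.
intros Hu. unfold l2norm. rewrite <- (sqrt_square (Cmod (u n))) by apply Cmod_ge_0.
apply sqrt_le_1_alt.
assert (Hs : Series (fun k => if Nat.eqb k n then Cmod (u k) ^ 2 else 0) = Cmod (u n) ^ 2).
{ rewrite (Series_single _ n); [rewrite Nat.eqb_refl; reflexivity|].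
  intros k Hk. apply Nat.eqb_neq in Hk. rewrite Hk. reflexivity. }
replace (Cmod (u n) * Cmod (u n)) with (Cmod (u n) ^ 2) by ring.
rewrite <- Hs. apply Series_le; [|exact Hu].
intros k. assert (h := pow2_ge_0 (Cmod (u k))). destruct (Nat.eqb k n); lra.
Qed.

Lemma l2norm_inner (u : nat -> C) : l2norm u = sqrt (fst (inner u u)).
Proof.
unfold l2norm, inner. cbn [fst]. f_equal. apply Series_ext. intros k. rewrite Cmod_sq.
unfold Re, Cconj, Cmult; simpl. ring.
Qed.

Lemma unitary_l2norm (V : (nat -> C) -> nat -> C) (u : nat -> C) : unitary V -> l2 u -> l2norm (V u) =
  l2norm u.
Proof. intros HV Hu. rewrite !l2norm_inner, (unitary_inner V HV) by assumption. reflexivity. Qed.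

Lemma l2norm_delta (n : nat) : l2norm (delta n) = 1.
Proof.
rewrite l2norm_inner, inner_delta_l, delta_eq. simpl. apply sqrt_1.
Qed.

(** Nested as a combination of two terms, one of them again such a combination, so that [l2_linear]
    and [unitary_comb] apply twice. *)
Lemma tau_delta (alpha : R) (m : nat) : tau alpha (delta m) =
  (fun k => RtoC (sqrt ((INR m + 1) * (INR m + 1 + alpha))) * delta (S m) k +
    1 * (RtoC (2 * INR m + 1 + alpha) * delta m k +
      match m with O => RtoC 0 | S p => RtoC (sqrt (INR m * (INR m + alpha))) end * delta (pred m) k))%C.
Proof.
apply functional_extensionality. intros k. unfold tau.
assert (D : forall i j, delta i j = if Nat.eqb j i then RtoC 1 else RtoC 0) by reflexivity.
rewrite !D.
assert (E1 : (match k with 0%nat => RtoC 0 | S p => delta m p end) = if Nat.eqb k (S m) then RtoC 1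
  else RtoC 0).
{ destruct k as [|k]; reflexivity. }
rewrite E1. clear E1.
destruct (Nat.eqb_spec k (S m)) as [e|e].
- subst k. destruct (Nat.eqb_spec (S m) m); [lia|]. destruct (Nat.eqb_spec (S (S m)) m); [lia|].
  destruct (Nat.eqb_spec (S m) (pred m)); [lia|]. rewrite S_INR. ring.
- destruct (Nat.eqb_spec k m) as [e1|e1].
  + subst k. destruct (Nat.eqb_spec (S m) m); [lia|].
    destruct m as [|p]; [cbn [pred Nat.eqb]; ring|]. destruct (Nat.eqb_spec (S p) (pred (S p))) as
      [h|h]; [simpl in h; lia|]. ring.
  + destruct (Nat.eqb_spec (S k) m) as [e2|e2].
    * subst m. cbn [pred]. rewrite Nat.eqb_refl, S_INR. ring.
    * destruct m as [|p]; [cbn [pred]; ring|]. cbn [pred].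
      destruct (Nat.eqb_spec k p) as [h|h]; [lia|]. ring.
Qed.

Lemma l2_tau_delta (alpha : R) (m : nat) : l2 (tau alpha (delta m)).
Proof.
rewrite tau_delta. apply l2_linear; [apply l2_delta|]. apply l2_linear; apply l2_delta.
Qed.

Definition row (U : R -> (nat -> C) -> nat -> C) (n m : nat) (t : R) : C := U t (delta m) n.

Lemma matrix_entry_row (U : R -> (nat -> C) -> nat -> C) (n m : nat) (t : R) :
  matrix_entry (U t) n m = row U n m t.
Proof. apply inner_delta_l. Qed.

Lemma row_bound (U : R -> (nat -> C) -> nat -> C) (n m : nat) (t : R) : unitary_group U -> Cmod (row U
  n m t) <= 1.
Proof.
intros HU. assert (Ht := group_unitary U HU t).
rewrite <- (l2norm_delta m), <- (unitary_l2norm (U t)) by (assumption || apply l2_delta).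
apply Cmod_le_l2norm, (unitary_l2 _ Ht), l2_delta.
Qed.

(** U(-t) is the adjoint of U(t), so the two entries are complex conjugates. *)
Lemma row_swap (U : R -> (nat -> C) -> nat -> C) (n m : nat) (t : R) : unitary_group U ->
  Cmod (row U n m t) = Cmod (row U m n (- t)).
Proof.
intros HU. assert (Ht := group_unitary U HU t). assert (Ht' := group_unitary U HU (- t)).
unfold row. rewrite <- (inner_delta_l n (U t (delta m))).
rewrite <- (unitary_inner _ Ht') by (try apply (unitary_l2 _ Ht); apply l2_delta).
rewrite <- (group_add U HU) by apply l2_delta.
rewrite Rplus_opp_l, (group_0 U HU) by apply l2_delta.
rewrite inner_delta_r. apply Cmod_conj.
Qed.

Lemma row_0 (U : R -> (nat -> C) -> nat -> C) (n m : nat) : unitary_group U -> row U n m 0 = delta m n.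
Proof. intros HU. unfold row. rewrite (group_0 U HU) by apply l2_delta. reflexivity. Qed.

Lemma cder_of_lim (f : R -> C) (t : R) (l : C) (g : R -> R) : is_lim g 0 0 ->
  (forall h, h <> 0 -> Cmod ((f (t + h)%R - f t) / RtoC h - l)%C <= g h) -> cder f t l.
Proof.
intros Hg Hf.
assert (K : forall eps, 0 < eps -> exists d : posreal, forall h, h <> 0 -> Rabs h < d ->
  Cmod ((f (t + h)%R - f t) / RtoC h - l)%C < eps).
{ intros eps Heps. apply is_lim_spec in Hg. destruct (Hg (mkposreal eps Heps)) as [d Hd].
  exists d. intros h Hh Hhd. apply Rle_lt_trans with (1 := Hf h Hh).
  simpl in Hd. specialize (Hd h). rewrite Rminus_0_r in Hd.
  apply Rle_lt_trans with (1 := Rle_abs _). apply Hd; [|exact Hh].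
  unfold ball; simpl. unfold AbsRing_ball, abs, minus, plus, opp; simpl. rewrite Ropp_0, Rplus_0_r.
    exact Hhd. }
assert (E : forall h, h <> 0 -> ((f (t + h)%R - f t) / RtoC h - l)%C =
  ((fst (f (t + h)) - fst (f t)) / h - fst l, (snd (f (t + h)) - snd (f t)) / h - snd l)).
{ intros h Hh. unfold Cminus, Cdiv, Cinv, Cmult, Cplus, Copp, RtoC; simpl. f_equal; field; exact Hh. }
split; apply is_derive_Reals; intros eps Heps; destruct (K eps Heps) as [d Hd]; exists d; intros h Hh Hhd;
  specialize (Hd h Hh Hhd); rewrite E in Hd by exact Hh; apply Rle_lt_trans with (2 := Hd);
  match goal with |- Rabs ?x <= Cmod ?z => apply Rle_trans with (2 := Rmax_Cmod z) end; simpl;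
  [apply Rmax_l|apply Rmax_r].
Qed.

Lemma unitary_comb (V : (nat -> C) -> nat -> C) (a b : C) (u v : nat -> C) (n : nat) : unitary V -> l2
  u -> l2 v ->
  V (fun k => a * u k + b * v k)%C n = (a * V u n + b * V v n)%C.
Proof. intros HV Hu Hv. rewrite (unitary_linear V HV) by assumption. reflexivity. Qed.

(** By the group law the error of the difference quotient at t is U(t) applied to the error at 0;
    U(t) preserves its norm, and the norm dominates each coordinate. Since the Jacobi matrix is
    symmetric, U(t) applied to [tau] alpha ([delta] m) is [tau] acting on the column index m. *)
Lemma row_row_ode (alpha : R) (U : R -> (nat -> C) -> nat -> C) (n : nat) : is_exp_mit (H alpha) U ->
  row_ode alpha (row U n).
Proof.
intros [HU Hgen] m t.
assert (Ht := group_unitary U HU t).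
set (f := tau alpha (delta m)).
assert (Hf : l2 f) by apply l2_tau_delta.
destruct (Hgen (delta m) f (l2_delta m) Hf) as [Hlim _].
assert (Hdom : dom (H alpha) (delta m) /\ app (H alpha) (delta m) = f).
{ split; [split; [apply l2_delta|exact Hf]|reflexivity]. }
specialize (Hlim Hdom).
assert (Ef : U t f n = tau alpha (fun k => row U n k t) m).
{ unfold f. rewrite tau_delta.
  rewrite (unitary_comb (U t)) by (try assumption; try apply l2_delta; apply l2_linear; apply l2_delta).
  rewrite (unitary_comb (U t)) by (try assumption; apply l2_delta).
  unfold tau, row. destruct m as [|p]; cbn [pred]; ring. }
rewrite <- Ef.
eapply cder_of_lim; [exact Hlim|].
intros h Hh.
set (w := fun k => ((U h (delta m) k - delta m k) / RtoC h - - Ci * f k)%C).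
assert (Ew : w = (fun k => / RtoC h * (1 * U h (delta m) k + (- (1)) * delta m k) + Ci * f k)%C).
{ apply functional_extensionality. intros k. unfold w, Cdiv. ring. }
assert (HUh : l2 (U h (delta m))) by (apply (unitary_l2 _ (group_unitary U HU h)), l2_delta).
assert (Hl1 : l2 (fun k => 1 * U h (delta m) k + (- (1)) * delta m k)%C) by (apply l2_linear; [exact
  HUh|apply l2_delta]).
assert (Hw : l2 w).
{ rewrite Ew. apply l2_linear; assumption. }
cbv beta. fold w. rewrite <- (unitary_l2norm (U t) w Ht Hw).
apply Rle_trans with (2 := Cmod_le_l2norm (U t w) n (unitary_l2 _ Ht w Hw)).
right. f_equal. rewrite Ew.
rewrite (unitary_comb (U t)) by assumption.
rewrite (unitary_comb (U t)) by (assumption || apply l2_delta).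
rewrite <- (group_add U HU) by apply l2_delta. unfold row, Cdiv. ring.
Qed.

(** * Green's identity and uniqueness *)

Definition jac_off (alpha : R) (m : nat) : R := sqrt ((INR m + 1) * (INR m + 1 + alpha)).

Fixpoint green_sum (y Phi : nat -> R -> C) (t : R) (L : nat) (s : R) : C :=
  match L with
  | O => (y O s * Phi O (t - s)%R)%C
  | S p => (green_sum y Phi t p s + y (S p) s * Phi (S p) (t - s)%R)%C
  end.

Lemma cder_reflect (f : R -> C) (t s : R) (l : C) : cder f (t - s) l -> cder (fun u => f (t - u)%R) s
  (- l)%C.
Proof.
intros [H1 H2].
assert (h : is_derive (fun u => t - u) s (- (1))) by (auto_derive; auto; ring).
split; simpl.
- eapply is_derive_eq; [apply (is_derive_comp (fun z => fst (f z)) (fun u => t - u)); [exact H1|exact h]|].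
  unfold scal; simpl; unfold mult; simpl. ring.
- eapply is_derive_eq; [apply (is_derive_comp (fun z => snd (f z)) (fun u => t - u)); [exact H2|exact h]|].
  unfold scal; simpl; unfold mult; simpl. ring.
Qed.

Lemma tau_S (alpha : R) (u : nat -> C) (p : nat) : tau alpha u (S p) =
  (RtoC (jac_off alpha p) * u p + RtoC (2 * INR (S p) + 1 + alpha) * u (S p) + RtoC (jac_off alpha (S
    p)) * u (S (S p)))%C.
Proof. unfold tau, jac_off. rewrite !S_INR. reflexivity. Qed.

Lemma tau_O (alpha : R) (u : nat -> C) : tau alpha u O =
  (RtoC (2 * INR 0 + 1 + alpha) * u O + RtoC (jac_off alpha O) * u 1%nat)%C.
Proof. unfold tau, jac_off. ring. Qed.

(** The Jacobi matrix is symmetric and the pairing has no conjugation, so interior terms telescope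
    and the discrete Wronskian at L remains. *)
Lemma green_derive (alpha t s : R) (y Phi : nat -> R -> C) (L : nat) : row_ode alpha y -> row_ode alpha
  Phi ->
  cder (green_sum y Phi t L) s
   (- Ci * RtoC (jac_off alpha L) * (y (S L) s * Phi L (t - s)%R - y L s * Phi (S L) (t - s)%R))%C.
Proof.
intros Hy HP.
assert (Hk : forall k, cder (fun s => y k s * Phi k (t - s)%R)%C s
  (- Ci * (tau alpha (fun j => y j s) k * Phi k (t - s)%R - y k s * tau alpha (fun j => Phi j (t -
    s)%R) k))%C).
{ intros k. eapply cder_eq.
  - apply cder_mult; [apply Hy|]. apply cder_reflect. apply HP.
  - cbv beta. ring. }
induction L as [|L IH]; cbn [green_sum].
- eapply cder_eq; [apply Hk|]. rewrite !tau_O. ring.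
- eapply cder_eq; [apply cder_plus; [apply IH|apply Hk]|]. rewrite !tau_S. ring.
Qed.

Lemma fst_le_Cmod (z : C) : Rabs (fst z) <= Cmod z.
Proof. apply Rle_trans with (2 := Rmax_Cmod z). apply Rmax_l. Qed.

Lemma snd_le_Cmod (z : C) : Rabs (snd z) <= Cmod z.
Proof. apply Rle_trans with (2 := Rmax_Cmod z). apply Rmax_r. Qed.

(** The row is only known to be bounded, so all decay must come from Phi. The pairing is y_0(t) at s
    = t and, once n <= L, Phi_n(t) at s = 0; in between it varies by at most t e(L) in each
    component. *)
Lemma green_unique (alpha t : R) (y Phi : nat -> R -> C) (n : nat) (e : nat -> R) : 0 < t ->
  row_ode alpha y -> row_ode alpha Phi ->
  (forall m s, Cmod (y m s) <= 1) ->
  (forall m, y m 0 = delta n m) -> (forall m, Phi m 0 = delta 0 m) ->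
  is_lim_seq e 0 ->
  (forall L s, 0 <= s <= t -> jac_off alpha L * (Cmod (Phi L s) + Cmod (Phi (S L) s)) <= e L) ->
  y O t = Phi n t.
Proof.
intros Ht Hy HP Hb Hy0 HP0 He Hd.
assert (G1 : forall L, green_sum y Phi t L t = y O t).
{ induction L as [|L IH]; cbn [green_sum].
  - rewrite Rminus_diag, HP0, delta_eq. ring.
  - rewrite IH, Rminus_diag, HP0, delta_neq by lia. ring. }
assert (G0 : forall L, green_sum y Phi t L 0 = if Nat.leb n L then Phi n t else 0).
{ induction L as [|L IH]; cbn [green_sum].
  - rewrite Hy0, Rminus_0_r. destruct n as [|p]; [rewrite delta_eq|rewrite delta_neq by lia]; cbn
      [Nat.leb]; ring.
  - rewrite IH, Hy0, Rminus_0_r. destruct (Nat.eq_dec n (S L)) as [->|hn].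
    + rewrite delta_eq. replace (Nat.leb (S L) L) with false by (symmetry; apply Nat.leb_gt; lia).
      rewrite Nat.leb_refl. ring.
    + rewrite delta_neq by lia. destruct (Nat.leb_spec n L); destruct (Nat.leb_spec n (S L)); try lia;
        ring. }
set (dg := fun L s => (- Ci * RtoC (jac_off alpha L) * (y (S L) s * Phi L (t - s)%R - y L s * Phi (S L)
  (t - s)%R))%C).
assert (Hdg : forall L s, 0 <= s <= t -> Cmod (dg L s) <= e L).
{ intros L s Hs. apply Rle_trans with (2 := Hd L (t - s) ltac:(lra)). unfold dg.
  assert (hj : 0 <= jac_off alpha L) by apply sqrt_pos.
  rewrite !Cmod_mult, Cmod_opp, Cmod_R, (Rabs_pos_eq (jac_off alpha L)) by exact hj.
  rewrite Cmod_Ci, Rmult_1_l. apply Rmult_le_compat_l; [exact hj|].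
  unfold Cminus. apply Rle_trans with (1 := Cmod_triangle _ _). rewrite Cmod_opp, !Cmod_mult.
  assert (h1 := Hb (S L) s). assert (h2 := Hb L s).
  assert (h3 := Cmod_ge_0 (Phi L (t - s))). assert (h4 := Cmod_ge_0 (Phi (S L) (t - s))).
  assert (h5 := Cmod_ge_0 (y (S L) s)). assert (h6 := Cmod_ge_0 (y L s)). nra. }
assert (Lim : forall x, (forall L, (n <= L)%nat -> Rabs x <= e L * t) -> x = 0).
{ intros x Hx. assert (h : Rbar_le (Rabs x) (0 * t)).
  { apply (is_lim_seq_le_loc (fun _ => Rabs x) (fun L => e L * t)).
    - exists n. intros L HL. apply Hx, HL.
    - apply is_lim_seq_const.
    - apply (is_lim_seq_scal_r e t 0), He. }
  simpl in h. rewrite Rmult_0_l in h. assert (h2 := Rabs_pos x).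
  destruct (Req_dec x 0) as [h3|h3]; [exact h3|]. apply Rabs_pos_lt in h3. lra. }
assert (E : forall L, (n <= L)%nat -> Rabs (fst (y O t) - fst (Phi n t)) <= e L * t /\
   Rabs (snd (y O t) - snd (Phi n t)) <= e L * t).
{ intros L HL. assert (g0 := G0 L). rewrite (proj2 (Nat.leb_le n L) HL) in g0.
  rewrite <- g0, <- (G1 L).
  replace (e L * t) with (e L * t - e L * 0) by ring.
  split.
  - apply (derive_compare (fun s => fst (green_sum y Phi t L s)) (fun s => e L * s) (fun s => fst (dg L
      s)) (fun _ => e L)); [lra| | |].
    + intros s _. apply (green_derive alpha t s y Phi L Hy HP).
    + intros s _. eapply is_derive_eq; [apply is_derive_scal, @is_derive_id|apply Rmult_1_r].
    + intros s Hs. apply Rle_trans with (1 := fst_le_Cmod _). apply Hdg, Hs.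
  - apply (derive_compare (fun s => snd (green_sum y Phi t L s)) (fun s => e L * s) (fun s => snd (dg L
      s)) (fun _ => e L)); [lra| | |].
    + intros s _. apply (green_derive alpha t s y Phi L Hy HP).
    + intros s _. eapply is_derive_eq; [apply is_derive_scal, @is_derive_id|apply Rmult_1_r].
    + intros s Hs. apply Rle_trans with (1 := snd_le_Cmod _). apply Hdg, Hs. }
apply injective_projections.
- apply Rminus_diag_uniq, Lim. intros L HL. apply E, HL.
- apply Rminus_diag_uniq, Lim. intros L HL. apply E, HL.
Qed.

Lemma ker_poly_col0 (P t : R) (m : nat) : ker_poly P t m 0 = t ^ m.
Proof. induction m as [|m IH]; cbn [ker_poly prev gbinom]; [simpl; ring|]. rewrite IH. simpl. ring. Qed.

Lemma lag_sq_ge_1 (alpha : R) (m : nat) : 0 <= alpha -> 1 <= lag_sq alpha m.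
Proof.
intros Ha. induction m as [|m IH]; cbn [lag_sq]; [lra|]. assert (h := pos_INR m).
assert (1 <= (INR m + 1 + alpha) / (INR m + 1)).
{ apply Rle_div_r; [lra|]. lra. }
nra.
Qed.

Lemma Cmod_Ci_pow (m : nat) : Cmod ((- Ci) ^ m) = 1.
Proof. rewrite Cmod_pow, Cmod_opp, Cmod_Ci. apply pow1. Qed.

Lemma row_sol_Cmod (alpha t : R) (n m : nat) : 0 <= alpha ->
  Cmod (row_sol alpha n m t) = lag_norm alpha m * (Rpower (1 + t ^ 2) (- (1 + alpha) / 2) * (/ sqrt (1
    + t ^ 2)) ^ (m + n))
    * Rabs (ker_poly (INR n + alpha) t m n).
Proof.
intros Ha. unfold row_sol.
rewrite !Cmod_mult, Cmod_Ci_pow, !Cmod_pow, !Cmod_R, pow1it_Cmod, inv1it_Cmod, pow_add.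
rewrite (Rabs_pos_eq (lag_norm alpha m)) by apply Rlt_le, lag_norm_pos, Ha. ring.
Qed.

Lemma row_sol_init (alpha : R) (m : nat) : 0 <= alpha -> row_sol alpha 0 m 0 = delta 0 m.
Proof.
intros Ha. unfold row_sol. rewrite ker_poly_col0. destruct m as [|m].
- rewrite delta_eq.
  assert (E : pow1it (1 + alpha) 0 = 1).
  { unfold pow1it. rewrite atan_0, Rmult_0_r, cos_0, sin_0. replace (1 + 0 ^ 2) with 1 by ring.
    unfold Rpower. rewrite ln_1, Rmult_0_r, exp_0. unfold RtoC. f_equal; ring. }
  rewrite E. unfold lag_norm. cbn [lag_sq]. rewrite sqrt_1. simpl. ring.
- rewrite delta_neq by lia. rewrite pow_ne_zero by lia. ring.
Qed.

(** Column 0 of [ker_poly] is t^m, which leaves the geometric factor (s / sqrt (1 + s^2))^m,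
    increasing in s. The ratio test shows that it beats [lag_sq] and the off-diagonal
    coefficient. *)
Lemma row_sol_decay (alpha t : R) : 0 <= alpha -> 0 < t -> exists e, is_lim_seq e 0 /\
  forall L s, 0 <= s <= t -> jac_off alpha L * (Cmod (row_sol alpha 0 L s) + Cmod (row_sol alpha 0 (S
    L) s)) <= e L.
Proof.
intros Ha Ht.
assert (hq : 0 < sqrt (1 + t ^ 2)) by (apply sqrt_lt_R0, sq_pos).
set (q := t / sqrt (1 + t ^ 2)).
assert (hq0 : 0 < q) by (apply Rdiv_lt_0_compat; assumption).
assert (hq1 : q < 1).
{ apply Rlt_div_l; [exact hq|]. rewrite Rmult_1_l.
  apply Rsqr_incrst_0; [|lra|lra]. rewrite Rsqr_sqrt by (apply Rlt_le, sq_pos). unfold Rsqr. lra. }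
assert (hb : forall m s, 0 <= s <= t -> Cmod (row_sol alpha 0 m s) <= lag_sq alpha m * q ^ m).
{ intros m s Hs. rewrite row_sol_Cmod by exact Ha. rewrite ker_poly_col0, Nat.add_0_r.
  assert (hs1 := sq_pos s). assert (hs2 : 0 < sqrt (1 + s ^ 2)) by (apply sqrt_lt_R0, hs1).
  rewrite Rabs_pos_eq by (apply pow_le; lra).
  assert (h1 : lag_norm alpha m <= lag_sq alpha m).
  { unfold lag_norm. assert (h := lag_sq_ge_1 alpha m Ha). rewrite <- (sqrt_square (lag_sq alpha m)) at
      2 by lra.
    apply sqrt_le_1_alt. nra. }
  assert (h2 : Rpower (1 + s ^ 2) (- (1 + alpha) / 2) <= 1).
  { apply Rle_trans with (Rpower (1 + s ^ 2) 0); [|rewrite Rpower_O by exact hs1; lra].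
    apply Rle_Rpower; [assert (h := pow2_ge_0 s)|]; lra. }
  assert (h3 : (/ sqrt (1 + s ^ 2)) ^ m * s ^ m <= q ^ m).
  { rewrite <- Rpow_mult_distr. apply pow_incr. split.
    - apply Rmult_le_pos; [apply Rlt_le, Rinv_0_lt_compat, hs2|lra].
    - unfold q. rewrite Rmult_comm. change (s / sqrt (1 + s ^ 2) <= t / sqrt (1 + t ^ 2)).
      apply (proj1 (Rle_div_r _ _ _ hq)).
      replace (s / sqrt (1 + s ^ 2) * sqrt (1 + t ^ 2)) with ((s * sqrt (1 + t ^ 2)) / sqrt (1 + s ^
        2)) by (field; lra).
      apply (proj2 (Rle_div_l _ _ _ hs2)).
      apply Rsqr_incr_0_var; [|apply Rmult_le_pos; lra].
      rewrite !Rsqr_mult, !Rsqr_sqrt by (apply Rlt_le, sq_pos). unfold Rsqr. nra. }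
  assert (h4 := lag_norm_pos alpha m Ha).
  assert (h5 : 0 < Rpower (1 + s ^ 2) (- (1 + alpha) / 2)) by apply exp_pos.
  assert (h6 : 0 <= (/ sqrt (1 + s ^ 2)) ^ m * s ^ m).
  { apply Rmult_le_pos; apply pow_le; [apply Rlt_le, Rinv_0_lt_compat, hs2|lra]. }
  replace (lag_norm alpha m * (Rpower (1 + s ^ 2) (- (1 + alpha) / 2) * (/ sqrt (1 + s ^ 2)) ^ m) * s ^
    m) with
    ((lag_norm alpha m * Rpower (1 + s ^ 2) (- (1 + alpha) / 2)) * ((/ sqrt (1 + s ^ 2)) ^ m * s ^ m))
      by ring.
  apply Rmult_le_compat; [nra|exact h6| |exact h3]. nra. }
(* The factor 2 + alpha covers both indices L and L + 1, since [lag_sq] grows by at most the factor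
   1 + alpha. *)
exists (fun L => (2 + alpha) * ((INR L + 1 + alpha) * lag_sq alpha L * q ^ L)). split.
- replace (Finite 0) with (Rbar_mult (2 + alpha) 0) by (simpl; f_equal; ring).
  apply is_lim_seq_scal_l.
  apply ex_series_lim_0.
  assert (hpos : forall L, 0 < (INR L + 1 + alpha) * lag_sq alpha L * q ^ L).
  { intros L. assert (h := pos_INR L). apply Rmult_lt_0_compat; [apply Rmult_lt_0_compat|apply pow_lt];
      try lra.
    apply lag_sq_pos, Ha. }
  apply (ex_series_ext (fun L => Rabs ((INR L + 1 + alpha) * lag_sq alpha L * q ^ L))).
  { intros L. apply Rabs_pos_eq, Rlt_le, hpos. }
  apply (ex_series_DAlembert _ q hq1).
  + intros L. apply Rgt_not_eq, hpos.
  + apply (is_lim_seq_ext (fun L => q + q * (1 + alpha) * / INR (S L))).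
    { intros L. assert (h := pos_INR L). assert (h1 := lag_sq_pos alpha L Ha). assert (h2 : 0 < q ^ L)
        by (apply pow_lt, hq0).
      rewrite Rabs_pos_eq by (apply Rlt_le, Rdiv_lt_0_compat; apply hpos).
      cbn [lag_sq]. simpl pow. rewrite S_INR. field. repeat split; lra. }
    replace (Finite q) with (Rbar_plus q (Rbar_mult (q * (1 + alpha)) 0)) by (simpl; f_equal; ring).
    apply is_lim_seq_plus'; [apply is_lim_seq_const|].
    apply (is_lim_seq_scal_l (fun L => / INR (S L)) (q * (1 + alpha)) 0).
    apply (is_lim_seq_incr_1 (fun L => / INR L)).
    apply (is_lim_seq_inv INR p_infty); [apply is_lim_seq_INR|discriminate].
- intros L s Hs. assert (h := pos_INR L).
  assert (b1 := hb L s Hs). assert (b2 := hb (S L) s Hs).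
  assert (hj : jac_off alpha L <= INR L + 1 + alpha).
  { unfold jac_off. rewrite <- (sqrt_square (INR L + 1 + alpha)) at 2 by lra. apply sqrt_le_1_alt,
      Rmult_le_compat_r; lra. }
  assert (hj0 : 0 <= jac_off alpha L) by apply sqrt_pos.
  assert (hp : 0 < lag_sq alpha L * q ^ L) by (apply Rmult_lt_0_compat; [apply lag_sq_pos, Ha|apply
    pow_lt, hq0]).
  assert (b3 : lag_sq alpha (S L) * q ^ S L <= (1 + alpha) * (lag_sq alpha L * q ^ L)).
  { cbn [lag_sq]. simpl pow.
    replace ((INR L + 1 + alpha) / (INR L + 1) * lag_sq alpha L * (q * q ^ L)) with
      (((INR L + 1 + alpha) / (INR L + 1) * q) * (lag_sq alpha L * q ^ L)) by ring.
    apply Rmult_le_compat_r; [lra|].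
    assert (h1 : (INR L + 1 + alpha) / (INR L + 1) <= 1 + alpha).
    { assert (h0 : INR L + 1 > 0) by lra. apply (proj2 (Rle_div_l _ _ _ h0)).
      assert (0 <= alpha * INR L) by (apply Rmult_le_pos; lra). lra. }
    assert (h2 : 0 < (INR L + 1 + alpha) / (INR L + 1)) by (apply Rdiv_lt_0_compat; lra). nra. }
  replace ((2 + alpha) * ((INR L + 1 + alpha) * lag_sq alpha L * q ^ L)) with
    ((INR L + 1 + alpha) * (lag_sq alpha L * q ^ L + (1 + alpha) * (lag_sq alpha L * q ^ L))) by ring.
  assert (c1 := Cmod_ge_0 (row_sol alpha 0 L s)). assert (c2 := Cmod_ge_0 (row_sol alpha 0 (S L) s)).
  apply Rmult_le_compat; lra.
Qed.

Lemma gbinom_lag_sq (alpha : R) (n : nat) : gbinom (INR n + alpha) n = lag_sq alpha n.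
Proof.
induction n as [|n IH]; [reflexivity|]. assert (h := pos_INR n).
cbn [gbinom lag_sq]. rewrite S_INR. replace (INR n + 1 + alpha - 1) with (INR n + alpha) by ring.
  rewrite IH. reflexivity.
Qed.

Lemma RtoC_neq_0 (x : R) : x <> 0 -> RtoC x <> 0.
Proof. intros H E. apply H. apply (f_equal fst) in E. exact E. Qed.

Lemma row_eq_row_sol (alpha : R) (U : R -> (nat -> C) -> nat -> C) (n m : nat) :
  0 <= alpha -> is_exp_mit (H alpha) U -> forall t, 0 < t ->
  row U n m t = ((- Ci) ^ n * RtoC (/ lag_norm alpha n) * row_sol alpha n m t)%C.
Proof.
intros Ha HU.
set (cst := ((- Ci) ^ n * RtoC (/ lag_norm alpha n))%C).
assert (Hrow := row_row_ode alpha U n HU).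
assert (HY := row_sol_ode alpha n Ha).
assert (H0 : forall t, 0 < t -> row U n 0 t = (cst * row_sol alpha n 0 t)%C).
{ intros t Ht. destruct (row_sol_decay alpha t Ha Ht) as [e [He1 He2]].
  assert (E0 : row U n 0 t = row_sol alpha 0 n t).
  { apply (green_unique alpha t (row U n) (row_sol alpha 0) n e Ht Hrow (row_sol_ode alpha 0 Ha)); try
      assumption.
    - intros m' s. apply row_bound, HU.
    - intros m'. rewrite row_0 by apply HU. unfold delta. rewrite Nat.eqb_sym. reflexivity.
    - intros m'. apply row_sol_init, Ha. }
  (* Green's identity yields the transposed entry; both are explicit and agree because [gbinom] (n +
     alpha) n is the square of [lag_norm] alpha n. *)
  rewrite E0. unfold row_sol, cst. rewrite ker_poly_col0. cbn [ker_poly]. rewrite gbinom_lag_sq.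
  assert (h := lag_norm_pos alpha n Ha).
  assert (E : lag_sq alpha n = lag_norm alpha n * lag_norm alpha n).
  { symmetry. apply sqrt_sqrt, Rlt_le, lag_sq_pos, Ha. }
  rewrite E, !RtoC_mult, RtoC_inv by lra. replace (lag_norm alpha 0) with 1 by (unfold lag_norm; cbn
    [lag_sq]; rewrite sqrt_1; reflexivity).
  simpl Cpow. field. apply RtoC_neq_0. lra. }
(* Agreement on the open half line can be differentiated. The two equations then have equal right
   sides, and dividing by the nonzero off-diagonal coefficient gives the next index. *)
assert (Step : forall k, (forall t, 0 < t -> row U n k t = (cst * row_sol alpha n k t)%C) -> forall t,
  0 < t ->
   tau alpha (fun j => row U n j t) k = (cst * tau alpha (fun j => row_sol alpha n j t) k)%C).
{ intros k Hk t Ht.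
  assert (D1 := Hrow k t).
  assert (D2 : cder (row U n k) t (cst * (- Ci * tau alpha (fun j => row_sol alpha n j t) k))%C).
  { apply (cder_ext_loc (fun s => cst * row_sol alpha n k s)%C).
    - apply (filter_imp (fun s => 0 < s)); [|apply open_gt, Ht]. intros s Hs. symmetry. apply Hk, Hs.
    - eapply cder_eq; [apply cder_mult; [apply cder_const|apply HY]|]. cbv beta. ring. }
  assert (E := cder_unique _ _ _ _ D1 D2).
  apply (f_equal (fun z => Ci * z)%C) in E.
  assert (EC : (Ci * Ci)%C = (- (1))%C) by (unfold Ci, Cmult, Copp, RtoC; simpl; f_equal; ring).
  transitivity (- (Ci * Ci) * tau alpha (fun j => row U n j t) k)%C; [rewrite EC; ring|].
  transitivity (- (Ci * Ci) * (cst * tau alpha (fun j => row_sol alpha n j t) k))%C; [|rewrite EC; ring].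
  transitivity (Ci * (- Ci * tau alpha (fun j => row U n j t) k))%C; [ring|]. rewrite E. ring. }
assert (hja : forall k, RtoC (jac_off alpha k) <> 0).
{ intros k. apply RtoC_neq_0, Rgt_not_eq, sqrt_lt_R0. assert (h := pos_INR k). nra. }
assert (Next : forall k x x', (RtoC (jac_off alpha k) * x = RtoC (jac_off alpha k) * x')%C -> x = x').
{ intros k x x' E. apply (f_equal (fun z => / RtoC (jac_off alpha k) * z)%C) in E.
  rewrite !Cmult_assoc, Cinv_l, !Cmult_1_l in E by apply hja. exact E. }
assert (Main : forall k, (forall t, 0 < t -> row U n k t = (cst * row_sol alpha n k t)%C) /\
  (forall t, 0 < t -> row U n (S k) t = (cst * row_sol alpha n (S k) t)%C)).
{ induction k as [|k [IH1 IH2]].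
  - split; [exact H0|]. intros t Ht. assert (E := Step O H0 t Ht). rewrite !tau_O, H0 in E by exact Ht.
    apply (Next O). 
    transitivity ((RtoC (2 * INR 0 + 1 + alpha) * (cst * row_sol alpha n 0 t) + RtoC (jac_off alpha 0)
      * row U n 1 t)
      - RtoC (2 * INR 0 + 1 + alpha) * (cst * row_sol alpha n 0 t))%C; [ring|]. rewrite E. ring.
  - split; [exact IH2|]. intros t Ht. assert (E := Step (S k) IH2 t Ht). rewrite !tau_S, IH1, IH2 in E
      by exact Ht.
    apply (Next (S k)).
    transitivity ((RtoC (jac_off alpha k) * (cst * row_sol alpha n k t) + RtoC (2 * INR (S k) + 1 +
      alpha) * (cst * row_sol alpha n (S k) t)
       + RtoC (jac_off alpha (S k)) * row U n (S (S k)) t)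
      - (RtoC (jac_off alpha k) * (cst * row_sol alpha n k t) + RtoC (2 * INR (S k) + 1 + alpha) * (cst
          * row_sol alpha n (S k) t)))%C; [ring|].
    rewrite E. ring. }
intros t Ht. apply (proj1 (Main m)), Ht.
Qed.

(** * From the closed form to the dispersive bound *)

Lemma row_sq (alpha t : R) (U : R -> (nat -> C) -> nat -> C) (n m : nat) :
  0 <= alpha -> is_exp_mit (H alpha) U -> 0 < t ->
  Cmod (row U n m t) ^ 2 = lag_sq alpha m / lag_sq alpha n * Rpower (1 + t ^ 2) (- (1 + (INR n + alpha)
    + INR m)) *
    ker_poly (INR n + alpha) t m n ^ 2.
Proof.
intros Ha HU Ht. rewrite (row_eq_row_sol alpha U n m Ha HU t Ht).
assert (hn := lag_norm_pos alpha n Ha). assert (hs1 := sq_pos t).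
rewrite !Cmod_mult, Cmod_Ci_pow, Cmod_R, row_sol_Cmod by exact Ha.
rewrite (Rabs_pos_eq (/ _)) by apply Rlt_le, Rinv_0_lt_compat, hn.
set (q := 1 + t ^ 2) in *.
assert (E : Rpower q (- (1 + alpha) / 2) * (/ sqrt q) ^ (m + n) =
   Rpower q (- (1 + (INR n + alpha) + INR m) / 2)).
{ rewrite <- Rpower_sqrt, <- Rpower_Ropp, <- Rpower_pow by (try apply exp_pos; exact hs1).
  rewrite Rpower_mult, <- Rpower_plus. f_equal. rewrite plus_INR. field. }
rewrite E.
replace (Rpower q (- (1 + (INR n + alpha) + INR m))) with
  (Rpower q (- (1 + (INR n + alpha) + INR m) / 2) * Rpower q (- (1 + (INR n + alpha) + INR m) / 2)).
2:{ rewrite <- Rpower_plus. f_equal. field. }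
assert (E1 : lag_sq alpha n = lag_norm alpha n * lag_norm alpha n).
{ symmetry. apply sqrt_sqrt, Rlt_le, lag_sq_pos, Ha. }
assert (E2 : lag_sq alpha m = lag_norm alpha m * lag_norm alpha m).
{ symmetry. apply sqrt_sqrt, Rlt_le, lag_sq_pos, Ha. }
rewrite E1, E2, <- (pow2_abs (ker_poly _ t m n)). field. lra.
Qed.

(** For the entry (0, 0), whose squared modulus is (1 + t^2)^(-(1 + alpha)). It follows from exp x
    >= 1 + x used twice. *)
Lemma bernoulli_Rpower (alpha u : R) : 0 <= alpha -> 0 <= u -> 1 + (1 + alpha) * u <= Rpower (1 + u) (1
  + alpha).
Proof.
intros Ha Hu. rewrite Rpower_plus, Rpower_1 by lra.
assert (h1 : 1 - ln (1 + u) <= / (1 + u)).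
{ assert (h := exp_ineq1_le (- ln (1 + u))). rewrite exp_Ropp, exp_ln in h by lra. lra. }
assert (h2 : 1 + alpha * ln (1 + u) <= Rpower (1 + u) alpha) by apply exp_ineq1_le.
assert (h3 : (1 + u) * (1 - / (1 + u)) = u) by (field; lra).
assert (h4 : u <= (1 + u) * ln (1 + u)) by (rewrite <- h3 at 1; apply Rmult_le_compat_l; lra).
apply Rle_trans with ((1 + u) * (1 + alpha * ln (1 + u))); [nra|]. apply Rmult_le_compat_l; lra.
Qed.

Lemma row_sq_bound (alpha t : R) (U : R -> (nat -> C) -> nat -> C) (n m : nat) :
  0 <= alpha -> is_exp_mit (H alpha) U -> 0 < t ->
  Cmod (row U n m t) ^ 2 <= 16 / (t * sqrt (INR n + INR m + alpha + 1)).
Proof.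
intros Ha HU Ht. rewrite (row_sq alpha t U n m Ha HU Ht).
assert (E : forall P i j, ker_poly P t i j = t ^ j / t ^ i * ker_coef (t ^ 2) P i j).
{ intros P i j. assert (h := ker_poly_coef P t i j). assert (hi : t ^ i <> 0) by (apply pow_nonzero; lra).
  apply Rmult_eq_reg_r with (t ^ i); [|exact hi]. rewrite h. field. exact hi. }
(* [kernel_sq_bound] asks for 1 <= n. The row n = 0 is treated by Bernoulli's inequality for m = 0
   and by transposition for m > 0. *)
destruct n as [|n]; [|rewrite E; apply kernel_sq_bound; [exact Ha|exact Ht|lia]].
rewrite ker_poly_col0. destruct m as [|m].
- simpl INR. cbn [lag_sq]. rewrite pow_O, !Rplus_0_l, Rplus_0_r.
  assert (hb := bernoulli_Rpower alpha (t ^ 2) Ha (pow2_ge_0 t)).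
  assert (h1 : 0 < sqrt (alpha + 1)) by (apply sqrt_lt_R0; lra).
  assert (h2 : sqrt (alpha + 1) * sqrt (alpha + 1) = alpha + 1) by (apply sqrt_sqrt; lra).
  assert (h3 : 0 < t * sqrt (alpha + 1)) by (apply Rmult_lt_0_compat; assumption).
  rewrite Rpower_Ropp. replace (1 / 1 * / Rpower (1 + t ^ 2) (1 + alpha) * 1 ^ 2) with (/ Rpower (1 + t
    ^ 2) (1 + alpha)) by (field; apply Rgt_not_eq, exp_pos).
  apply Rle_trans with (/ (t * sqrt (alpha + 1))).
  + apply Rinv_le_contravar; [exact h3|]. apply Rle_trans with (2 := hb).
    replace ((1 + alpha) * t ^ 2) with ((t * sqrt (alpha + 1)) * (t * sqrt (alpha + 1))).
    2:{ transitivity (t ^ 2 * (sqrt (alpha + 1) * sqrt (alpha + 1))); [ring|]. rewrite h2. ring. }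
    assert (h4 := pow2_ge_0 (t * sqrt (alpha + 1) - 1)). nra.
  + assert (0 < / (t * sqrt (alpha + 1))) by (apply Rinv_0_lt_compat, h3). unfold Rdiv. lra.
(* Applied to the transposed entry, whose squared modulus has the same closed form. *)
- assert (h := kernel_sq_bound alpha t 0 (S m) Ha Ht ltac:(lia)). cbv zeta in h.
  cbn [ker_coef] in h. rewrite gbinom_lag_sq in h.
  assert (hp := lag_sq_pos alpha (S m) Ha).
  change (INR 0) with 0 in *. change (lag_sq alpha 0) with 1 in *.
  replace (0 + INR (S m) + alpha + 1) with (INR (S m) + 0 + alpha + 1) by ring.
  apply Rle_trans with (2 := h). right.
  replace (1 + (0 + alpha) + INR (S m)) with (1 + (INR (S m) + alpha) + 0) by ring.
  set (q := t ^ S m). rewrite pow_O. field. lra.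
Qed.

Theorem theorem6p3 (alpha : R) (halpha : 0 <= alpha) :
  exists C0 : R, 0 < C0 /\ C0 < 6 * sqrt 2 /\
    forall U : R -> (nat -> C) -> (nat -> C), is_exp_mit (H alpha) U ->
    forall (n m : nat) (t : R), t <> 0 ->
      Cmod (matrix_entry (U t) n m)
        <= C0 * Rpower (Rabs t) (- (1 / 2))
             / Rpower (INR n + INR m + alpha + 1) (1 / 4).
Proof.
(* The square root of the constant 16 of [row_sq_bound]. *)
exists 4. split; [lra|]. split.
{ assert (1 <= sqrt 2) by (rewrite <- sqrt_1 at 1; apply sqrt_le_1_alt; lra). lra. }
intros U HU.
assert (Pos : forall n m t, 0 < t -> Cmod (row U n m t) <=
  4 * Rpower t (- (1 / 2)) / Rpower (INR n + INR m + alpha + 1) (1 / 4)).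
{ intros n m t Ht.
  assert (hN : 0 < INR n + INR m + alpha + 1).
  { assert (h1 := pos_INR n). assert (h2 := pos_INR m). lra. }
  set (N := INR n + INR m + alpha + 1) in *.
  assert (h1 : 0 < Rpower t (- (1 / 2))) by apply exp_pos.
  assert (h2 : 0 < Rpower N (1 / 4)) by apply exp_pos.
  apply Rsqr_incr_0_var; [|apply Rlt_le, Rdiv_lt_0_compat; lra].
  assert (E1 : Rpower t (- (1 / 2)) * Rpower t (- (1 / 2)) = / t).
  { rewrite <- Rpower_plus. replace (- (1 / 2) + - (1 / 2)) with (- (1)) by field.
    rewrite Rpower_Ropp, Rpower_1 by exact Ht. reflexivity. }
  assert (E2 : Rpower N (1 / 4) * Rpower N (1 / 4) = sqrt N).
  { rewrite <- Rpower_plus, <- Rpower_sqrt by exact hN. f_equal. field. }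
  assert (hsN := sqrt_lt_R0 _ hN).
  replace (Rsqr (4 * Rpower t (- (1 / 2)) / Rpower N (1 / 4))) with (16 / (t * sqrt N)).
  2:{ transitivity (16 * (Rpower t (- (1 / 2)) * Rpower t (- (1 / 2))) / (Rpower N (1 / 4) * Rpower N
    (1 / 4))).
      - rewrite E1, E2. field. lra.
      - unfold Rsqr. field. lra. }
  replace (Rsqr (Cmod (row U n m t))) with (Cmod (row U n m t) ^ 2) by (unfold Rsqr; ring).
  apply row_sq_bound; assumption. }
intros n m t Ht. rewrite matrix_entry_row.
destruct (Rlt_le_dec 0 t) as [h|h].
- rewrite Rabs_pos_eq by lra. apply Pos, h.
- rewrite row_swap by apply HU. rewrite Rabs_left by lra.
  rewrite (Rplus_comm (INR n)). apply Pos. lra.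
Qed.
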